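(* Let $z\in\mathbb C\setminus\mathbb R$. Assume the Non-Generic Case, i.e. $\lambda=0$ is an eigenvalue of the auxiliary Hamiltonian $\mathring H^{in}$, and let $\widehat C_0$ be the restriction of $\widehat C$ to $\operatorname{Ran}\widehat P$. (i) If $\operatorname{Ker}\widehat C$ is a proper subspace of $\mathbb C^N$, then $\widehat C_0$ is invertible as an operator in $\widehat P\mathbb C^N$, and $$(H^\varepsilon - z)^{-1} = \begin{pmatrix} (\widehat H^{out} - z)^{-1} & \mathbb O\\ \mathbb O & -z^{-1}\sum_{k,k'=1}^m\big(\delta_{k,k'}-(\underline{\hat c}_k,\widehat C_0^{-1}\underline{\hat c}_{k'})_{\mathbb C^N}\big)\,\hat\varphi_k^\varepsilon(\hat\varphi_{k'}^\varepsilon,\cdot)_{\mathcal H^{in,\varepsilon}}\end{pmatrix}+\mathcal O_{\mathcal B(\mathcal H^\varepsilon)}(\varepsilon^{1/2}),\qquad( * )$$ where the block matrix is understood in the decomposition $\mathcal H^\varepsilon=\mathcal H^{out}\oplus\mathcal H^{in,\varepsilon}$. (ii) If $\operatorname{Ker}\widehat C=\mathbb C^N$, then $\widehat P=0$, and the expansion $( * )$ holds true with $\widehat H^{out}=\mathring H^{out}$, with $(\underline{\hat c}_k,\widehat C_0^{-1}\underline{\hat c}_{k'})_{\mathbb C^N}$ replaced by $0$ for all $k,k'=1,\dots,m$, and with the error term changed to $\mathcal O_{\mathcal B(\mathcal H^\varepsilon)}(\varepsilon)$. (iii) If the vectors $\underline{\hat c}_k$, $k=1,\dots,m$, are linearly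 independent, then $\delta_{k,k'}-(\underline{\hat c}_k,\widehat C_0^{-1}\underline{\hat c}_{k'})_{\mathbb C^N}=0$ for all $k,k'=1,\dots,m$, and $$(H^\varepsilon - z)^{-1} = \begin{pmatrix} (\widehat H^{out} - z)^{-1} & \mathbb O\\ \mathbb O & \mathbb O\end{pmatrix}+\mathcal O_{\mathcal B(\mathcal H^\varepsilon)}(\varepsilon^{1/2}).$$
   Context: **Functions on metric graphs.** Metric graphs have finitely many edges and vertices; each edge $e$ is identified with $[0,\ell_e]$ (finite length $\ell_e>0$) or $[0,+\infty)$. A function $\psi$ on a graph is the collection of its restrictions $\psi_e$ to the edges. For a vertex $v$, $d(v)$ is its degree (number of edge ends at $v$, loops counted twice). For $\psi\in\bigoplus_e H^2(e)$, $\Psi(v)\in\mathbb C^{d(v)}$ is the vector of boundary values ($\psi_e(0)$ or $\psi_e(\ell_e)$) of $\psi$ at the edge ends at $v$, and $\Psi'(v)\in\mathbb C^{d(v)}$ is the vector, in the same order, of derivatives in the outgoing direction ($\psi_e'(0)$ or $-\psi_e'(\ell_e)$). Scalar products are antilinear in the first argument. For an orthogonal projection $P$, $P^\perp$ denotes identity minus $P$. **Inner graph.** $\mathcal G^{in}$ is a compact metric graph (all edges of finite length), $0<\varepsilon<1$, and $\mathcal G^{in,\varepsilon}=\varepsilon\mathcal G^{in}$ (all lengths multiplied by $\varepsilon$). $N$ distinct vertices $v_1,\dots,v_N$ of $\mathcal G^{in}$ are selected, called connecting vertices; $\mathcal C$ is their set, and $\mathcal V^{in}$ is the (possibly empty)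 set of remaining vertices. For $v\in\mathcal C$, $d^{in}(v)$ is the degree of $v$ in $\mathcal G^{in}$. For each $v\in\mathcal V^{in}$ an orthogonal projection $P^{in}_v$ in $\mathbb C^{d(v)}$ and a self-adjoint operator $\Theta^{in}_v$ in $\operatorname{Ran}P^{in}_v$ are fixed, and $\Theta^{in,\varepsilon}_v=\varepsilon^{-1}\Theta^{in}_v$. $B^{in}:\mathcal G^{in}\to\mathbb R$ is bounded and $B^{in,\varepsilon}(x)=\varepsilon^{-2}B^{in}(x/\varepsilon)$ for $x\in\mathcal G^{in,\varepsilon}$. $\mathcal H^{in,\varepsilon}$ and $\mathcal H_2^{in,\varepsilon}$ are the direct sums of $L^2(e)$, resp. $H^2(e)$, over the edges of $\mathcal G^{in,\varepsilon}$; $\mathcal H^{in}$, $\mathcal H^{in}_2$ are these spaces for $\varepsilon=1$. **Outer graph and full graph.** The graph $\mathcal G^\varepsilon$ is obtained from $\mathcal G^{in,\varepsilon}$ by attaching to each $v_j$ one outer edge $e_j$ (of finite length independent of $\varepsilon$, or a half-line), with $v_j$ corresponding to $x=0$ on $e_j$, $j=1,\dots,N$. The other endpoint of each finite outer edge is a vertex of degree one; $\mathcal V^{out}$ is the set of these. The degree of $v\in\mathcal C$ in $\mathcal G^\varepsilon$ is $d(v)=d^{in}(v)+1$. $\mathcal G^{out}$ is the star-graph formed by the $e_j$ joined at $x=0$. $\mathcal H^{out}=\bigoplus_j L^2(e_j)$, $\mathcal H^{out}_2=\bigoplus_j H^2(e_j)$, $\mathcal H^\varepsilon=\mathcal H^{out}\oplus\mathcal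 H^{in,\varepsilon}$, $\mathcal H^\varepsilon_2=\mathcal H_2^{out}\oplus\mathcal H_2^{in,\varepsilon}$. For $\psi\in\mathcal H^{out}_2$ with components $\psi_j$: $\Psi(\mathbf 0)=(\psi_1(0),\dots,\psi_N(0))^T$, $\Psi'(\mathbf 0)=(\psi_1'(0),\dots,\psi_N'(0))^T$. For $v\in\mathcal V^{out}$ an orthogonal projection $P^{out}_v:\mathbb C\to\mathbb C$ and a self-adjoint operator $\Theta^{out}_v$ in $\operatorname{Ran}P^{out}_v$ are fixed. $B^{out}:\mathcal G^{out}\to\mathbb R$ is bounded and compactly supported; $B^\varepsilon=(B^{out},B^{in,\varepsilon})$. All data except the explicit scaling are independent of $\varepsilon$. **Kirchhoff projections.** For $v\in\mathcal C$, $K_v$ is the orthogonal projection in $\mathbb C^{d(v)}$ onto the span of $(1,\dots,1)$, and $K_v^{in}$ is the orthogonal projection in $\mathbb C^{d^{in}(v)}$ onto the span of $(1,\dots,1)$. **Operators.** - $H^\varepsilon$ in $\mathcal H^\varepsilon$: $H^\varepsilon\psi=-\psi''+B^\varepsilon\psi$, with domain the $\psi\in\mathcal H_2^\varepsilon$ such that ${P_v^{in}}^\perp\Psi(v)=0$, $P_v^{in}\Psi'(v)-\Theta_v^{in,\varepsilon}P_v^{in}\Psi(v)=0$ for all $v\in\mathcal V^{in}$; ${P_v^{out}}^\perp\Psi(v)=0$, $P_v^{out}\Psi'(v)-\Theta_v^{out}P_v^{out}\Psi(v)=0$ for all $v\in\mathcal V^{out}$; $K_v^\perp\Psi(v)=0$,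 $K_v\Psi'(v)=0$ for all $v\in\mathcal C$. - Auxiliary Hamiltonian $\mathring H^{in}$ in $\mathcal H^{in}$: $\mathring H^{in}\psi=-\psi''+B^{in}\psi$, with domain the $\psi\in\mathcal H_2^{in}$ such that ${P_v^{in}}^\perp\Psi(v)=0$, $P_v^{in}\Psi'(v)-\Theta_v^{in}P_v^{in}\Psi(v)=0$ for all $v\in\mathcal V^{in}$; ${K_v^{in}}^\perp\Psi(v)=0$, $K_v^{in}\Psi'(v)=0$ for all $v\in\mathcal C$. Its spectrum consists of isolated eigenvalues of finite multiplicity; functions in its domain are continuous at connecting vertices. - $\mathring H^{out}$ in $\mathcal H^{out}$: $\mathring H^{out}\psi=-\psi''+B^{out}\psi$, with domain the $\psi\in\mathcal H_2^{out}$ such that ${P_v^{out}}^\perp\Psi(v)=0$, $P_v^{out}\Psi'(v)-\Theta_v^{out}P_v^{out}\Psi(v)=0$ for all $v\in\mathcal V^{out}$, and $\Psi(\mathbf 0)=0$. - $\widehat H^{out}$ in $\mathcal H^{out}$ (with $\widehat P$ defined below): $\widehat H^{out}\psi=-\psi''+B^{out}\psi$, with domain the $\psi\in\mathcal H_2^{out}$ satisfying the same conditions at all $v\in\mathcal V^{out}$ as for $\mathring H^{out}$, and $\widehat P^\perp\Psi(\mathbf 0)=0$, $\widehat P\Psi'(\mathbf 0)=0$. These operators are self-adjoint. **Zero eigenvalue data (Non-Generic Case).** $\{\hat\varphi_k\}_{k=1,\dots,m}$ is an orthonormal basis of the zero eigenspace of $\mathring H^{in}$; $\hat\varphi_k^\varepsilon(x)=\varepsilon^{-1/2}\hat\varphi_k(x/\varepsilon)$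 for $x\in\mathcal G^{in,\varepsilon}$; $\underline{\hat c}_k=(\hat\varphi_k(v_1),\dots,\hat\varphi_k(v_N))\in\mathbb C^N$; $\widehat C=\sum_{k=1}^m\underline{\hat c}_k(\underline{\hat c}_k,\cdot)_{\mathbb C^N}$, a Hermitian $N\times N$ matrix; $\widehat P$ is the orthogonal projection in $\mathbb C^N$ onto $\operatorname{Ran}\widehat C$. One has $\underline{\hat c}_k\in\operatorname{Ran}\widehat C$. **Notation.** $\mathcal B(X,Y)$ is the space of bounded linear operators $X\to Y$, $\mathcal B(X)=\mathcal B(X,X)$. $\mathcal O_{\mathcal B(X,Y)}(\varepsilon^a)$ denotes an operator $X\to Y$ whose norm is at most $C\varepsilon^a$ for all sufficiently small $\varepsilon$, with $C$ independent of $\varepsilon$ ($z$ is fixed). $\mathbb O$ is a zero operator. *)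

(* Defs.v *)
From HB Require Import structures.
From mathcomp Require Import all_boot all_order all_algebra.
From mathcomp Require Import complex.
From mathcomp Require Import all_classical all_reals all_analysis.
Set Implicit Arguments.
Unset Strict Implicit.
Unset Printing Implicit Defensive.
Import Order.TTheory GRing.Theory Num.Theory.
Import numFieldNormedType.Exports.
Local Open Scope classical_set_scope.
Local Open Scope ring_scope.
Local Open Scope complex_scope.

Section LinearAlgebra.
Variables (R : realType) (n : nat).
Implicit Types (A P Theta : 'M[R[i]]_n) (u v : 'cV[R[i]]_n).

(* Antilinear in the first argument. *)
Definition cdot u v : R[i] := \sum_i (u i 0)^* * v i 0.

Definition adjmx A : 'M[R[i]]_n := map_mx Num.conj A^T.

Definition mxran A : set 'cV[R[i]]_n := range (mulmx A).

Definition mxker A : set 'cV[R[i]]_n := [set u | A *m u = 0].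

Definition orth_projection P : Prop := P *m P = P /\ adjmx P = P.

(* A self-adjoint operator in [Ran P] is encoded by its extension by zero to
   the orthogonal complement of [Ran P]. *)
Definition selfadjoint_in P Theta : Prop :=
  P *m Theta *m P = Theta /\ adjmx Theta = Theta.

(* [P^perp Psi = 0] and [P Psi' - Theta P Psi = 0]. *)
Definition vertex_cond P Theta (Psi Psi' : 'cV[R[i]]_n) : Prop :=
  (1%:M - P) *m Psi = 0 /\ P *m Psi' - Theta *m (P *m Psi) = 0.

(* The orthogonal projection onto the span of [(1, ..., 1)], for [0 < n]. *)
Definition kirchhoff_proj : 'M[R[i]]_n := const_mx n%:R^-1.

(* The value at [w] of the inverse of [A] restricted to [Ran P]; meaningful
   when [A] maps [Ran P] bijectively onto itself. *)
Definition restr_inv A P (w : 'cV[R[i]]_n) : 'cV[R[i]]_n :=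
  xget 0 [set u | mxran P u /\ A *m u = w].

End LinearAlgebra.

Arguments kirchhoff_proj R n : clear implicits.

(* [Some a] stands for an edge of length [a], [None] for a half-line. *)
Definition edge (R : realType) (l : option R) : set R :=
  if l is Some a then [set x | 0 <= x <= a] else [set x | 0 <= x].

(* A function on a graph is the family of its restrictions to the edges; only
   the values on the edges matter. *)
Definition gfun (R : realType) (I : Type) : Type := I -> R -> R[i].

Section FunctionSpaces.
Variable R : realType.

Local Notation leb := (@lebesgue_measure R).

Definition sqmod (w : R[i]) : R := complex.Re w ^+ 2 + complex.Im w ^+ 2.

Definition cintegral (D : set R) (f : R -> R[i]) : R[i] :=
  (\int[leb]_(x in D) complex.Re (f x)) +i*
  (\int[leb]_(x in D) complex.Im (f x)).

Definition in_L2 (D : set R) (f : R -> R[i]) : Prop :=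
  ((fun x => complex.Re (f x)) \_ D \in Lfun leb 2%:E) /\
  ((fun x => complex.Im (f x)) \_ D \in Lfun leb 2%:E).

Definition eq_ae (D : set R) (f g : R -> R[i]) : Prop :=
  {ae leb, forall x, D x -> f x = g x}.

Definition primitive_of (D : set R) (f g : R -> R[i]) : Prop :=
  forall x, D x -> f x = f 0 + cintegral `[0, x]%classic g.

(* [f] is the [C^1] representative of a function of class [H^2] on the interval
   [D] (which starts at [0]), with first derivative [f1] (the continuous
   representative) and second derivative [f2]. *)
Definition in_H2 (D : set R) (f f1 f2 : R -> R[i]) : Prop :=
  [/\ in_L2 D f, in_L2 D f1, in_L2 D f2,
      primitive_of D f f1 & primitive_of D f1 f2].

Section Family.
Variable I : finType.
Implicit Types (l : I -> option R) (f g : gfun R I).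

Definition gL2 l f : Prop := forall i, in_L2 (edge (l i)) (f i).

Definition geq_ae l f g : Prop := forall i, eq_ae (edge (l i)) (f i) (g i).

(* Antilinear in the first argument. *)
Definition gdot l f g : R[i] :=
  \sum_i cintegral (edge (l i)) (fun x => (f i x)^* * g i x).

Definition gnorm l f : R :=
  Num.sqrt (\sum_i \int[leb]_(x in edge (l i)) sqmod (f i x)).

Definition gzero : gfun R I := fun _ _ => 0.

Definition gaxpy (a : R[i]) f g : gfun R I := fun i x => a * f i x + g i x.

Definition gsub f g : gfun R I := fun i x => f i x - g i x.

(* A possibly unbounded operator [A] is given by its graph: [A psi eta] reads
   "psi is in the domain of A and A psi = eta in L^2". *)
Definition gop : Type := gfun R I -> gfun R I -> Prop.

(* [psi |-> - psi'' + B psi], with a boundary condition on [psi] and [psi']. *)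
Definition schrodinger l (B : I -> R -> R)
    (bc : gfun R I -> gfun R I -> Prop) : gop := fun psi eta =>
  exists psi1 psi2 : gfun R I,
    [/\ forall i, in_H2 (edge (l i)) (psi i) (psi1 i) (psi2 i),
        bc psi psi1
      & geq_ae l eta (fun i x => - psi2 i x + (B i x)%:C * psi i x)].

(* [A - z] is a bijection from the domain of [A] onto [L^2], with bounded
   inverse. *)
Definition resolvent_set l (A : gop) (z : R[i]) : Prop :=
  [/\ forall f, gL2 l f -> exists psi, A psi (gaxpy z psi f),
      forall f psi psi', gL2 l f ->
        A psi (gaxpy z psi f) -> A psi' (gaxpy z psi' f) -> geq_ae l psi psi'
    & exists M : R, forall f psi, gL2 l f ->
        A psi (gaxpy z psi f) -> gnorm l psi <= M * gnorm l f].

(* [(A - z)^-1 f], for [z] in the resolvent set of [A]. *)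
Definition resolvent (A : gop) (z : R[i]) (f : gfun R I) : gfun R I :=
  xget gzero [set psi | A psi (gaxpy z psi f)].

Definition has_eigenvalue l (A : gop) (lambda : R) : Prop :=
  exists psi, A psi (gaxpy lambda%:C psi gzero) /\ ~ geq_ae l psi gzero.

Definition zero_eigenbasis l (A : gop) m (phi : 'I_m -> gfun R I) : Prop :=
  [/\ forall k, A (phi k) gzero,
      forall k k', gdot l (phi k) (phi k') = (k == k')%:R
    & forall psi, A psi gzero -> exists a : 'I_m -> R[i],
        geq_ae l psi (fun i x => \sum_k a k * phi k i x)].

(* For small [eps], [T eps] is a linear operator in [L^2] (of the graph with
   edge lengths [l eps]) of norm at most [M * eps `^ a]. *)
Definition bigO_op (l : R -> I -> option R)
    (T : R -> gfun R I -> gfun R I) (a : R) : Prop :=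
  exists M eps0 : R, 0 < eps0 /\
    forall eps, 0 < eps -> eps < 1 -> eps < eps0 ->
      [/\ forall c f g, gL2 (l eps) f -> gL2 (l eps) g ->
            geq_ae (l eps) (T eps (gaxpy c f g))
              (gaxpy c (T eps f) (T eps g)),
          forall f, gL2 (l eps) f -> gL2 (l eps) (T eps f)
        & forall f, gL2 (l eps) f ->
            gnorm (l eps) (T eps f) <= M * eps `^ a * gnorm (l eps) f].

End Family.
End FunctionSpaces.

Section Ends.
Variables (R : realType) (E V : finType) (endpt : E * bool -> V).

(* [(e, false)] is the end [x = 0] of the edge [e], [(e, true)] is the end
   [x = l e]; a loop contributes two ends to its vertex. *)
Definition ends (v : V) : {set E * bool} := [set h | endpt h == v].

Definition degree (v : V) : nat := #|ends v|.

Variable l : E -> R.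
Implicit Types psi : gfun R E.

Definition end_value psi (h : E * bool) : R[i] :=
  psi h.1 (if h.2 then l h.1 else 0).

Definition bvalues psi (v : V) : 'cV[R[i]]_(degree v) :=
  \col_i end_value psi (enum_val i).

(* Derivatives in the outgoing direction; the argument is [psi']. *)
Definition bderivs (psi1 : gfun R E) (v : V) : 'cV[R[i]]_(degree v) :=
  \col_i (let h := enum_val i in
          if h.2 then - end_value psi1 h else end_value psi1 h).

(* The value at [v] of a function that is continuous at [v]. *)
Definition vertex_value psi (v : V) : R[i] :=
  if [pick h in ends v] is Some h then end_value psi h else 0.

End Ends.

Record qgraph (R : realType) (N : nat) := QGraph {
  iedge : finType;
  ivert : finType;
  ilen : iedge -> R;
  ilen_gt0 : forall e, 0 < ilen e;
  iend : iedge * bool -> ivert;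
  conn : 'I_N -> ivert;
  conn_inj : injective conn;
  conn_degree : forall j, (0 < degree iend (conn j))%N;
  (* used only at the vertices which are not connecting vertices *)
  Pin : forall v, 'M[R[i]]_(degree iend v);
  Thetain : forall v, 'M[R[i]]_(degree iend v);
  Pin_proj : forall v, v \notin codom conn -> orth_projection (Pin v);
  Thetain_sa : forall v, v \notin codom conn ->
    selfadjoint_in (Pin v) (Thetain v);
  Bin : iedge -> R -> R;
  Bin_meas : forall e, measurable_fun (edge (Some (ilen e))) (Bin e);
  Bin_bounded : exists M : R, forall e x,
    edge (Some (ilen e)) x -> `|Bin e x| <= M;
  (* the outer edge [j] is attached at [x = 0] to [conn j] *)
  olen : 'I_N -> option R;
  olen_gt0 : forall j a, olen j = Some a -> 0 < a;
  (* used only at the finite outer edges *)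
  Pout : 'I_N -> 'M[R[i]]_1;
  Thetaout : 'I_N -> 'M[R[i]]_1;
  Pout_proj : forall j, olen j <> None -> orth_projection (Pout j);
  Thetaout_sa : forall j, olen j <> None ->
    selfadjoint_in (Pout j) (Thetaout j);
  Bout : 'I_N -> R -> R;
  Bout_meas : forall j, measurable_fun (edge (olen j)) (Bout j);
  Bout_bounded : exists M : R, forall j x,
    edge (olen j) x -> `|Bout j x| <= M;
  Bout_compact : exists r : R, forall j x,
    edge (olen j) x -> r < x -> Bout j x = 0
}.

Arguments ilen {R N} q _.
Arguments iend {R N} q _.
Arguments conn {R N} q _.
Arguments Pin {R N} q v.
Arguments Thetain {R N} q v.
Arguments Bin {R N} q _ _.

Section Hamiltonians.
Variables (R : realType) (N : nat) (G : qgraph R N).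

Definition ilens (eps : R) : iedge G -> R := fun e => eps * ilen G e.

Definition iedges : iedge G -> option R := fun e => Some (ilen G e).

Definition iedges_eps (eps : R) : iedge G -> option R :=
  fun e => Some (ilens eps e).

(* [G^eps] has edge set [outer edges + inner edges]. *)
Definition fedges (eps : R) (i : 'I_N + iedge G) : option R :=
  match i with inl j => olen G j | inr e => iedges_eps eps e end.

Definition fouter (psi : gfun R ('I_N + iedge G)) : gfun R 'I_N :=
  fun j => psi (inl j).

Definition finner (psi : gfun R ('I_N + iedge G)) : gfun R (iedge G) :=
  fun e => psi (inr e).

Definition blockdiag (S : gfun R 'I_N -> gfun R 'I_N)
    (T : gfun R (iedge G) -> gfun R (iedge G))
    (f : gfun R ('I_N + iedge G)) : gfun R ('I_N + iedge G) :=
  fun i => match i with inl j => S (fouter f) j | inr e => T (finner f) e end.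

Definition Bin_eps (eps : R) (e : iedge G) (x : R) : R :=
  eps ^- 2 * Bin G e (x / eps).

Definition Bfull_eps (eps : R) (i : 'I_N + iedge G) (x : R) : R :=
  match i with inl j => Bout G j x | inr e => Bin_eps eps e x end.

Definition values0 (psi : gfun R 'I_N) : 'cV[R[i]]_N := \col_j psi j 0.

Definition bc_Vout (psi psi1 : gfun R 'I_N) : Prop :=
  forall j a, olen G j = Some a ->
    vertex_cond (Pout G j) (Thetaout G j)
      (const_mx (psi j a)) (const_mx (- psi1 j a)).

Definition bc_Vin_eps (eps : R) (psi psi1 : gfun R (iedge G)) : Prop :=
  forall v, v \notin codom (conn G) ->
    vertex_cond (Pin G v) ((eps^-1)%:C *: Thetain G v)
      (bvalues (iend G) (ilens eps) psi v)
      (bderivs (iend G) (ilens eps) psi1 v).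

Definition bc_conn_eps (eps : R) (psi psi1 : gfun R ('I_N + iedge G)) : Prop :=
  forall j, vertex_cond
    (kirchhoff_proj R (degree (iend G) (conn G j) + 1)) 0
    (col_mx (bvalues (iend G) (ilens eps) (finner psi) (conn G j))
            (const_mx (fouter psi j 0)))
    (col_mx (bderivs (iend G) (ilens eps) (finner psi1) (conn G j))
            (const_mx (fouter psi1 j 0))).

Definition Hfull (eps : R) : gop R ('I_N + iedge G)%type :=
  schrodinger (fedges eps) (Bfull_eps eps) (fun psi psi1 =>
    [/\ bc_Vin_eps eps (finner psi) (finner psi1),
        bc_Vout (fouter psi) (fouter psi1)
      & bc_conn_eps eps psi psi1]).

Definition Hin_ring : gop R (iedge G) :=
  schrodinger iedges (Bin G) (fun psi psi1 =>
    (forall v, v \notin codom (conn G) ->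
       vertex_cond (Pin G v) (Thetain G v)
         (bvalues (iend G) (ilen G) psi v)
         (bderivs (iend G) (ilen G) psi1 v)) /\
    (forall j,
       vertex_cond (kirchhoff_proj R (degree (iend G) (conn G j))) 0
         (bvalues (iend G) (ilen G) psi (conn G j))
         (bderivs (iend G) (ilen G) psi1 (conn G j)))).

Definition Hout_ring : gop R 'I_N :=
  schrodinger (olen G) (Bout G) (fun psi psi1 =>
    bc_Vout psi psi1 /\ values0 psi = 0).

Definition Hout_hat (Phat : 'M[R[i]]_N) : gop R 'I_N :=
  schrodinger (olen G) (Bout G) (fun psi psi1 =>
    bc_Vout psi psi1 /\ vertex_cond Phat 0 (values0 psi) (values0 psi1)).

Section Eigenfunctions.
Variables (m : nat) (phi : 'I_m -> gfun R (iedge G)).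

Definition phi_eps (eps : R) (k : 'I_m) : gfun R (iedge G) :=
  fun e x => ((Num.sqrt eps)^-1)%:C * phi k e (x / eps).

Definition cvec (k : 'I_m) : 'cV[R[i]]_N :=
  \col_j vertex_value (iend G) (ilen G) (phi k) (conn G j).

(* [\sum_k c_k (c_k, .)] *)
Definition Chat : 'M[R[i]]_N :=
  \matrix_(i, j) \sum_k cvec k i 0 * (cvec k j 0)^*.

(* The coefficient [delta_(k,k') - (c_k, Chat_0^-1 c_k')]. *)
Definition coef (Phat : 'M[R[i]]_N) (k k' : 'I_m) : R[i] :=
  (k == k')%:R - cdot (cvec k) (restr_inv Chat Phat (cvec k')).

(* [- z^-1 \sum_(k,k') q_(k,k') phi_k^eps (phi_k'^eps, .)] *)
Definition inner_block (z : R[i]) (q : 'I_m -> 'I_m -> R[i]) (eps : R)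
    (f : gfun R (iedge G)) : gfun R (iedge G) :=
  fun e x => - z^-1 * \sum_k \sum_k'
    q k k' * phi_eps eps k e x * gdot (iedges_eps eps) (phi_eps eps k') f.

End Eigenfunctions.

(* [(Hfull eps - z)^-1 = diag ((Hout - z)^-1, T eps) + O(eps `^ a)], including
   the existence of the two resolvents. *)
Definition resolvent_expansion (z : R[i]) (Hout : gop R 'I_N)
    (T : R -> gfun R (iedge G) -> gfun R (iedge G)) (a : R) : Prop :=
  [/\ resolvent_set (olen G) Hout z,
      forall eps, 0 < eps -> eps < 1 ->
        resolvent_set (fedges eps) (Hfull eps) z
    & bigO_op fedges (fun eps f =>
        gsub (resolvent (Hfull eps) z f)
             (blockdiag (resolvent Hout z) (T eps) f)) a].

End Hamiltonians.

Arguments iedges {R N} G _.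
Arguments Hin_ring {R N} G _ _.
Arguments Hout_ring {R N} G _ _.
Arguments Hout_hat {R N} G Phat _ _.

(* Main.v *)
(* Let [psi = (H^eps - z)^-1 f].  By Green's identity [|Im z| |psi| <= |f|], so the
   traces [psi_j(0)], [psi_j'(0)] on the fixed outer edges are [O(|f|)].  On the inner
   graph, [u(y) = psi(eps y)] solves [- u'' + B u = F] with
   [F = eps^2 (z u + f(eps .))], up to a Kirchhoff defect [- eps psi_j'(0)] at the
   connecting vertices; hence [u = \sum_k b_k phi_k + w] with [w = O(eps |f|)]
   uniformly.  Let [L] be the matrix with columns [c_k], so that [Chat = L L^*].
   Then [psi(0) = L b + O(eps)], and testing the equation for [u] against the
   [phi_k] gives
     [L^* psi'(0) = - eps (z (phi, u) + (phi, f(eps .))) = O(eps^(1/2))].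
   Thus [psi] almost satisfies the vertex conditions of [Hout_hat], and the energy
   identity compares its outer part with [(Hout_hat - z)^-1 f].  Inside,
   [Pi = 1 - L^* Chat_0^-1 L] annihilates [L^*], so the displayed identity
   determines [Pi b], while [b - Pi b = L^* Chat_0^-1 L b] stays bounded and is
   negligible on edges of length [O(eps)].  If [L = 0] every error is [O(eps)].
   The resolvents exist because the boundary conditions are a square linear system
   for the initial data on the edges, injective by the energy identity. *)
Require Import Defs.
From HB Require Import structures.
From mathcomp Require Import all_boot all_order all_algebra.
From mathcomp Require Import complex ring lra.
From mathcomp Require Import all_classical all_reals all_analysis.
From mathcomp Require Import measurable_realfun.
Set Implicit Arguments.
Unset Strict Implicit.
Unset Printing Implicit Defensive.
Import Order.TTheory GRing.Theory Num.Theory.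
Import numFieldNormedType.Exports.
Local Open Scope classical_set_scope.
Local Open Scope ring_scope.
Local Open Scope complex_scope.

(** * Integrals and primitives on an edge *)

Section RealPrimitives.
Variable R : realType.
Local Notation leb := (@lebesgue_measure R).
Local Notation integ D f := (leb.-integrable D (EFin \o f)).
Implicit Types (D : set R) (f g : R -> R) (l : option R).

(** Uniformity in [eps] is obtained without a spectral gap and without inverting an [eps]-dependent
    matrix. On the rescaled inner graph the operator stays at energy zero, [z] being part of the
    source, so every constant belongs to one fixed problem: Gronwall's inequality bounds a solution
    by its source and its initial data on the edges, and a pseudo-inverse of the finite matrix of
    vertex residuals bounds these data modulo the data of eigenfunctions. The power of [eps] in the
    flux comes from the dilation, which multiplies [L^2] norms by [eps^(-1/2)]. The obstacle to a
    square system for the initial data is a half-line, whose far end carries no vertex condition.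
    The missing equation says that the coefficient of the growing exponential vanishes; it is a
    convergent linear functional of the data because the potential has compact support. Functions of
    class [H^2] are treated as iterated primitives throughout, and the product rule for primitives
    comes from Fubini's theorem. *)

Lemma edge_Some (a : R) : edge (Some a) = `[0, a]%classic.
Proof. by apply/seteqP; split => x /=; rewrite in_itv. Qed.

Lemma edge_None : edge None = `[0, +oo[%classic :> set R.
Proof. by apply/seteqP; split => x /=; rewrite in_itv /= andbT. Qed.

Lemma measurable_edge l : measurable (edge l).
Proof.
case: l => [a|]; first by rewrite edge_Some; exact: measurable_itv.
by rewrite edge_None; exact: measurable_itv.
Qed.

Lemma edge_ge0 l x : edge l x -> 0 <= x.
Proof. by case: l => [a|] //= /andP[]. Qed.

Lemma edge_le l x y : edge l x -> 0 <= y -> y <= x -> edge l y.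
Proof. by case: l => [a|] //= /andP[_ xa] -> yx /=; rewrite (le_trans yx). Qed.

Lemma edge_sub l x : edge l x -> `[0, x] `<=` edge l.
Proof. by move=> lx y /=; rewrite in_itv /= => /andP[y0 yx]; apply: edge_le lx _ _. Qed.

Lemma itv0_edge (x y : R) : `[0, x]%classic y -> edge (Some x) y.
Proof. by rewrite edge_Some. Qed.

Lemma integ_meas D f : integ D f -> measurable_fun D f.
Proof. by move=> /measurable_int /measurable_EFinP. Qed.

Lemma integ_ext D f g : measurable D -> (forall x, D x -> f x = g x) ->
  integ D f -> integ D g.
Proof.
move=> mD fg; apply: eq_integrable => // x /set_mem Dx /=.
by rewrite fg.
Qed.

Lemma integ_le D f g : measurable D -> measurable_fun D f ->
  (forall x, D x -> `|f x| <= g x) -> integ D g -> integ D f.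
Proof.
move=> mD mf fg; apply: le_integrable => //; first exact/measurable_EFinP.
by move=> x Dx /=; rewrite lee_fin (le_trans (fg _ Dx))// ler_norm.
Qed.

Lemma integS D D' f : measurable D -> measurable D' -> D `<=` D' ->
  integ D' f -> integ D f.
Proof. by move=> mD mD' DD'; apply: integrableS. Qed.

Lemma integ_norm D f : integ D f -> integ D (fun x => `|f x|).
Proof. exact: integrable_abse. Qed.

Lemma integD D f g : measurable D -> integ D f -> integ D g ->
  integ D (fun x => f x + g x).
Proof. by move=> mD; apply: integrableD. Qed.

Lemma integZ D c f : measurable D -> integ D f -> integ D (fun x => c * f x).
Proof. by move=> mD; apply: integrableZl. Qed.

Lemma integN D f : measurable D -> integ D f -> integ D (fun x => - f x).
Proof. by move=> mD; apply: integrableN. Qed.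

Lemma integB D f g : measurable D -> integ D f -> integ D g ->
  integ D (fun x => f x - g x).
Proof. by move=> mD hf hg; apply: integD => //; apply: integN. Qed.

Lemma integ_mulb D f g C : measurable D -> measurable_fun D f ->
  (forall x, D x -> `|f x| <= C) -> integ D g -> integ D (fun x => f x * g x).
Proof.
move=> mD mf fC ig.
apply: (@integ_le _ _ (fun x => C * `|g x|)) => //.
- by apply: measurable_funM => //; exact: integ_meas.
- by move=> x Dx; rewrite normrM ler_wpM2r// fC.
- by apply: integZ => //; exact: integ_norm.
Qed.

Lemma integ_cst0 D : measurable D -> integ D (fun=> 0).
Proof. by move=> mD; exact: integrable0. Qed.

Lemma integ_bounded (x : R) f C : measurable_fun `[0, x] f ->
  (forall y, 0 <= y <= x -> `|f y| <= C) -> integ `[0, x] f.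
Proof.
move=> mf fC.
apply: measurable_bounded_integrable => //=.
  by rewrite lebesgue_measure_itv /=; case: ifPn => //; rewrite ltry.
rewrite /bounded_near; near=> M => y /=; rewrite in_itv /= => /fC /le_trans; apply.
by near: M; apply: nbhs_pinfty_ge; rewrite num_real.
Unshelve. all: by end_near. Qed.

Lemma EFin_Rint D f : measurable D -> integ D f ->
  (\int[leb]_(x in D) (f x)%:E)%E = (\int[leb]_(x in D) f x)%:E.
Proof. by move=> mD iF; rewrite /Rintegral fineK// integrable_fin_num. Qed.

Lemma Rint_le D f g : measurable D -> integ D f -> integ D g ->
  (forall x, D x -> f x <= g x) ->
  \int[leb]_(x in D) f x <= \int[leb]_(x in D) g x.
Proof. by move=> mD h1 h2 h; apply: le_Rintegral. Qed.

Lemma Rint_ext D f g : (forall x, D x -> f x = g x) ->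
  \int[leb]_(x in D) f x = \int[leb]_(x in D) g x.
Proof. by move=> fg; apply: eq_Rintegral => x /set_mem; exact: fg. Qed.

Lemma Rint_subset D D' f : measurable D -> measurable D' -> D `<=` D' ->
  integ D' f -> (forall x, D' x -> 0 <= f x) ->
  \int[leb]_(x in D) f x <= \int[leb]_(x in D') f x.
Proof.
move=> mD mD' DD' iF f0.
rewrite -lee_fin -!EFin_Rint//; last exact: integS iF.
by apply: ge0_subset_integral => //; exact: measurable_int iF.
Qed.

Lemma Rint_itv0 f : \int[leb]_(x in `[0, 0]) f x = 0.
Proof. by rewrite set_itv1 Rintegral_set1. Qed.

Lemma integ_restrict D f : measurable D -> integ D f -> integ setT (f \_ D : R -> R).
Proof.
move=> mD iF.
have -> : EFin \o (f \_ D : R -> R) = (EFin \o f) \_ D.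
  by apply/funext => y /=; rewrite !patchE; case: ifP.
by have [+ _] := integrable_mkcond (mu := leb) (EFin \o f) mD; apply.
Qed.

(** Both sides integrate [f1 t * g1 s] over the triangle [0 <= s <= t <= x]. This exchange replaces
    integration by parts for functions known only as primitives. *)
Lemma fubini_triangle (x : R) (f1 g1 : R -> R) :
  integ `[0, x] f1 -> integ `[0, x] g1 ->
  \int[leb]_(t in `[0, x]) (f1 t * \int[leb]_(s in `[0, t]) g1 s) =
  \int[leb]_(s in `[0, x]) (g1 s * \int[leb]_(t in `[s, x]) f1 t).
Proof.
move=> if1 ig1.
pose ft : R -> R := f1 \_ `[0, x]; pose gt : R -> R := g1 \_ `[0, x].
have mI a b : measurable (`[a, b]%classic : set R) by exact: measurable_itv.
have ift : integ setT ft.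
  by apply: integ_restrict.
have igt : integ setT gt.
  by apply: integ_restrict.
(* The integrand is extended by zero from the triangle to the plane, where Fubini's theorem applies
   without domains. *)
pose h (p : R * R) : R := if p.2 <= p.1 then ft p.1 * gt p.2 else 0.
have mh : measurable_fun setT h.
  apply: measurable_fun_ifT => //.
    by apply: measurable_fun_ler.
  apply: measurable_funM.
    by apply: measurableT_comp => //; exact: integ_meas.
  by apply: measurableT_comp => //; exact: integ_meas.
have inner1 t : (\int[leb]_s (h (t, s))%:E)%E =
    (((fun t => f1 t * \int[leb]_(s in `[0, t]) g1 s) \_ `[0, x]) t)%:E.
  rewrite patchE; case: ifPn => [/set_mem tx|tx]; last first.
    rewrite integral0_eq// => s _; by rewrite /h /= /ft patchE (negbTE tx) mul0r if_same.
  have tx' := tx; move: tx'; rewrite /= in_itv /= => /andP[t0 tx'].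
  have sub : `[0, t] `<=` `[0, x].
    by move=> s /=; rewrite !in_itv /= => /andP[-> st]; rewrite (le_trans st).
  have igt' : integ `[0, t] g1 by exact: integS ig1.
  rewrite -RintegralZl// -EFin_Rint//; last exact: integZ.
  rewrite [RHS]integral_mkcond; apply: eq_integral => s _.
  rewrite /h /= patchE /= /ft /gt !patchE mem_set//.
  have [st|ts] := leP s t; last first.
    rewrite ifF//; apply/negP => /set_mem /=; rewrite in_itv /=.
    by rewrite (leNgt s) ts andbF.
  have [s0|s0] := leP 0 s.
    by rewrite !mem_set//= ?in_itv /= ?s0 ?st ?(le_trans st).
  rewrite !ifF ?mulr0//; apply/negP => /set_mem /=; rewrite in_itv /=.
    by rewrite (leNgt 0) s0.
  by rewrite (leNgt 0) s0.
have inner2 s : (\int[leb]_t (h (t, s))%:E)%E =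
    (((fun s => g1 s * \int[leb]_(t in `[s, x]) f1 t) \_ `[0, x]) s)%:E.
  rewrite patchE; case: ifPn => [/set_mem sx|sx]; last first.
    rewrite integral0_eq// => t _; by rewrite /h /= /gt patchE (negbTE sx) mulr0 if_same.
  have sx' := sx; move: sx'; rewrite /= in_itv /= => /andP[s0 sx'].
  have sub : `[s, x] `<=` `[0, x].
    by move=> t /=; rewrite !in_itv /= => /andP[st ->]; rewrite (le_trans s0 st).
  have ift' : integ `[s, x] f1 by exact: integS if1.
  rewrite -RintegralZl// -EFin_Rint//; last exact: integZ.
  rewrite [RHS]integral_mkcond; apply: eq_integral => t _.
  rewrite /h /= patchE /= /ft /gt !patchE (mem_set sx).
  have [st|ts] := leP s t; last first.
    rewrite ifF//; apply/negP => /set_mem /=; rewrite in_itv /=.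
    by rewrite (leNgt s) ts.
  have [tx|tx] := leP t x.
    by rewrite !mem_set//= ?in_itv /= ?tx ?st ?(le_trans s0 st)// mulrC.
  rewrite !ifF ?mul0r//; apply/negP => /set_mem /=; rewrite in_itv /=.
    by rewrite (leNgt t) tx andbF.
  by rewrite (leNgt t) tx andbF.
(* Tonelli's theorem gives integrability on the plane: a section of [|h|] has integral at most
   [|ft t| * C], with [C] the [L^1] norm of [gt]. *)
have ih : (leb \x leb)%E.-integrable setT (EFin \o h).
  apply/integrable12ltyP; first exact/measurable_EFinP.
  pose C := \int[leb]_s `|gt s|.
  apply: (@le_lt_trans _ _ (\int[leb]_t (`|ft t| * C)%:E)%E).
    apply: ge0_le_integral => //.
    - by move=> t _; apply: integral_ge0.
    - have key := @measurable_fun_fubini_tonelli_F _ _ _ _ R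
        (@lebesgue_measure R : {sigma_finite_measure set _ -> \bar R})
        (fun p : R * R => `|(EFin \o h) p|%E).
      apply: key => //.
      by apply: measurableT_comp => //; exact/measurable_EFinP.
    - apply/measurable_EFinP/measurable_funM => //.
      by apply: measurableT_comp => //; exact: integ_meas.
    - move=> t _; rewrite EFinM -EFin_Rint//; last exact: integ_norm.
      rewrite -integralZl//; last exact: integ_norm.
      apply: ge0_le_integral => //.
      + apply/measurable_EFinP; apply: measurableT_comp => //.
        apply: measurableT_comp mh _; exact: measurable_pair1.
      + apply/measurable_EFinP/measurable_funM => //.
        by apply: measurableT_comp => //; exact: integ_meas.
      + move=> s _; rewrite /h /=; case: ifP => _; rewrite ?normrM// normr0.
        by rewrite lee_fin mulr_ge0.
  have : integ setT (fun t => C * `|ft t|) by apply: integZ => //; exact: integ_norm.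
  move=> /EFin_Rint => /(_ measurableT).
  under eq_integral do rewrite mulrC.
  by move=> ->; rewrite ltry.
have := Fubini ih.
under eq_integral do rewrite /= inner1.
under [X in _ = X -> _]eq_integral do rewrite /= inner2.
move=> key; rewrite Rintegral_mkcond [RHS]Rintegral_mkcond.
by congr fine; exact: key.
Qed.
End RealPrimitives.

(** * Square-integrable functions, primitives and the product rule *)

Section RealPrimitives2.
Variable R : realType.
Local Notation leb := (@lebesgue_measure R).
Local Notation integ D f := (leb.-integrable D (EFin \o f)).
Implicit Types (D : set R) (f g : R -> R) (l : option R).

Definition sqint D f := measurable_fun D f /\ integ D (fun x => f x ^+ 2).

(** Bridge between the [L^2] membership of the definitions, phrased with an extension by zero, and
    conditions on [D] itself, which suit the domination arguments below. *)
Lemma sqint_Lfun D f : measurable D ->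
  f \_ D \in Lfun leb 2%:E <-> sqint D f.
Proof.
move=> mD; split=> [fL|[mf if2]].
  have mfD : measurable_fun setT (f \_ D : R -> R).
    by move: (fL); rewrite inE => /andP[/[!inE]].
  split; first exact/measurable_restrictT.
  apply: (@integ_ext _ _ (fun x => (f \_ D : R -> R) x ^+ 2)) => //.
    by move=> x Dx; rewrite patchE mem_set.
  apply: integS (Lfun2_integrable_sqr fL) => //.
have mfD : measurable_fun setT (f \_ D : R -> R).
  by have [h _] := measurable_restrictT f mD; exact: h.
rewrite inE; apply/andP; split; rewrite inE//=.
rewrite /finite_norm unlock poweR_lty//.
have /integrableP[_] := integ_restrict mD if2.
apply: le_lt_trans; rewrite le_eqVlt; apply/orP; left; apply/eqP.
apply: eq_integral => x _ /=; rewrite !patchE; congr EFin.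
case: ifP => _; first by rewrite powR_mulrn// -normrX.
by rewrite normr0 powR0// pnatr_eq0.
Qed.

Lemma sqint_mul D f g : measurable D -> sqint D f -> sqint D g ->
  integ D (fun x => f x * g x).
Proof.
move=> mD [mf if2] [mg ig2].
apply: (@integ_le _ _ _ (fun x => f x ^+ 2 + g x ^+ 2)) => //.
- exact: measurable_funM.
- move=> x _; rewrite ler_norml; apply/andP; split.
    have := sqr_ge0 (f x + g x); nra.
  have := sqr_ge0 (f x - g x); nra.
- exact: integD.
Qed.

Lemma sqintD D f g : measurable D -> sqint D f -> sqint D g ->
  sqint D (fun x => f x + g x).
Proof.
move=> mD [mf if2] [mg ig2]; split; first exact: measurable_funD.
apply: (@integ_le _ _ _ (fun x => 2 * (f x ^+ 2 + g x ^+ 2))) => //.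
- by apply: measurable_funX; exact: measurable_funD.
- move=> x _; rewrite ger0_norm ?sqr_ge0//.
  have := sqr_ge0 (f x - g x); nra.
- by apply: integZ => //; exact: integD.
Qed.

Lemma sqint_mulb D f g C : measurable D -> measurable_fun D f ->
  (forall x, D x -> `|f x| <= C) -> sqint D g -> sqint D (fun x => f x * g x).
Proof.
move=> mD mf fC [mg ig2]; split; first exact: measurable_funM.
apply: (@integ_le _ _ _ (fun x => C ^+ 2 * g x ^+ 2)) => //.
- by apply: measurable_funX; exact: measurable_funM.
- move=> x Dx; rewrite normrX normrM exprMn real_normK ?num_real//.
  rewrite real_normK ?num_real// ler_wpM2r ?sqr_ge0//.
  rewrite -[leLHS](@real_normK _ (f x)) ?num_real//.
  by rewrite lerXn2r ?nnegrE ?fC// (le_trans _ (fC _ Dx)).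
- exact: integZ.
Qed.

Lemma sqintZ D c f : measurable D -> sqint D f -> sqint D (fun x => c * f x).
Proof. by move=> mD; apply: (@sqint_mulb _ _ _ `|c|). Qed.

Lemma sqint_ext D f g : measurable D -> (forall x, D x -> f x = g x) ->
  sqint D f -> sqint D g.
Proof.
move=> mD fg [mf if2]; split.
  by apply: eq_measurable_fun mf => x /set_mem; exact: fg.
by apply: integ_ext if2 => // x Dx; rewrite fg.
Qed.

Lemma sqintN D f : measurable D -> sqint D f -> sqint D (fun x => - f x).
Proof. by move=> mD /(@sqintZ _ (-1) f mD); under eq_fun do rewrite mulN1r. Qed.

Lemma sqint_sub D D' f : measurable D -> measurable D' -> D `<=` D' ->
  sqint D' f -> sqint D f.
Proof.
by move=> mD mD' DD' [mf if2]; split; [exact: measurable_funS mf|exact: integS if2].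
Qed.

Lemma sqint_integ (x : R) f : sqint `[0, x] f -> integ `[0, x] f.
Proof.
move=> sf.
have : sqint `[0, x] (fun=> 1).
  split; first exact: measurable_cst.
  by apply: (@integ_bounded _ _ _ 1) => // y _; rewrite expr1n normr1.
move=> /(sqint_mul (measurable_itv _) sf); apply: integ_ext => // y _.
by rewrite mulr1.
Qed.

Lemma sqint_bounded (x C : R) f : measurable_fun `[0, x] f ->
  (forall y, 0 <= y <= x -> `|f y| <= C) -> sqint `[0, x] f.
Proof.
move=> mf fC; split => //; apply: (@integ_bounded _ _ _ (C ^+ 2)).
  exact: measurable_funX.
move=> y xy; rewrite normrX lerXn2r ?nnegrE ?fC//.
by rewrite (le_trans _ (fC _ xy)).
Qed.

(** Discriminant argument: the integral of [(t |f| - |g|)^2] is nonnegative for every real [t]. *)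
Lemma Rint_CS D f g : measurable D -> sqint D f -> sqint D g ->
  (\int[leb]_(x in D) (`|f x| * `|g x|)) ^+ 2 <=
  (\int[leb]_(x in D) (f x ^+ 2)) * (\int[leb]_(x in D) (g x ^+ 2)).
Proof.
move=> mD sf sg.
set I := \int[leb]_(x in D) _; set A := \int[leb]_(x in D) _.
set B := \int[leb]_(x in D) _.
have A0 : 0 <= A by apply: Rintegral_ge0 => x _; exact: sqr_ge0.
have B0 : 0 <= B by apply: Rintegral_ge0 => x _; exact: sqr_ge0.
have I0 : 0 <= I by apply: Rintegral_ge0 => x _; rewrite mulr_ge0.
have iI : integ D (fun x => `|f x| * `|g x|).
  by under eq_fun do rewrite -normrM; apply/integ_norm/sqint_mul.
have key t : t * I * 2 <= t ^+ 2 * A + B.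
  have [_ i1] := sf; have [_ i2] := sg.
  have i3 : integ D (fun x => t ^+ 2 * f x ^+ 2) by exact: integZ.
  have i4 : integ D (fun x => (t * 2) * (`|f x| * `|g x|)) by exact: integZ.
  have -> : t * I * 2 = (t * 2) * I by rewrite mulrAC.
  rewrite /I /A /B -RintegralZl// -RintegralZl// -RintegralD//.
  apply: Rint_le => //; first exact: integD.
  - move=> x _; rewrite -[f x ^+ 2]real_normK ?num_real//.
    rewrite -[g x ^+ 2]real_normK ?num_real//.
    have := sqr_ge0 (t * `|f x| - `|g x|); nra.
(* If [A = 0] and [I != 0], the value [t = (B + 1) / I] contradicts [key]; otherwise the minimising
   value [t = I / A] gives the inequality. *)
have [A1|A1] := eqVneq A 0.
  have [->|I1] := eqVneq I 0; first by rewrite expr0n mulr_ge0.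
  have := key ((B + 1) / I); rewrite A1 mulr0 add0r.
  rewrite divfK//; nra.
have := key (I / A).
have Ap : 0 < A by rewrite lt_neqAle eq_sym A1.
rewrite -(ler_pM2r Ap) mulrDl.
have -> : I / A * I * 2 * A = 2 * I ^+ 2 by field.
have -> : (I / A) ^+ 2 * A * A = I ^+ 2 by field.
nra.
Qed.

(** Absolute continuity on the edge with derivative [g], based at the initial point. Local
    integrability is part of the definition because [Rintegral] returns a conventional value on
    functions that are not integrable. *)
Definition prim l f g := (forall x, edge l x -> integ `[0, x] g) /\
  (forall x, edge l x -> f x = f 0 + \int[leb]_(t in `[0, x]) g t).

Lemma primD l f f1 g g1 : prim l f f1 -> prim l g g1 ->
  prim l (fun x => f x + g x) (fun x => f1 x + g1 x).
Proof.
move=> [if1 Ef] [ig1 Eg]; split => x lx.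
  by apply: integD => //; [exact: if1|exact: ig1].
by rewrite RintegralD//; [rewrite Ef// Eg// addrACA|exact: if1|exact: ig1].
Qed.

Lemma primZ l c f f1 : prim l f f1 ->
  prim l (fun x => c * f x) (fun x => c * f1 x).
Proof.
move=> [if1 Ef]; split => x lx; first by apply: integZ => //; exact: if1.
by rewrite RintegralZl//; [rewrite Ef// mulrDr|exact: if1].
Qed.

Lemma prim_ext l f f1 g g1 :
  (forall x, edge l x -> f x = g x) -> (forall x, edge l x -> f1 x = g1 x) ->
  prim l f f1 -> prim l g g1.
Proof.
move=> fg fg1 [if1 Ef]; split => x lx.
  apply: integ_ext (if1 x lx) => //.
  by move=> y /(edge_sub lx); exact: fg1.
have l0 : edge l 0 by apply: (edge_le lx) => //; exact: edge_ge0 lx.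
rewrite -!fg// Ef//; congr +%R; apply: Rint_ext.
by move=> y /(edge_sub lx); exact: fg1.
Qed.

Lemma primN l f f1 : prim l f f1 -> prim l (fun x => - f x) (fun x => - f1 x).
Proof.
move=> /(@primZ _ (-1)).
by apply: prim_ext => x _; rewrite mulN1r.
Qed.

Lemma primB l f f1 g g1 : prim l f f1 -> prim l g g1 ->
  prim l (fun x => f x - g x) (fun x => f1 x - g1 x).
Proof. by move=> pf pg; apply: primD => //; exact: primN. Qed.

Lemma prim_sub l l' f f1 : edge l `<=` edge l' -> prim l' f f1 -> prim l f f1.
Proof. by move=> ll' [h1 h2]; split => x /ll'; [exact: h1|exact: h2]. Qed.

Lemma prim_cont l f f1 (x : R) : prim l f f1 -> edge l x ->
  {within `[0, x], continuous f}.
Proof.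
move=> [if1 Ef] lx.
have h := parameterized_integral_continuous (edge_ge0 lx) (if1 x lx).
apply: (@subspace_eq_continuous _ _ _ (fun y => f 0 + parameterized_integral leb 0 y f1)).
  by move=> y /set_mem xy; rewrite [RHS]Ef//; exact: edge_sub lx _ xy.
by move=> y; apply: cvgD; [exact: cvg_cst|exact: h].
Qed.

Lemma prim_meas l f f1 : prim l f f1 -> measurable_fun (edge l) f.
Proof.
move=> pf.
have H x : edge l x -> measurable_fun `[0, x] f.
  move=> lx; apply: subspace_continuous_measurable_fun => //.
  exact: prim_cont pf lx.
case: l pf H => [a|] pf H.
  have [a0|a0] := leP 0 a; first by rewrite edge_Some; apply: H; rewrite /= a0 lexx.
  suff -> : edge (Some a) = set0 by exact: measurable_fun_set0.
  by rewrite -subset0 => x /= /andP[x0 xa]; have := le_lt_trans (le_trans x0 xa) a0; rewrite ltxx.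
have -> : edge None = \bigcup_n `[0, n%:R : R]%classic.
  apply/seteqP; split => x /=; last by move=> [n _] /=; rewrite in_itv /= => /andP[].
  move=> x0; exists (Num.truncn x).+1 => //=.
  by rewrite in_itv /= x0 ltW// truncnS_gt.
by apply/measurable_fun_bigcup => // n; apply: H => /=.
Qed.

Lemma prim_bound l f f1 x y : prim l f f1 -> edge l x -> 0 <= y <= x ->
  `|f y| <= `|f 0| + \int[leb]_(t in `[0, x]) `|f1 t|.
Proof.
move=> [if1 Ef] lx /andP[y0 yx].
have ly : edge l y by exact: edge_le lx _ _.
rewrite Ef//; apply: le_trans (ler_normD _ _) _; rewrite lerD2l.
apply: le_trans (le_normr_Rintegral _ (if1 _ ly)) _ => //.
apply: Rint_subset => //; last exact/integ_norm/if1.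
by move=> t /=; rewrite !in_itv /= => /andP[-> /le_trans]; apply.
Qed.

Lemma prim_diff l f f1 x y : prim l f f1 -> edge l y -> 0 <= x -> x <= y ->
  f y - f x = \int[leb]_(t in `[x, y]) f1 t.
Proof.
move=> [if1 Ef] ly x0 xy.
have lx : edge l x by exact: edge_le ly _ _.
have iy := if1 _ ly.
rewrite (Ef y)// (Ef x)// opprD addrACA subrr add0r Rintegral_itvB//.
  rewrite Rintegral_itv_obnd_cbnd//.
  apply: integS iy => //; move=> t /=; rewrite !in_itv /= => /andP[xt ->].
  by rewrite (le_trans x0 (ltW xt)).
Qed.

(** Product rule for absolutely continuous functions. Writing [g] as the integral of [g1] turns the
    integral of [f1 * g] into an integral over a triangle; exchanging the order recovers [f] by
    integrating [f1] over [[s, x]]. *)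
Lemma prim_mul l f f1 g g1 : prim l f f1 -> prim l g g1 ->
  prim l (fun x => f x * g x) (fun x => f1 x * g x + f x * g1 x).
Proof.
move=> pf pg; have [if1 Ef] := pf; have [ig1 Eg] := pg.
have mI x : edge l x -> measurable_fun `[0, x] f /\ measurable_fun `[0, x] g.
  by move=> lx; split; apply: measurable_funS (edge_sub lx) _ => //;
    [exact: measurable_edge|exact: prim_meas pf|exact: measurable_edge|exact: prim_meas pg].
have ifg x : edge l x -> integ `[0, x] (fun t => f1 t * g t).
  move=> lx; apply: (@integ_ext _ _ (fun t => g t * f1 t)) => //.
    by move=> t _; rewrite mulrC.
  apply: integ_mulb (if1 x lx) => //; first exact: (mI _ lx).2.
  by move=> y /=; rewrite in_itv /=; exact: prim_bound pg lx.
have igf x : edge l x -> integ `[0, x] (fun t => f t * g1 t).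
  move=> lx.
  apply: integ_mulb (ig1 x lx) => //; first exact: (mI _ lx).1.
  by move=> y /=; rewrite in_itv /=; exact: prim_bound pf lx.
split => x lx; first by apply: integD => //; [exact: ifg|exact: igf].
rewrite RintegralD//; [|exact: ifg|exact: igf].
have x0 := edge_ge0 lx.
have tri := fubini_triangle (if1 x lx) (ig1 x lx).
have -> : \int[leb]_(t in `[0, x]) (f1 t * g t) =
   \int[leb]_(t in `[0, x]) (g 0 * f1 t) +
   \int[leb]_(t in `[0, x]) (f1 t * \int[leb]_(s in `[0, t]) g1 s).
  rewrite -RintegralD//.
  - apply: Rint_ext => t /(edge_sub lx) lt; rewrite (Eg t)//; move: (Rintegral _ _ _) => ?; ring.
  - by apply: integZ => //; exact: if1.
  - apply: (@integ_ext _ _ (fun t => f1 t * g t - g 0 * f1 t)) => //.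
      by move=> t /(edge_sub lx) lt; rewrite (Eg t)//; move: (Rintegral _ _ _) => ?; ring.
    by apply: integB => //; [exact: ifg|apply: integZ => //; exact: if1].
rewrite tri.
(* After the exchange the inner integral is [f x - f s]. *)
have -> : \int[leb]_(s in `[0, x]) (g1 s * \int[leb]_(t in `[s, x]) f1 t) =
   \int[leb]_(s in `[0, x]) (f x * g1 s) - \int[leb]_(s in `[0, x]) (f s * g1 s).
  rewrite -RintegralB//; [|by apply: integZ => //; exact: ig1|exact: igf].
  apply: Rint_ext => s sx; have ls := edge_sub lx sx.
  move: sx => /=; rewrite in_itv /= => /andP[s0 sx].
  by rewrite -(prim_diff pf lx s0 sx); move: (f x) (f s) (g1 s) => *; ring.
rewrite !RintegralZl//; [|exact: ig1|exact: if1].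
have := Ef x lx; have := Eg x lx.
move: (\int[leb]_(t in `[0, x]) f1 t) (\int[leb]_(t in `[0, x]) g1 t) => F G.
move: (\int[leb]_(t in `[0, x]) (f t * g1 t)) => H.
by move=> -> ->; move: (f 0) (g 0) => *; ring.
Qed.

End RealPrimitives2.

(** * Complex-valued functions *)

Section ComplexLayer.
Variable R : realType.
Local Notation leb := (@lebesgue_measure R).
Local Notation integ D f := (leb.-integrable D (EFin \o f)).
Local Notation C := R[i].
Local Notation cRe := (@complex.Re R).
Local Notation cIm := (@complex.Im R).
Implicit Types (D : set R) (f g : R -> C) (l : option R) (w : C).

Lemma cReD (a b : C) : cRe (a + b) = cRe a + cRe b. Proof. by case: a; case: b. Qed.
Lemma cImD (a b : C) : cIm (a + b) = cIm a + cIm b. Proof. by case: a; case: b. Qed.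
Lemma cReN (a : C) : cRe (- a) = - cRe a. Proof. by case: a. Qed.
Lemma cImN (a : C) : cIm (- a) = - cIm a. Proof. by case: a. Qed.
Lemma cReM (a b : C) : cRe (a * b) = cRe a * cRe b - cIm a * cIm b.
Proof. by case: a; case: b. Qed.
Lemma cImM (a b : C) : cIm (a * b) = cRe a * cIm b + cIm a * cRe b.
Proof. by case: a => a1 a2; case: b => b1 b2. Qed.
Lemma cReJ (a : C) : cRe a^* = cRe a. Proof. by case: a. Qed.
Lemma cImJ (a : C) : cIm a^* = - cIm a. Proof. by case: a. Qed.
Definition cReE := (cReD, cImD, cReN, cImN, cReM, cImM, cReJ, cImJ).
Lemma cext (a b : C) : cRe a = cRe b -> cIm a = cIm b -> a = b.
Proof. by case: a => a1 a2; case: b => b1 b2 /= -> ->. Qed.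
Lemma cIm_sum (J : Type) (r : seq J) (P : pred J) (F : J -> C) :
  cIm (\sum_(i <- r | P i) F i) = \sum_(i <- r | P i) cIm (F i).
Proof. by apply: (big_morph cIm cImD). Qed.

(** This norm replaces the modulus: it is real-valued, submultiplicative, within a factor [sqrt 2]
    of the modulus, and passes through integrals componentwise. Its expression in absolute values
    keeps the estimates within linear arithmetic. *)
Definition n1 (w : C) : R := `|cRe w| + `|cIm w|.

Lemma n1_ge0 w : 0 <= n1 w. Proof. by rewrite addr_ge0. Qed.
Lemma n1_0 : n1 0 = 0. Proof. by rewrite /n1 /= normr0 addr0. Qed.
Lemma n1_eq0 w : n1 w <= 0 -> w = 0.
Proof.
move=> w0; have [h1 h2] := (normr_ge0 (cRe w), normr_ge0 (cIm w)).
apply: cext => /=; apply/eqP; rewrite -normr_le0; move: w0; rewrite /n1; lra.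
Qed.
Lemma n1D (a b : C) : n1 (a + b) <= n1 a + n1 b.
Proof.
by rewrite /n1 !cReE addrACA lerD// ler_normD.
Qed.
Lemma n1N (a : C) : n1 (- a) = n1 a. Proof. by rewrite /n1 !cReE !normrN. Qed.
Lemma n1B (a b : C) : n1 (a - b) <= n1 a + n1 b.
Proof. by rewrite -[n1 b]n1N n1D. Qed.
Lemma n1J (a : C) : n1 a^* = n1 a. Proof. by rewrite /n1 !cReE normrN. Qed.
Lemma n1M (a b : C) : n1 (a * b) <= n1 a * n1 b.
Proof.
rewrite /n1 !cReE mulrDl !mulrDr -!normrM addrACA.
apply: le_trans (lerD (ler_normB _ _) (ler_normD _ _)) _.
set x1 := `|_ * _|; set x2 := `|_ * _|; set x3 := `|_ * _|; set x4 := `|_ * _|.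
lra.
Qed.
Lemma n1_sum (J : Type) (r : seq J) (P : pred J) (F : J -> C) :
  n1 (\sum_(i <- r | P i) F i) <= \sum_(i <- r | P i) n1 (F i).
Proof.
elim/big_rec2: _ => [|i y x _ xy]; first by rewrite n1_0.
by apply: le_trans (n1D _ _) _; rewrite lerD2l.
Qed.
Lemma n1_real (a : R) : n1 a%:C = `|a|. Proof. by rewrite /n1 /= normr0 addr0. Qed.
Lemma sqmod_ge0 w : 0 <= sqmod w. Proof. by rewrite addr_ge0// sqr_ge0. Qed.
Lemma sqmod_le_n1 w : sqmod w <= n1 w ^+ 2.
Proof.
rewrite /sqmod /n1 -(@real_normK _ (cRe w)) ?num_real//.
rewrite -(@real_normK _ (cIm w)) ?num_real//.
have := normr_ge0 (cRe w); have := normr_ge0 (cIm w); nra.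
Qed.
Lemma n1_le_sqmod w : n1 w ^+ 2 <= 2 * sqmod w.
Proof.
rewrite /sqmod /n1 -(@real_normK _ (cRe w)) ?num_real//.
rewrite -(@real_normK _ (cIm w)) ?num_real//.
have := sqr_ge0 (`|cRe w| - `|cIm w|); nra.
Qed.
Lemma sqmodD (a b : C) : sqmod (a + b) <= 2 * sqmod a + 2 * sqmod b.
Proof.
rewrite /sqmod !cReE.
have := sqr_ge0 (cRe a - cRe b); have := sqr_ge0 (cIm a - cIm b); nra.
Qed.
Lemma sqmodM (a b : C) : sqmod (a * b) = sqmod a * sqmod b.
Proof. by rewrite /sqmod !cReE; ring. Qed.
Lemma sqmodN (a : C) : sqmod (- a) = sqmod a.
Proof. by rewrite /sqmod !cReE !sqrrN. Qed.
Lemma sqmod0 : sqmod (0 : C) = 0.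
Proof. by rewrite /sqmod /= expr0n addr0. Qed.
Lemma sqmod_eq0 w : sqmod w <= 0 -> w = 0.
Proof.
move=> w0; apply: cext; apply/eqP; rewrite -sqrf_eq0 /=; apply/eqP/le_anti;
have := sqr_ge0 (cRe w); have := sqr_ge0 (cIm w); move: w0; rewrite /sqmod; lra.
Qed.

Definition cmeas D f := measurable_fun D (cRe \o f) /\ measurable_fun D (cIm \o f).
Definition cint D f := integ D (cRe \o f) /\ integ D (cIm \o f).
Definition csq D f := sqint D (cRe \o f) /\ sqint D (cIm \o f).
Definition cprim l f g := prim l (cRe \o f) (cRe \o g) /\ prim l (cIm \o f) (cIm \o g).

Lemma in_L2E l f : in_L2 (edge l) f <-> csq (edge l) f.
Proof.
have mD := measurable_edge l.
by split=> -[h1 h2]; split; apply/(sqint_Lfun _ mD).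
Qed.

Lemma cprimE l f g : (forall x, edge l x -> cint `[0, x] g) ->
  primitive_of (edge l) f g -> cprim l f g.
Proof.
move=> ig pf; split; split => x lx /=; try by case: (ig x lx).
  by rewrite (pf x)// cReE.
by rewrite (pf x)// cReE.
Qed.

Lemma cprim_primitive l f g : cprim l f g -> primitive_of (edge l) f g.
Proof.
move=> [[h1 h2] [h3 h4]] x lx; apply: cext; rewrite cReE /=; [exact: h2|exact: h4].
Qed.

Lemma cprim_int l f g x : cprim l f g -> edge l x -> cint `[0, x] g.
Proof. by move=> [[h1 h2] [h3 h4]] lx; split; [exact: h1|exact: h3]. Qed.

Lemma cint_ext D f g : measurable D -> (forall x, D x -> f x = g x) ->
  cint D f -> cint D g.
Proof. by move=> mD fg [h1 h2]; split; [apply: integ_ext h1|apply: integ_ext h2] => // x Dx /=; rewrite fg. Qed.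

Lemma cmeas_ext D f g : (forall x, D x -> f x = g x) ->
  cmeas D f -> cmeas D g.
Proof.
by move=> fg [h1 h2]; split; [apply: eq_measurable_fun h1|apply: eq_measurable_fun h2] => x /set_mem Dx /=; rewrite fg.
Qed.

Lemma csq_ext D f g : measurable D -> (forall x, D x -> f x = g x) ->
  csq D f -> csq D g.
Proof. by move=> mD fg [h1 h2]; split; [apply: sqint_ext h1|apply: sqint_ext h2] => // x Dx /=; rewrite fg. Qed.

Lemma cprim_ext l f f1 g g1 :
  (forall x, edge l x -> f x = g x) -> (forall x, edge l x -> f1 x = g1 x) ->
  cprim l f f1 -> cprim l g g1.
Proof.
move=> fg fg1 [h1 h2]; split; [apply: prim_ext h1|apply: prim_ext h2] => x lx /=;
  by rewrite ?fg ?fg1.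
Qed.

Lemma cint_meas D f : cint D f -> cmeas D f.
Proof. by move=> [/integ_meas h1 /integ_meas h2]. Qed.

Lemma csq_meas D f : csq D f -> cmeas D f.
Proof. by move=> [[h1 _] [h2 _]]. Qed.

Lemma cmeasD D f g : cmeas D f -> cmeas D g -> cmeas D (fun x => f x + g x).
Proof.
move=> [h1 h2] [h3 h4]; split.
  by apply: eq_measurable_fun (measurable_funD h1 h3) => x _ /=; rewrite cReE.
by apply: eq_measurable_fun (measurable_funD h2 h4) => x _ /=; rewrite cReE.
Qed.

Lemma cmeasM D f g : cmeas D f -> cmeas D g -> cmeas D (fun x => f x * g x).
Proof.
move=> [h1 h2] [h3 h4]; split.
  apply: eq_measurable_fun (measurable_funB (measurable_funM h1 h3) (measurable_funM h2 h4)) => x _ /=.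
  by rewrite cReE.
apply: eq_measurable_fun (measurable_funD (measurable_funM h1 h4) (measurable_funM h2 h3)) => x _ /=.
by rewrite cReE.
Qed.

Lemma cmeas_cst D w : cmeas D (fun=> w).
Proof. by split; exact: measurable_cst. Qed.

Lemma cmeasN D f : cmeas D f -> cmeas D (fun x => - f x).
Proof.
move=> h; apply: (@cmeas_ext _ (fun x => -1 * f x)); first by move=> x _; rewrite mulN1r.
by apply: cmeasM => //; exact: cmeas_cst.
Qed.

Lemma cmeasB D f g : cmeas D f -> cmeas D g -> cmeas D (fun x => f x - g x).
Proof. by move=> h1 h2; apply: cmeasD => //; exact: cmeasN. Qed.

Lemma cmeas_sub D D' f : measurable D' -> D `<=` D' -> cmeas D' f -> cmeas D f.
Proof. by move=> mD DD' [h1 h2]; split; [exact: measurable_funS h1|exact: measurable_funS h2]. Qed.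

Lemma cmeas_n1 D f : cmeas D f -> measurable_fun D (fun x => n1 (f x)).
Proof. by move=> [h1 h2]; apply: measurable_funD; exact: measurableT_comp. Qed.

Lemma cmeas_sqmod D f : cmeas D f -> measurable_fun D (fun x => sqmod (f x)).
Proof. by move=> [h1 h2]; apply: measurable_funD; exact: measurable_funX. Qed.

Lemma cint_le D f (g : R -> R) : measurable D -> cmeas D f ->
  (forall x, D x -> n1 (f x) <= g x) -> integ D g -> cint D f.
Proof.
move=> mD [h1 h2] fg ig; split; apply: integ_le (ig) => // x Dx /=;
  apply: le_trans (fg _ Dx); rewrite /n1.
  by rewrite lerDl.
by rewrite lerDr.
Qed.

Lemma cint_n1 D f : measurable D -> cint D f -> integ D (fun x => n1 (f x)).
Proof. by move=> mD [h1 h2]; apply: integD => //; exact: integ_norm. Qed.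

Lemma cintD D f g : measurable D -> cint D f -> cint D g ->
  cint D (fun x => f x + g x).
Proof.
move=> mD hf hg.
apply: (@cint_le _ _ (fun x => n1 (f x) + n1 (g x))) => //.
- by apply: cmeasD; exact: cint_meas.
- by move=> x _; exact: n1D.
- by apply: integD => //; exact: cint_n1.
Qed.

Lemma cint_mulb D f g c : measurable D -> cmeas D f ->
  (forall x, D x -> n1 (f x) <= c) -> cint D g -> cint D (fun x => f x * g x).
Proof.
move=> mD mf fc ig.
apply: (@cint_le _ _ (fun x => c * n1 (g x))) => //.
- by apply: cmeasM => //; exact: cint_meas.
- move=> x Dx; apply: le_trans (n1M _ _) _.
  by rewrite ler_wpM2r ?n1_ge0// fc.
- by apply: integZ => //; exact: cint_n1.
Qed.

Lemma cintZ D w f : measurable D -> cint D f -> cint D (fun x => w * f x).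
Proof.
by move=> mD; apply: (@cint_mulb _ _ _ (n1 w)) => //; exact: cmeas_cst.
Qed.

Lemma cintN D f : measurable D -> cint D f -> cint D (fun x => - f x).
Proof. by move=> mD /(cintZ (-1) mD); apply: cint_ext => // x _; rewrite mulN1r. Qed.

Lemma cint_sub D D' f : measurable D -> measurable D' -> D `<=` D' ->
  cint D' f -> cint D f.
Proof. by move=> mD mD' DD' [h1 h2]; split; [exact: integS h1|exact: integS h2]. Qed.

Lemma cint0 D : measurable D -> cint D (fun=> 0).
Proof. by move=> mD; split; exact: integ_cst0. Qed.

Lemma cint_sum (J : Type) (r : seq J) D (F : J -> R -> C) : measurable D ->
  (forall j, cint D (F j)) -> cint D (fun x => \sum_(j <- r) F j x).
Proof.
move=> mD iF; elim: r => [|j r IH].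
  by apply: cint_ext (cint0 mD) => // x _; rewrite big_nil.
by apply: cint_ext (cintD mD (iF j) IH) => // x _; rewrite big_cons.
Qed.

Lemma cintegral_ext D f g : (forall x, D x -> f x = g x) ->
  cintegral D f = cintegral D g.
Proof. by move=> fg; rewrite /cintegral; congr Complex; apply: Rint_ext => x Dx; rewrite fg. Qed.

Lemma cintegralD D f g : measurable D -> cint D f -> cint D g ->
  cintegral D (fun x => f x + g x) = cintegral D f + cintegral D g.
Proof.
move=> mD [h1 h2] [h3 h4]; apply: cext; rewrite cReE /= -RintegralD//;
  by apply: Rint_ext => x _; rewrite cReE.
Qed.

Lemma cintegralZ D w f : measurable D -> cint D f ->
  cintegral D (fun x => w * f x) = w * cintegral D f.
Proof.
move=> mD [h1 h2]; apply: cext; rewrite cReE /= -!RintegralZl//.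
  by rewrite -RintegralB//; [apply: Rint_ext => x _; rewrite cReE|exact: integZ|exact: integZ].
by rewrite -RintegralD//; [apply: Rint_ext => x _; rewrite cReE|exact: integZ|exact: integZ].
Qed.

Lemma cintegralN D f : measurable D -> cint D f ->
  cintegral D (fun x => - f x) = - cintegral D f.
Proof.
move=> mD hf; rewrite -mulN1r -cintegralZ//.
by apply: cintegral_ext => x _; rewrite mulN1r.
Qed.

Lemma cintegralB D f g : measurable D -> cint D f -> cint D g ->
  cintegral D (fun x => f x - g x) = cintegral D f - cintegral D g.
Proof. by move=> mD hf hg; rewrite cintegralD ?cintegralN//; exact: cintN. Qed.

Lemma cintegral0 D : cintegral D (fun=> 0) = 0 :> C.
Proof. by apply: cext; rewrite /= /Rintegral integral0. Qed.

Lemma cintegral_sum (J : Type) (r : seq J) D (F : J -> R -> C) : measurable D ->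
  (forall j, cint D (F j)) ->
  cintegral D (fun x => \sum_(j <- r) F j x) = \sum_(j <- r) cintegral D (F j).
Proof.
move=> mD iF; elim: r => [|j r IH].
  rewrite big_nil -[RHS](cintegral0 D).
  by apply: cintegral_ext => x _; rewrite big_nil.
rewrite big_cons -IH -cintegralD//; last exact: cint_sum.
by apply: cintegral_ext => x _; rewrite big_cons.
Qed.

Lemma n1_cintegral D f : measurable D -> cint D f ->
  n1 (cintegral D f) <= \int[leb]_(x in D) n1 (f x).
Proof.
move=> mD [h1 h2]; rewrite /n1 RintegralD//; try exact: integ_norm.
by apply: lerD; exact: le_normr_Rintegral.
Qed.

Lemma csqD D f g : measurable D -> csq D f -> csq D g -> csq D (fun x => f x + g x).
Proof.
move=> mD [h1 h2] [h3 h4]; split.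
  by apply: sqint_ext (sqintD mD h1 h3) => // x _ /=; rewrite cReE.
by apply: sqint_ext (sqintD mD h2 h4) => // x _ /=; rewrite cReE.
Qed.

Lemma csq_mulb D f g c : measurable D -> cmeas D f ->
  (forall x, D x -> n1 (f x) <= c) -> csq D g -> csq D (fun x => f x * g x).
Proof.
move=> mD [m1 m2] fc [h1 h2].
have b1 x : D x -> `|(cRe \o f) x| <= c.
  by move=> /fc; apply: le_trans; rewrite lerDl.
have b2 x : D x -> `|(cIm \o f) x| <= c.
  by move=> /fc; apply: le_trans; rewrite lerDr.
have s1 := sqint_mulb mD m1 b1 h1; have s2 := sqint_mulb mD m2 b2 h2.
have s3 := sqint_mulb mD m1 b1 h2; have s4 := sqint_mulb mD m2 b2 h1.
split.
  by apply: sqint_ext (sqintD mD s1 (sqintN mD s2)) => // x _ /=; rewrite cReE.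
by apply: sqint_ext (sqintD mD s3 s4) => // x _ /=; rewrite cReE.
Qed.

Lemma csqZ D w f : measurable D -> csq D f -> csq D (fun x => w * f x).
Proof. by move=> mD; apply: (@csq_mulb _ _ _ (n1 w)) => //; exact: cmeas_cst. Qed.

Lemma csqN D f : measurable D -> csq D f -> csq D (fun x => - f x).
Proof. by move=> mD /(csqZ (-1) mD); apply: csq_ext => // x _; rewrite mulN1r. Qed.

Lemma csqB D f g : measurable D -> csq D f -> csq D g -> csq D (fun x => f x - g x).
Proof. by move=> mD hf hg; apply: csqD => //; exact: csqN. Qed.

Lemma csqJ D f : measurable D -> csq D f -> csq D (fun x => (f x)^*).
Proof.
move=> mD [h1 h2]; split; first by apply: sqint_ext h1 => // x _ /=; rewrite cReE.
by apply: sqint_ext (sqintN mD h2) => // x _ /=; rewrite cReE.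
Qed.

Lemma csq0 D : measurable D -> csq D (fun=> 0).
Proof.
move=> mD; split; split; do 1?[exact: measurable_cst].
  by apply: integ_ext (integ_cst0 mD) => // x _; rewrite /= expr0n.
by apply: integ_ext (integ_cst0 mD) => // x _; rewrite /= expr0n.
Qed.

Lemma csq_sum (J : Type) (r : seq J) D (F : J -> R -> C) : measurable D ->
  (forall j, csq D (F j)) -> csq D (fun x => \sum_(j <- r) F j x).
Proof.
move=> mD iF; elim: r => [|j r IH].
  by apply: csq_ext (csq0 mD) => // x _; rewrite big_nil.
by apply: csq_ext (csqD mD (iF j) IH) => // x _; rewrite big_cons.
Qed.

Lemma csq_sub D D' f : measurable D -> measurable D' -> D `<=` D' ->
  csq D' f -> csq D f.
Proof. by move=> mD mD' DD' [h1 h2]; split; [exact: sqint_sub h1|exact: sqint_sub h2]. Qed.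

Lemma csq_sqmod D f : measurable D -> csq D f -> integ D (fun x => sqmod (f x)).
Proof. by move=> mD [[_ h1] [_ h2]]; exact: integD. Qed.

Lemma csqE D f : measurable D -> cmeas D f -> integ D (fun x => sqmod (f x)) -> csq D f.
Proof.
move=> mD [m1 m2] h; split; split => //; apply: integ_le h => //;
  do 1?[exact: measurable_funX]; move=> x _; rewrite ger0_norm ?sqr_ge0// /sqmod /=.
  by rewrite lerDl sqr_ge0.
by rewrite lerDr sqr_ge0.
Qed.

Lemma csq_mul D f g : measurable D -> csq D f -> csq D g -> cint D (fun x => f x * g x).
Proof.
move=> mD [h1 h2] [h3 h4]; split.
  apply: integ_ext (integB mD (sqint_mul mD h1 h3) (sqint_mul mD h2 h4)) => // x _ /=.
  by rewrite cReE.
apply: integ_ext (integD mD (sqint_mul mD h1 h4) (sqint_mul mD h2 h3)) => // x _ /=.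
by rewrite cReE.
Qed.

Lemma csq_cint (x : R) f : csq `[0, x] f -> cint `[0, x] f.
Proof. by move=> [h1 h2]; split; exact: sqint_integ. Qed.

Lemma csq_loc l f x : csq (edge l) f -> edge l x -> cint `[0, x] f.
Proof.
move=> h lx; apply: csq_cint; apply: csq_sub h => //; first exact: measurable_edge.
exact: edge_sub.
Qed.

Lemma csq_bounded (x c : R) f : cmeas `[0, x] f ->
  (forall y, 0 <= y <= x -> n1 (f y) <= c) -> csq `[0, x] f.
Proof.
move=> [h1 h2] fc; split; apply: (@sqint_bounded _ _ c) => // y /fc /=;
  apply: le_trans; rewrite /n1; first by rewrite lerDl.
by rewrite lerDr.
Qed.

Lemma cprimD l f f1 g g1 : cprim l f f1 -> cprim l g g1 ->
  cprim l (fun x => f x + g x) (fun x => f1 x + g1 x).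
Proof.
move=> [h1 h2] [h3 h4]; split; [apply: prim_ext (primD h1 h3)|apply: prim_ext (primD h2 h4)];
  by move=> x _ /=; rewrite cReE.
Qed.

Lemma cprimJ l f f1 : cprim l f f1 -> cprim l (fun x => (f x)^*) (fun x => (f1 x)^*).
Proof.
move=> [h1 h2]; split; [apply: prim_ext h1|apply: prim_ext (primN h2)];
  by move=> x _ /=; rewrite cReE.
Qed.

Lemma cprim_mul l f f1 g g1 : cprim l f f1 -> cprim l g g1 ->
  cprim l (fun x => f x * g x) (fun x => f1 x * g x + f x * g1 x).
Proof.
move=> [h1 h2] [h3 h4]; split.
  apply: prim_ext (primB (prim_mul h1 h3) (prim_mul h2 h4)) => x _ /=; rewrite !cReE//.
  by ring.
apply: prim_ext (primD (prim_mul h1 h4) (prim_mul h2 h3)) => x _ /=; rewrite !cReE//.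
by ring.
Qed.

Lemma cprim_cst l w : cprim l (fun=> w) (fun=> 0).
Proof.
split; split => x lx; do 1?[exact: integ_cst0];
  by rewrite /= /Rintegral integral0 addr0.
Qed.

Lemma cprimZ l w f f1 : cprim l f f1 ->
  cprim l (fun x => w * f x) (fun x => w * f1 x).
Proof.
move=> h; apply: cprim_ext (cprim_mul (cprim_cst l w) h) => x _ //.
by rewrite mul0r add0r.
Qed.

Lemma cprimN l f f1 : cprim l f f1 -> cprim l (fun x => - f x) (fun x => - f1 x).
Proof. by move=> /(cprimZ (-1)); apply: cprim_ext => x _; rewrite mulN1r. Qed.

Lemma cprimB l f f1 g g1 : cprim l f f1 -> cprim l g g1 ->
  cprim l (fun x => f x - g x) (fun x => f1 x - g1 x).
Proof. by move=> h1 h2; apply: cprimD => //; exact: cprimN. Qed.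

Lemma cprim_sum (J : Type) (r : seq J) l (F F1 : J -> R -> C) :
  (forall j, cprim l (F j) (F1 j)) ->
  cprim l (fun x => \sum_(j <- r) F j x) (fun x => \sum_(j <- r) F1 j x).
Proof.
move=> pF; elim: r => [|j r IH].
  by apply: cprim_ext (cprim_cst l 0) => x _; rewrite big_nil.
by apply: cprim_ext (cprimD (pF j) IH) => x _; rewrite big_cons.
Qed.

Lemma cprim_sub l l' f f1 : edge l `<=` edge l' -> cprim l' f f1 -> cprim l f f1.
Proof. by move=> ll' [h1 h2]; split; exact: prim_sub ll' _. Qed.

Lemma cprim_meas l f f1 : cprim l f f1 -> cmeas (edge l) f.
Proof. by move=> [/prim_meas h1 /prim_meas h2]. Qed.

Lemma cprim_bound l f f1 x y : cprim l f f1 -> edge l x -> 0 <= y <= x ->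
  n1 (f y) <= n1 (f 0) + \int[leb]_(t in `[0, x]) n1 (f1 t).
Proof.
move=> pf lx xy; have [i1 i2] := cprim_int pf lx; case: (pf) => h1 h2.
rewrite /n1 RintegralD//; try exact: integ_norm.
by rewrite addrACA; apply: lerD; [exact: prim_bound h1 lx xy|exact: prim_bound h2 lx xy].
Qed.

Lemma cprim_csq l f f1 x : cprim l f f1 -> edge l x -> csq `[0, x] f.
Proof.
move=> pf lx; apply: csq_bounded; last by move=> y; exact: cprim_bound pf lx.
by apply: cmeas_sub (cprim_meas pf); [exact: measurable_edge|exact: edge_sub].
Qed.

Lemma cprim_cintegral l w f : (forall x, edge l x -> cint `[0, x] f) ->
  cprim l (fun x => w + cintegral `[0, x] f) f.
Proof.
move=> h; apply: cprimE => // x lx.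
rewrite (_ : cintegral `[0, 0] f = 0) ?addr0//.
by apply: cext; rewrite /= Rint_itv0.
Qed.

End ComplexLayer.

(** * Linear second-order equations *)

Section ODE.
Variable R : realType.
Local Notation leb := (@lebesgue_measure R).
Local Notation integ D f := (leb.-integrable D (EFin \o f)).
Local Notation C := R[i].
Implicit Types (l : option R).

Lemma prim_C1 (f f1 : R -> R) : (forall x : R, is_derive x 1 f (f1 x)) ->
  continuous f1 -> prim None f f1.
Proof.
move=> df cf1.
have cf : continuous f.
  by move=> x; apply: differentiable_continuous; apply/derivable1_diffP; case: (df x).
split => x /= x0.
  apply: continuous_compact_integrable; first exact: segment_compact.
  by apply: continuous_subspaceT => y; exact: cf1.
move: x0; rewrite le_eqVlt => /predU1P[<-|x0]; first by rewrite Rint_itv0 addr0.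
have := @continuous_FTC2 _ f1 f 0 x x0.
rewrite /Rintegral => -> /=.
- by rewrite addrCA subrr addr0.
- by apply: continuous_subspaceT => y; exact: cf1.
- split.
  + by move=> y _; case: (df y).
  + exact/cvg_at_right_filter/cf.
  + exact/cvg_at_left_filter/cf.
- by move=> y _; rewrite derive1E; case: (df y).
Qed.

Lemma prim_exp (a : R) : prim None (fun x => expR (a * x)) (fun x => a * expR (a * x)).
Proof.
apply: prim_C1 => x.
  apply: is_derive_eq; rewrite /GRing.scale /=; ring.
have -> : (fun x => a * expR (a * x)) = (fun=> a) \* (expR \o *%R a) by [].
apply: continuousM; first exact: cvg_cst.
by apply: continuous_comp; [exact: mulrl_continuous|exact: continuous_expR].
Qed.

Lemma Rint_exp (a x : R) : 0 <= x ->
  integ `[0, x] (fun t => expR (a * t)) /\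
  a * \int[leb]_(t in `[0, x]) expR (a * t) = expR (a * x) - 1.
Proof.
move=> x0; have pe := prim_exp a; have mpe := prim_meas pe.
have sub : `[0, x] `<=` edge None := @edge_sub R None x x0.
have ie : integ `[0, x] (fun t => expR (a * t)).
  apply: (@integ_bounded _ _ _ (expR (`|a| * x))).
    by apply: measurable_funS sub mpe; exact: measurable_edge.
  move=> y /andP[y0 yx]; rewrite ger0_norm ?expR_ge0// ler_expR.
  apply: le_trans (ler_norm _) _; rewrite normrM ler_wpM2l//.
  by rewrite ger0_norm.
split => //; rewrite -RintegralZl//.
by have [_ ->] := pe; rewrite // mulr0 expR0 [1 + _]addrC addrK.
Qed.

(** Let [M] be the supremum of [e^(- 2 K t) y t], finite by the bound [B]. Inserting
    [y t <= M e^(2 K t)] into the integral inequality gives [M <= A + M / 2], which is the origin of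
    the factor [2]. *)
Lemma gronwall (X K A B : R) (y : R -> R) : 0 < K -> 0 <= A ->
  measurable_fun `[0, X] y -> (forall x, 0 <= x <= X -> 0 <= y x <= B) ->
  (forall x, 0 <= x <= X -> y x <= A + K * \int[leb]_(t in `[0, x]) y t) ->
  forall x, 0 <= x <= X -> y x <= 2 * A * expR (2 * K * x).
Proof.
move=> K0 A0 my yB yK x xX.
pose S := [set expR (- (2 * K * t)) * y t | t in `[0, X]%classic].
have X0 : 0 <= X by case/andP: xX => /le_trans h /h.
have B0 : 0 <= B by have /andP[/le_trans h /h] := yB x xX.
have ubS : ubound S B.
  move=> _ [t tX0 <-]; have tX : 0 <= t <= X by move: tX0; rewrite /= in_itv.
  have /andP[t0 _] := tX; have /andP[y0 yb] := yB t tX.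
  rewrite -[leRHS]mul1r ler_pM ?expR_ge0//.
  by rewrite -[leRHS]expR0 ler_expR oppr_le0 !mulr_ge0// ltW.
have hS : has_sup S.
  split; last by exists B.
  by exists (expR (- (2 * K * x)) * y x); exists x => //=; rewrite in_itv.
set M := sup S.
have yM t : 0 <= t <= X -> y t <= M * expR (2 * K * t).
  move=> tX; rewrite -ler_pdivrMr ?expR_gt0// mulrC -expRN.
  by apply: sup_upper_bound => //; exists t => //=; rewrite in_itv.
have M0 : 0 <= M.
  have := yM x xX; have /andP[y0 _] := yB x xX.
  by move=> /(le_trans y0); rewrite pmulr_lge0// expR_gt0.
(* [K] times the integral of [e^(2 K s)] over [[0, t]] equals [(e^(2 K t) - 1) / 2]. *)
have MA : M <= A + M / 2.
  apply: sup_le_ub; first by case: hS.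
  move=> _ [t tX0 <-]; have tX : 0 <= t <= X by move: tX0; rewrite /= in_itv.
  have /andP[t0 tX'] := tX.
  have [ie Ee] := Rint_exp (2 * K) t0.
  rewrite expRN mulrC ler_pdivrMr ?expR_gt0//.
  apply: le_trans (yK t tX) _.
  have le1 : \int[leb]_(s in `[0, t]) y s <= M * \int[leb]_(s in `[0, t]) expR (2 * K * s).
    rewrite -RintegralZl//; apply: Rint_le => //; last first.
      move=> s /=; rewrite in_itv /= => /andP[s0 st]; apply: yM.
      by rewrite s0 (le_trans st).
    + exact: integZ.
    + apply: (@integ_bounded _ _ _ B).
        apply: measurable_funS my => //; move=> s /=; rewrite !in_itv /= => /andP[-> st].
        by rewrite (le_trans st).
      move=> s /andP[s0 st]; have /andP[y0 yb] : 0 <= y s <= B.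
        by apply: yB; rewrite s0 (le_trans st).
      by rewrite ger0_norm.
  have e1 : 1 <= expR (2 * K * t).
    by rewrite -[leLHS]expR0 ler_expR !mulr_ge0// ltW.
  move: le1 Ee e1; set I := \int[leb]_(s in _) _; set J := \int[leb]_(s in _) _.
  set e := expR _ => le1 Ee e1.
  have : K * I <= M / 2 * (2 * K * J) by nra.
  rewrite Ee => h; apply: le_trans (_ : A + M / 2 * (e - 1) <= _); first by rewrite lerD2l.
  have : 0 <= M / 2 by rewrite divr_ge0.
  nra.
apply: le_trans (yM x xX) _; rewrite ler_wpM2r ?expR_ge0//; lra.
Qed.

(** The sum [n1 u + n1 u1] satisfies the Gronwall inequality with rate [K + 1]: the derivative of
    [u] contributes [n1 u1], that of [u1] contributes [K * n1 u] and the source. *)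
Lemma schr_gronwall (X K : R) (q f u u1 : R -> C) : 0 <= K ->
  (forall x, 0 <= x <= X -> n1 (q x) <= K) -> cint `[0, X] f ->
  cprim (Some X) u u1 -> cprim (Some X) u1 (fun x => q x * u x - f x) ->
  forall x, 0 <= x <= X -> n1 (u x) + n1 (u1 x) <=
    2 * (n1 (u 0) + n1 (u1 0) + \int[leb]_(t in `[0, X]) n1 (f t))
    * expR (2 * (K + 1) * X).
Proof.
move=> K0 qK cf pu pu1 x xX.
have X0 : 0 <= X by case/andP: xX => /le_trans h /h.
have eX : edge (Some X) X by rewrite /= X0 lexx.
set A := n1 (u 0) + n1 (u1 0) + _.
have If0 : 0 <= \int[leb]_(t in `[0, X]) n1 (f t) by apply: Rintegral_ge0 => t _; exact: n1_ge0.
have A0 : 0 <= A by rewrite !addr_ge0 ?n1_ge0.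
have K1 : 0 < K + 1 by rewrite ltr_wpDl.
have mu : measurable_fun `[0, X] (fun x => n1 (u x)).
  by have := cprim_meas pu; rewrite edge_Some => /cmeas_n1.
have mu1 : measurable_fun `[0, X] (fun x => n1 (u1 x)).
  by have := cprim_meas pu1; rewrite edge_Some => /cmeas_n1.
have [Bu bu] : exists B, forall y, 0 <= y <= X -> n1 (u y) <= B.
  by eexists => y; exact: cprim_bound pu eX.
have [Bu1 bu1] : exists B, forall y, 0 <= y <= X -> n1 (u1 y) <= B.
  by eexists => y; exact: cprim_bound pu1 eX.
have := @gronwall X (K + 1) A (Bu + Bu1) (fun x => n1 (u x) + n1 (u1 x)) K1 A0.
move=> /(_ (measurable_funD mu mu1)) h.
apply: le_trans (h _ _ x xX) _.
- by move=> y yX; rewrite addr_ge0 ?n1_ge0// lerD ?bu ?bu1.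
- move=> y yX; have /andP[y0 yX'] := yX.
  have ey : edge (Some X) y by [].
  have sub : `[0, y] `<=` `[0, X].
    by move=> t /=; rewrite !in_itv /= => /andP[-> /le_trans]; apply.
  have iu : integ `[0, y] (fun t => n1 (u t)).
    apply: (@integ_bounded _ _ _ Bu); first exact: measurable_funS mu.
    by move=> t /andP[t0 ty]; rewrite ger0_norm ?n1_ge0// bu// t0 (le_trans ty).
  have iu1 : integ `[0, y] (fun t => n1 (u1 t)).
    apply: (@integ_bounded _ _ _ Bu1); first exact: measurable_funS mu1.
    by move=> t /andP[t0 ty]; rewrite ger0_norm ?n1_ge0// bu1// t0 (le_trans ty).
  have if_ : integ `[0, y] (fun t => n1 (f t)).
    by apply: integS (cint_n1 _ cf).
  have yy : 0 <= y <= y by rewrite y0 lexx.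
  have b1 := cprim_bound pu ey yy; have b2 := cprim_bound pu1 ey yy.
  have b3 : \int[leb]_(t in `[0, y]) n1 (q t * u t - f t) <=
      K * \int[leb]_(t in `[0, y]) n1 (u t) + \int[leb]_(t in `[0, y]) n1 (f t).
    rewrite -RintegralZl// -RintegralD//; last exact: integZ.
    apply: Rint_le => //.
    + by apply: cint_n1 => //; exact: cprim_int pu1 ey.
    + by apply: integD => //; exact: integZ.
    + move=> t /=; rewrite in_itv /= => /andP[t0 ty].
      apply: le_trans (n1B _ _) _; rewrite lerD2r.
      apply: le_trans (n1M _ _) _; rewrite ler_wpM2r ?n1_ge0// qK//.
      by rewrite t0 (le_trans ty).
  have b4 : \int[leb]_(t in `[0, y]) n1 (f t) <= \int[leb]_(t in `[0, X]) n1 (f t).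
    by apply: Rint_subset => //; [exact: cint_n1|move=> t _; exact: n1_ge0].
  rewrite RintegralD//.
  have I1 : 0 <= \int[leb]_(t in `[0, y]) n1 (u t) by apply: Rintegral_ge0 => t _; exact: n1_ge0.
  have I2 : 0 <= \int[leb]_(t in `[0, y]) n1 (u1 t) by apply: Rintegral_ge0 => t _; exact: n1_ge0.
  move: b1 b2 b3 b4 I1 I2; rewrite /A.
  move: (\int[leb]_(t in `[0, y]) n1 (u t)) (\int[leb]_(t in `[0, y]) n1 (u1 t)).
  move: (\int[leb]_(t in `[0, y]) n1 (f t)) (\int[leb]_(t in `[0, X]) n1 (f t)).
  move: (\int[leb]_(t in `[0, y]) n1 (q t * u t - f t)) => I1 I2 I3 I4 I5.
  move: (n1 (u y)) (n1 (u1 y)) (n1 (u 0)) (n1 (u1 0)) => *; nra.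
- have /andP[x0 xX'] := xX.
  rewrite ler_wpM2l ?mulr_ge0// ler_expR ler_wpM2l// mulr_ge0// ltW//.
Qed.

(** Nested intervals: subtracting and adding the tail [2 c 2^(-n)] of the geometric series gives an
    increasing and a decreasing sequence, and the supremum of the former lies in every interval
    between them. *)
Lemma geometric_limit (s : nat -> R) (c : R) :
  (forall n, `|s n.+1 - s n| <= c * 2^-1 ^+ n) ->
  exists L, forall n, `|L - s n| <= 2 * c * 2^-1 ^+ n.
Proof.
move=> hs.
pose a n := s n - 2 * c * 2^-1 ^+ n; pose b n := s n + 2 * c * 2^-1 ^+ n.
have e n : 2 * c * 2^-1 ^+ n - 2 * c * 2^-1 ^+ n.+1 = c * 2^-1 ^+ n.
  by rewrite exprS; field.
have aS n : a n <= a n.+1.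
  have := hs n; have := e n; rewrite ler_norml /a => en /andP[]; lra.
have bS n : b n.+1 <= b n.
  have := hs n; have := e n; rewrite ler_norml /b => en /andP[]; lra.
have c0 : 0 <= c by have := hs 0%N; rewrite expr0 mulr1; apply: le_trans.
have am n k : a n <= a (n + k)%N.
  by elim: k => [|k IH]; rewrite ?addn0// addnS (le_trans IH).
have bm n k : b (n + k)%N <= b n.
  by elim: k => [|k IH]; rewrite ?addn0// addnS (le_trans _ IH).
have ab n m : a n <= b m.
  apply: le_trans (am n m) _; rewrite addnC; apply: le_trans (bm m n).
  rewrite addnC /a /b; have : 0 <= 2 * c * 2^-1 ^+ (n + m) by rewrite !mulr_ge0// exprn_ge0// invr_ge0.
  lra.
have hS : has_sup (range a).
  by split; [exists (a 0%N); exists 0%N|exists (b 0%N) => _ [n _ <-]].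
exists (sup (range a)) => n.
have h1 : a n <= sup (range a) by apply: sup_upper_bound => //; exists n.
have h2 : sup (range a) <= b n.
  by apply: sup_le_ub; [case: hS|move=> _ [k _ <-]].
by rewrite ler_norml; move: h1 h2; rewrite /a /b; lra.
Qed.

Definition volt (f : R -> C) (x : R) : C := cintegral `[0, x] f.

(* Picard iteration in the norm [sup_x e^(- th x) |u x|]. *)
Lemma volterra_exists (q b : R -> C) (K th B : R) : 0 < th -> 0 <= K ->
  2 * K <= th ^+ 2 ->
  cmeas (edge None) q -> (forall x, 0 <= x -> n1 (q x) <= K) ->
  cmeas (edge None) b -> (forall x, 0 <= x -> n1 (b x) <= B * expR (th * x)) ->
  exists u, [/\ cmeas (edge None) u,
    forall x, 0 <= x -> cint `[0, x] (fun t => q t * u t)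
    & forall x, 0 <= x -> u x = b x + volt (volt (fun t => q t * u t)) x].
Proof.
move=> th0 K0 Kth mq qK mb bB.
have mE : measurable (edge (None : option R)) := measurable_edge None.
have subE x : 0 <= x -> `[0, x] `<=` edge (None : option R) by exact: (@edge_sub R None).
pose good M (h : R -> C) := cmeas (edge None) h /\
  forall x, 0 <= x -> n1 (h x) <= M * expR (th * x).
have good_int M h x : good M h -> 0 <= x -> cint `[0, x] h.
  move=> [mh hM] x0; apply: (@cint_le _ _ _ (fun t => M * expR (th * t))) => //.
  - by apply: cmeas_sub mh => //; exact: subE.
  - by move=> t /=; rewrite in_itv /= => /andP[t0 _]; exact: hM.
  - by apply: integZ => //; case: (Rint_exp th x0).
have good_prim M h : good M h -> cprim None (volt h) h.
  move=> gh; apply: cprim_ext (@cprim_cintegral R None 0 h _) => [x _|//|x x0].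
    by rewrite add0r.
  exact: good_int gh x0.
have good_volt M h : good M h -> good (M / th) (volt h).
  move=> gh; split; first exact: cprim_meas (good_prim _ _ gh).
  move=> x x0; apply: le_trans (n1_cintegral _ (good_int _ _ _ gh x0)) _ => //.
  have [ie Ee] := Rint_exp th x0.
  have M0 : 0 <= M.
    case: gh => _ /(_ 0 (lexx _)); rewrite mulr0 expR0 mulr1.
    exact/le_trans/n1_ge0.
  apply: (@le_trans _ _ (M * \int[leb]_(t in `[0, x]) expR (th * t))).
    rewrite -RintegralZl//; apply: Rint_le => //.
    - by apply: cint_n1 => //; exact: good_int gh x0.
    - exact: integZ.
    - by move=> t /=; rewrite in_itv /= => /andP[t0 _]; case: gh => _; exact.
  rewrite -mulrA ler_wpM2l// ler_pdivlMl// Ee; lra.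
have good_mul M h : good M h -> good (K * M) (fun t => q t * h t).
  move=> [mh hM]; split; first exact: cmeasM.
  move=> x x0; apply: le_trans (n1M _ _) _; rewrite -mulrA.
  by rewrite ler_pM ?n1_ge0// ?qK// hM.
have goodW M M' h : M <= M' -> good M h -> good M' h.
  move=> MM [mh hM]; split => // x x0; apply: le_trans (hM _ x0) _.
  by rewrite ler_wpM2r ?expR_ge0.
pose VV h := volt (volt (fun t => q t * h t)).
have good_ge0 M h : good M h -> 0 <= M.
  case => _ /(_ 0 (lexx _)); rewrite mulr0 expR0 mulr1; exact/le_trans/n1_ge0.
(* Each integration divides the weighted norm by [th] and the coefficient [q] multiplies it by at
   most [K], so [2 K <= th ^ 2] makes the Volterra operator a contraction with factor [1 / 2]. *)
have good_VV M h : good M h -> good (M / 2) (VV h).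
  move=> gh; apply: goodW (good_volt _ _ (good_volt _ _ (good_mul _ _ gh))).
  rewrite -mulrA -invfM -expr2 ler_pdivrMr ?exprn_gt0//.
  have := good_ge0 _ _ gh; nra.
have VVB M M' h k : good M h -> good M' k ->
    forall x, 0 <= x -> VV h x - VV k x = VV (fun t => h t - k t) x.
  move=> gh gk x x0.
  have g1 := good_mul _ _ gh; have g2 := good_mul _ _ gk.
  rewrite /VV /volt -cintegralB//.
  - apply: cintegral_ext => t /=; rewrite in_itv /= => /andP[t0 _].
    rewrite -cintegralB//; [|exact: good_int g1 t0|exact: good_int g2 t0].
    by apply: cintegral_ext => s _; rewrite mulrBr.
  - exact: good_int (good_volt _ _ g1) x0.
  - exact: good_int (good_volt _ _ g2) x0.
have goodB M M' h k : good M h -> good M' k -> good (M + M') (fun t => h t - k t).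
  move=> [mh hM] [mk kM]; split; first exact: cmeasB.
  move=> x x0; rewrite mulrDl; apply: le_trans (n1B _ _) _.
  by rewrite lerD// ?hM ?kM.
have goodD M M' h k : good M h -> good M' k -> good (M + M') (fun t => h t + k t).
  move=> [mh hM] [mk kM]; split; first exact: cmeasD.
  move=> x x0; rewrite mulrDl; apply: le_trans (n1D _ _) _.
  by rewrite lerD// ?hM ?kM.
have gb : good B b by [].
have B0 := good_ge0 _ _ gb.
pose T h x := b x + VV h x.
pose s n := iter n T b.
have sSf n : s n.+1 = T (s n) by [].
have s0 : s 0%N = b by [].
clearbody s.
have sS n x : s n.+1 x = b x + VV (s n) x by rewrite sSf.
have gs n : exists M, good M (s n).
  elim: n => [|n [M IH]]; first by exists B; rewrite s0.
  by exists (B + M / 2); rewrite sSf; apply: goodD => //; exact: good_VV.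
have ds n : good (B * 2^-1 ^+ n) (fun x => s n.+1 x - s n x).
  elim: n => [|n IH].
    rewrite expr0 mulr1; apply: (@goodW (B / 2)); first lra.
    have [m1 h1] := good_VV _ _ gb.
    split; last by move=> x x0; rewrite sS s0 addrAC subrr add0r; exact: h1.
    by apply: cmeas_ext m1 => x _; rewrite sS s0 addrAC subrr add0r.
  have [M1 g1] := gs n.+1; have [M2 g2] := gs n.
  have [m1 h1] := good_VV _ _ IH.
  have E x : 0 <= x -> VV (fun x0 => s n.+1 x0 - s n x0) x = s n.+2 x - s n.+1 x.
    move=> x0; rewrite (sS n.+1 x) (sS n x) opprD addrACA subrr add0r.
    exact: esym (VVB _ _ _ _ g1 g2 x x0).
  split; first by apply: cmeas_ext m1 => x x0; rewrite E.
  by move=> x x0; rewrite -E// exprSr mulrA; exact: h1.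
(* The premise [0 <= x] stands inside the existential so that [choice] yields a total function; its
   values at negative points are irrelevant. *)
have lim x : exists L : C, 0 <= x ->
    forall n, n1 (L - s n x) <= 4 * (B * expR (th * x)) * 2^-1 ^+ n.
  have [x0|x0] := boolP (0 <= x); last by exists 0 => h; case/negP: x0.
  have dx n : n1 (s n.+1 x - s n x) <= B * expR (th * x) * 2^-1 ^+ n.
    by rewrite mulrAC; case: (ds n) => _; exact.
  have [L1 h1] : exists L, forall n, `|L - complex.Re (s n x)| <= 2 * (B * expR (th * x)) * 2^-1 ^+ n.
    apply: geometric_limit => n; apply: le_trans (dx n).
    by rewrite /n1 !cReE lerDl.
  have [L2 h2] : exists L, forall n, `|L - complex.Im (s n x)| <= 2 * (B * expR (th * x)) * 2^-1 ^+ n.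
    apply: geometric_limit => n; apply: le_trans (dx n).
    by rewrite /n1 !cReE lerDr.
  exists (L1 +i* L2) => _ n; rewrite /n1 !cReE /=.
  have := h1 n; have := h2 n; lra.
have [u hu] := choice lim.
have pow0 : (fun n => 2^-1 ^+ n : R) @ \oo --> 0.
  by apply: cvg_expr; rewrite ger0_norm ?invr_ge0// invf_lt1// ltr1n.
have powc (c : R) : (fun n => c * 2^-1 ^+ n : R) @ \oo --> 0.
  by rewrite -(mulr0 c); apply: cvgMr.
have small (a c : R) : (forall n, a <= c * 2^-1 ^+ n) -> a <= 0.
  move=> h; rewrite leNgt; apply/negP => a0.
  have a2 : 0 < a / 2 by rewrite divr_gt0.
  have /cvgr0_norm_le /(_ _ a2) /filter_ex[n hn] := powc c.
  have := le_trans (h n) (le_trans (ler_norm _) hn); lra.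
have mu : cmeas (edge None) u.
  split.
    apply: (@measurable_fun_cvg _ _ _ _ (fun n x => complex.Re (s n x))).
      by move=> n; have [M [[]]] := gs n.
    move=> x x0; apply/cvgrPdist_le => e e0; near=> n.
    apply: le_trans (_ : n1 (u x - s n x) <= _); first by rewrite /n1 !cReE lerDl.
    apply: le_trans (hu x x0 n) _; near: n.
    have /cvgr0_norm_le /(_ e e0) := powc (4 * (B * expR (th * x))).
    apply: filterS => n.
    exact/le_trans/ler_norm.
  apply: (@measurable_fun_cvg _ _ _ _ (fun n x => complex.Im (s n x))).
    by move=> n; have [M [[]]] := gs n.
  move=> x x0; apply/cvgrPdist_le => e e0; near=> n.
  apply: le_trans (_ : n1 (u x - s n x) <= _); first by rewrite /n1 !cReE lerDr.
  apply: le_trans (hu x x0 n) _; near: n.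
  have /cvgr0_norm_le /(_ e e0) := powc (4 * (B * expR (th * x))).
  apply: filterS => n.
  exact/le_trans/ler_norm.
have gus n : good (4 * B * 2^-1 ^+ n) (fun x => u x - s n x).
  split; first by apply: cmeasB => //; have [M [[]]] := gs n.
  by move=> x x0; apply: le_trans (hu x x0 n) _; rewrite mulrA mulrAC.
have gu : good (4 * B + B) u.
  have [m1 h1] := goodD _ _ _ _ (gus 0%N) gb.
  split => // x x0; have := h1 x x0; rewrite s0 expr0 mulr1 subrK//.
exists u; split => //; first by move=> x x0; exact: good_int (good_mul _ _ gu) x0.
move=> x x0; apply/eqP; rewrite -subr_eq0; apply/eqP/n1_eq0.
apply: (small _ (6 * B * expR (th * x))) => n.
have [M gsn] := gs n.
(* The defect of the limit is expressed by the errors of two consecutive iterates, both of order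
   [2^(-n)], for every [n]. *)
have -> : u x - (b x + volt (volt (fun t => q t * u t)) x) =
    (u x - s n.+1 x) - VV (fun t => u t - s n t) x.
  have alg (w1 w2 w3 w4 : C) : w1 - (w2 + w3) = (w1 - (w2 + w4)) - (w3 - w4) by ring.
  rewrite (sS n x) -(VVB _ _ _ _ gu gsn x x0); exact: alg.
apply: le_trans (n1B _ _) _.
have [_ h1] := gus n.+1; have [_ h2] := good_VV _ _ (gus n).
apply: le_trans (lerD (h1 x x0) (h2 x x0)) _.
have := expR_ge0 (th * x); have : 0 <= 2^-1 ^+ n :> R by rewrite exprn_ge0// invr_ge0.
rewrite exprS; move: (2^-1 ^+ n) (expR _) => p e p0 e0.
have : 0 <= B * p * e by rewrite !mulr_ge0.
lra.
Unshelve. all: by end_near. Qed.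

End ODE.

(** * Initial value problems on the half-line and bounds for boundary values *)

Section Schroedinger.
Variable R : realType.
Local Notation leb := (@lebesgue_measure R).
Local Notation integ D f := (leb.-integrable D (EFin \o f)).
Local Notation C := R[i].
Implicit Types (l : option R).

Lemma Rint_cst (a b c : R) : a <= b -> \int[leb]_(t in `[a, b]) c = c * (b - a).
Proof.
move=> ab; have mx : fine (leb `[a, b]) = b - a.
  rewrite lebesgue_measure_itv /= lte_fin; case: ifPn => //; rewrite -leNgt => ba.
  by apply/eqP; rewrite eq_sym subr_eq0; apply/eqP/le_anti/andP.
by rewrite Rintegral_cst//; congr *%R; exact: mx.
Qed.

(** Monotone convergence along the intervals [[a, n]]. Square integrability on a half-line is always
    deduced from bounds on [[0, x]] uniform in [x] by this lemma. *)
Lemma integ_exhaust (a M : R) (f : R -> R) : (forall x, a <= x -> 0 <= f x) ->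
  (forall x, integ `[a, x] f) -> (forall x, \int[leb]_(t in `[a, x]) f t <= M) ->
  integ `[a, +oo[ f /\ \int[leb]_(t in `[a, +oo[) f t <= M.
Proof.
move=> f0 fi fM.
have EU : \bigcup_n `[a, n%:R : R]%classic = `[a, +oo[%classic.
  apply/seteqP; split => x /=; first by move=> [n _] /=; rewrite !in_itv /= andbT => /andP[].
  rewrite in_itv /= andbT => ax; exists (Num.truncn x).+1 => //=.
  by rewrite in_itv /= ax ltW// truncnS_gt.
have mf : measurable_fun `[a, +oo[ f.
  by rewrite -EU; apply/measurable_fun_bigcup => // n; exact: integ_meas.
have cv : (fun n => \int[leb]_(x in `[a, n%:R : R]) (f x)%:E)%E @ \oo -->
    (\int[leb]_(x in `[a, +oo[) (f x)%:E)%E.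
  rewrite -EU; apply: ge0_nondecreasing_set_cvg_integral.
  - move=> n m nm; apply/subsetPset => x /=; rewrite !in_itv /= => /andP[-> xn] /=.
    by rewrite (le_trans xn)// ler_nat.
  - by move=> n; exact: measurable_itv.
  - by move=> n; exact: measurable_int (fi _).
  - by move=> n x /=; rewrite in_itv /= => /andP[ax _]; rewrite lee_fin f0.
have le : (\int[leb]_(x in `[a, +oo[) (f x)%:E <= M%:E)%E.
  rewrite -(cvg_lim _ cv)//; apply: lime_le; first by apply/cvg_ex; eexists; exact: cv.
  by apply: nearW => n; rewrite EFin_Rint// lee_fin.
have fin : integ `[a, +oo[ f.
  apply/integrableP; split; first exact/measurable_EFinP.
  apply: le_lt_trans (ltry M); apply: le_trans le.
  rewrite le_eqVlt; apply/orP; left; apply/eqP; apply: eq_integral => x /set_mem /=.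
  by rewrite in_itv /= andbT => ax; rewrite ger0_norm// f0.
by split => //; rewrite -lee_fin -EFin_Rint.
Qed.

Lemma csq_L1 (x : R) (f : R -> C) : 0 <= x -> csq `[0, x] f ->
  (\int[leb]_(t in `[0, x]) n1 (f t)) ^+ 2 <= 2 * x * \int[leb]_(t in `[0, x]) sqmod (f t).
Proof.
move=> x0 sf; have mI : measurable (`[0, x]%classic : set R) by [].
have s1 : sqint `[0, x] (fun=> 1 : R).
  by apply: (@sqint_bounded _ _ 1) => // y _; rewrite normr1.
have s2 : sqint `[0, x] (fun t => n1 (f t)).
  split; first exact: cmeas_n1 (csq_meas sf).
  apply: (@integ_le _ _ _ (fun t => 2 * sqmod (f t))) => //.
  - by apply: measurable_funX; exact: cmeas_n1 (csq_meas sf).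
  - by move=> t _; rewrite ger0_norm ?sqr_ge0// n1_le_sqmod.
  - by apply: integZ => //; exact: csq_sqmod.
have := Rint_CS mI s1 s2.
under [X in X ^+ 2 <= _]Rint_ext => t _ do rewrite normr1 mul1r ger0_norm ?n1_ge0//.
move=> /le_trans; apply.
rewrite [X in X * _](_ : _ = x); last first.
  under Rint_ext do rewrite expr1n.
  by rewrite Rint_cst// mul1r subr0.
rewrite [2 * x]mulrC -mulrA ler_wpM2l// -RintegralZl//; last exact: csq_sqmod.
apply: Rint_le => //; first by case: s2.
  by apply: integZ => //; exact: csq_sqmod.
by move=> t _; exact: n1_le_sqmod.
Qed.

(** The equation is the Volterra equation whose free term [b] is [al + be x] minus the double
    primitive of [f]. It remains to dominate [b] by an exponential, which holds since [b] grows at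
    most quadratically. *)
Lemma schr_exists (q f : R -> C) (K : R) (al be : C) :
  cmeas (edge None) q -> (forall x, 0 <= x -> n1 (q x) <= K) ->
  csq (edge None) f -> exists u u1 : R -> C,
  [/\ cprim None u u1, cprim None u1 (fun x => q x * u x - f x), u 0 = al & u1 0 = be].
Proof.
move=> mq qK sf.
have K0 : 0 <= K by apply: le_trans (qK 0 (lexx _)); exact: n1_ge0.
have fi (x : R) : edge None x -> cint `[0, x] f by exact: csq_loc.
pose N := \int[leb]_(t in edge None) sqmod (f t).
have N0 : 0 <= N by apply: Rintegral_ge0 => t _; exact: sqmod_ge0.
(* The bound [n1 w <= 1 + 2 sqmod w] turns square integrability of [f] into linear growth of its
   primitive. *)
have fN x : 0 <= x -> n1 (volt f x) <= x + 2 * N.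
  move=> x0; apply: le_trans (n1_cintegral _ (fi x x0)) _ => //.
  have mE := measurable_edge (None : option R).
  have sub : `[0, x] `<=` edge (None : option R) := @edge_sub R None x x0.
  have i2 := csq_sqmod mE sf.
  have i3 : integ `[0, x] (fun t => sqmod (f t)) by exact: integS i2.
  apply: (@le_trans _ _ (\int[leb]_(t in `[0, x]) (1 + 2 * sqmod (f t)))).
    apply: Rint_le => //.
    - by apply: cint_n1 => //; exact: fi.
    - apply: integD => //; last exact: integZ.
      by apply: (@integ_bounded _ _ _ 1) => // y _; rewrite normr1.
    - move=> t _; have := n1_le_sqmod (f t); have := sqr_ge0 (n1 (f t) - 1); nra.
  rewrite RintegralD//; last first.
  - exact: integZ.
  - by apply: (@integ_bounded _ _ _ 1) => // y _; rewrite normr1.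
  rewrite Rint_cst// mul1r subr0 RintegralZl// lerD2l.
  by rewrite ler_wpM2l// /N; apply: Rint_subset => // t _; exact: sqmod_ge0.
pose b1 x := be - volt f x.
have pb1 : cprim None b1 (fun x => - f x).
  apply: cprim_ext (cprimB (cprim_cst None be) (@cprim_cintegral R None 0 f fi)) => x _.
    by rewrite add0r.
  by rewrite sub0r.
have b1i (x : R) : edge None x -> cint `[0, x] b1.
  by move=> x0; apply: csq_cint; exact: cprim_csq pb1 x0.
pose b x := al + volt b1 x.
have pb : cprim None b b1 by exact: cprim_cintegral.
pose c := n1 be + 2 * N.
have c0 : 0 <= c by rewrite addr_ge0 ?n1_ge0// mulr_ge0.
have b1c x : 0 <= x -> n1 (b1 x) <= c + x.
  move=> x0; apply: le_trans (n1B _ _) _; have := fN x x0; rewrite /c; lra.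
have bc x : 0 <= x -> n1 (b x) <= n1 al + (c + x) * x.
  move=> x0; apply: le_trans (n1D _ _) _; rewrite lerD2l.
  apply: le_trans (n1_cintegral _ (b1i x x0)) _ => //.
  apply: (@le_trans _ _ (\int[leb]_(t in `[0, x]) (c + x))).
    apply: Rint_le => //.
    - by apply: cint_n1 => //; exact: b1i.
    - by apply: (@integ_bounded _ _ _ (c + x)) => // y _; rewrite ger0_norm// addr_ge0.
    - move=> t /=; rewrite in_itv /= => /andP[t0 tx]; apply: le_trans (b1c t t0) _.
      by rewrite lerD2l.
  by rewrite Rint_cst// subr0.
pose th := 2 * K + 1.
have th1 : 1 <= th by rewrite /th; lra.
pose B := n1 al + c + 4.
have bB x : 0 <= x -> n1 (b x) <= B * expR (th * x).
  move=> x0; apply: le_trans (bc x x0) _.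
  have e1 : (1 + x / 2) ^+ 2 <= expR x.
    have := expR_ge1Dx (x / 2) => h.
    rewrite (_ : expR x = expR (x / 2) ^+ 2); last first.
      by rewrite -expRM_natl; congr expR; rewrite mulr_natl -mulr_natr -mulrA mulVf ?mulr1 ?pnatr_eq0.
    by rewrite lerXn2r ?nnegrE ?expR_ge0// addr_ge0// divr_ge0.
  have e2 : expR x <= expR (th * x) by rewrite ler_expR ler_peMl.
  have e3 := le_trans e1 e2.
  move: (n1_ge0 al) c0 x0 e3; rewrite /B; move: (expR _) (n1 al) => e a a0 c0' x0 e3.
  have h1 : 1 <= e by nra.
  have h2 : x <= e by nra.
  have h3 : x ^+ 2 <= 4 * e by nra.
  have : a * 1 <= a * e by rewrite ler_wpM2l.
  have : c * x <= c * e by rewrite ler_wpM2l.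
  nra.
have th0 : 0 < th by lra.
have Kth : 2 * K <= th ^+ 2 by rewrite /th; nra.
have [u [mu iqu Eu]] := volterra_exists th0 K0 Kth mq qK (cprim_meas pb) bB.
pose w x := volt (fun t => q t * u t) x.
have pw : cprim None w (fun t => q t * u t).
  apply: cprim_ext (@cprim_cintegral R None 0 _ iqu) => x _ //.
  by rewrite add0r.
have pvw : cprim None (volt w) w.
  apply: cprim_ext (@cprim_cintegral R None 0 w _) => [x _|//|x x0].
    by rewrite add0r.
  by apply: csq_cint; exact: cprim_csq pw x0.
have v0 (h : R -> C) : volt h 0 = 0 by apply: cext; rewrite /= Rint_itv0.
exists u, (fun x => b1 x + w x); split.
- by apply: cprim_ext (cprimD pb pvw) => x x0 //; rewrite Eu.
- by apply: cprim_ext (cprimD pb1 pw) => x x0 //; rewrite addrC.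
- by rewrite Eu// !v0 addr0 /b v0 addr0.
- by rewrite /w v0 addr0 /b1 v0 subr0.
Qed.

(** Otherwise [f] minus its mean would be positive on [[a, b]] with integral zero, hence zero almost
    everywhere, and [[a, b]] would be a null set. *)
Lemma Rint_mean (a b : R) (f : R -> R) : a < b -> integ `[a, b] f ->
  exists2 x, a <= x <= b & f x * (b - a) <= \int[leb]_(t in `[a, b]) f t.
Proof.
move=> ab fi; apply: contrapT => H.
set I := \int[leb]_(t in _) _ in H.
have ba : 0 < b - a by rewrite subr_gt0.
have Hx x : a <= x <= b -> I / (b - a) < f x.
  move=> xab; rewrite ltNge; apply/negP => h; apply: H; exists x => //.
  by rewrite -ler_pdivlMr.
pose g x := f x - I / (b - a).
have gi : integ `[a, b] g.
  apply: integB => //; apply: measurable_bounded_integrable => //=.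
    by rewrite lebesgue_measure_itv /=; case: ifPn => //; rewrite ltry.
  by apply: bounded_cst.
have gI : \int[leb]_(t in `[a, b]) g t = 0.
  rewrite /g RintegralB//; last first.
    apply: measurable_bounded_integrable => //=; last exact: bounded_cst.
    by rewrite lebesgue_measure_itv /=; case: ifPn => //; rewrite ltry.
  by rewrite Rint_cst ?ltW// divfK ?subrr// gt_eqF.
have : (\int[leb]_(x in `[a, b]) `|(g x)%:E|)%E = 0%E.
  under eq_integral => x /set_mem xab.
    rewrite gee0_abs; first over.
    by rewrite lee_fin subr_ge0 ltW// Hx//; move: xab; rewrite /= in_itv.
  by rewrite EFin_Rint// gI.
have mI : measurable (`[a, b]%classic : set R) by exact: measurable_itv.
move=> /(ae_eq_integral_abs leb mI (measurable_int _ gi)) ae0.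
have : leb `[a, b] = 0%E.
  move: ae0 => [N [mN N0 HN]].
  apply/eqP; rewrite eq_le measure_ge0 andbT -N0; apply: le_measure; rewrite ?inE//.
  apply: subset_trans HN => x /= xab; rewrite in_itv /= in xab => h.
  have := h; rewrite in_itv /= => /(_ xab) [] /eqP; rewrite subr_eq0 => /eqP.
  by have := Hx x xab => + e; rewrite e ltxx.
rewrite lebesgue_measure_itv /= lte_fin ab => -[] /eqP; by rewrite gt_eqF.
Qed.

(** Interpolation from the norms of [u] and [u2] alone. The mean value argument finds [x1] in the
    first third and [x2] in the last third of [[0, b]] where [u ^ 2] is at most [3 / b] times its
    integral. Up to an error [b T], with [T] the [L^1] norm of [u2] on [[0, b]], the values there
    are [u 0 + x * u1 0]; since [x2 - x1 >= b / 3], these two relations can be solved for [u 0] and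
    [u1 0]. *)
Lemma trace_bound (b : R) : 0 < b -> exists2 K, 0 <= K &
  forall l (u u1 u2 : R -> R), edge l b -> prim l u u1 -> prim l u1 u2 ->
  sqint (edge l) u -> sqint (edge l) u2 ->
  u 0 ^+ 2 + u1 0 ^+ 2 <= K * (\int[leb]_(t in edge l) u t ^+ 2 +
                              \int[leb]_(t in edge l) u2 t ^+ 2).
Proof.
move=> b0.
(* With [m = |u x1| + |u x2| + T], the factor [k1] bounds [|u1 0|] by [m], [k2] bounds [|u 0|] by
   [m], and [3 * k3] bounds [m ^ 2] by the sum of the two integrals. *)
pose k1 := 3 / b + 6; pose k2 := 1 + b + b * k1; pose k3 := 6 / b + b.
have k10 : 0 <= k1 by rewrite /k1 addr_ge0// divr_ge0// ltW.
have k20 : 0 <= k2 by rewrite /k2 !addr_ge0// ?mulr_ge0// ltW.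
have k30 : 0 <= k3 by rewrite /k3 addr_ge0// ?divr_ge0// ltW.
exists ((k1 ^+ 2 + k2 ^+ 2) * (3 * k3)).
  by rewrite mulr_ge0// ?addr_ge0 ?sqr_ge0// mulr_ge0.
move=> l u u1 u2 lb pu pu1 su su2.
have mE := measurable_edge l.
have sub : `[0, b] `<=` edge l by exact: edge_sub.
have su' : sqint `[0, b] u by exact: sqint_sub su.
have su2' : sqint `[0, b] u2 by exact: sqint_sub su2.
set A := \int[leb]_(t in edge l) u t ^+ 2; set S := \int[leb]_(t in edge l) u2 t ^+ 2.
have A0 : 0 <= A by apply: Rintegral_ge0 => t _; exact: sqr_ge0.
have S0 : 0 <= S by apply: Rintegral_ge0 => t _; exact: sqr_ge0.
have iu : integ (edge l) (fun t => u t ^+ 2) by case: su.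
have iu2 : integ (edge l) (fun t => u2 t ^+ 2) by case: su2.
set T := \int[leb]_(t in `[0, b]) `|u2 t|.
have T0 : 0 <= T by apply: Rintegral_ge0.
have TS : T ^+ 2 <= b * S.
  have s1 : sqint `[0, b] (fun=> 1 : R).
    by apply: (@sqint_bounded _ _ 1) => // y _; rewrite normr1.
  have := Rint_CS (measurable_itv _) s1 su2'.
  under [X in X ^+ 2 <= _]Rint_ext => t _ do rewrite normr1 mul1r.
  move=> /le_trans; apply.
  under [X in X * _ <= _]Rint_ext do rewrite expr1n.
  rewrite Rint_cst ?(ltW b0)// mul1r subr0.
  by rewrite ler_wpM2l ?(ltW b0)//; apply: Rint_subset => // t _; exact: sqr_ge0.
have d1 x : 0 <= x <= b -> `|u1 x - u1 0| <= T.
  move=> /andP[x0 xb]; have lx : edge l x by exact: edge_le lb _ _.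
  rewrite (prim_diff pu1 lx (lexx 0) x0).
  have ix : integ `[0, x] u2 by case: pu1 => h _; exact: h.
  apply: le_trans (le_normr_Rintegral _ ix) _ => //.
  apply: Rint_subset => //; last by apply/integ_norm; exact: sqint_integ.
  by move=> t /=; rewrite !in_itv /= => /andP[-> /le_trans]; apply.
have d2 x : 0 <= x <= b -> `|u x - u 0 - x * u1 0| <= b * T.
  move=> /andP[x0 xb]; have lx : edge l x by exact: edge_le lb _ _.
  have i1 : integ `[0, x] u1 by case: pu => h _; exact: h.
  have ic : integ `[0, x] (fun=> u1 0) by apply: (@integ_bounded _ _ _ `|u1 0|).
  rewrite (prim_diff pu lx (lexx 0) x0).
  have -> : x * u1 0 = \int[leb]_(t in `[0, x]) u1 0 by rewrite Rint_cst// subr0 mulrC.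
  rewrite -RintegralB//; apply: le_trans (le_normr_Rintegral _ _) _ => //; first exact: integB.
  apply: (@le_trans _ _ (\int[leb]_(t in `[0, x]) T)).
    apply: Rint_le => //.
    - by apply/integ_norm/integB.
    - by apply: (@integ_bounded _ _ _ T) => // y _; rewrite ger0_norm.
    - move=> t /=; rewrite in_itv /= => /andP[t0 tx]; apply: d1.
      by rewrite t0 (le_trans tx).
  by rewrite Rint_cst// subr0 mulrC ler_wpM2r.
have mean x1 x2 : 0 <= x1 -> x1 + b / 3 = x2 -> x2 <= b ->
    exists2 x, x1 <= x <= x2 & u x ^+ 2 * b <= 3 * A.
  move=> x10 x12 x2b.
  have s12 : `[x1, x2] `<=` edge l.
    move=> t /=; rewrite in_itv /= => /andP[h1 h2]; apply: edge_le lb _ _.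
      exact: le_trans h1.
    exact: le_trans h2 _.
  have lt12 : x1 < x2 by rewrite -x12 ltrDl divr_gt0.
  have [|x xx h] := @Rint_mean x1 x2 (fun t => u t ^+ 2) lt12; first by apply: integS iu.
  exists x => //; have : \int[leb]_(t in `[x1, x2]) u t ^+ 2 <= A.
    by apply: Rint_subset => // t _; exact: sqr_ge0.
  move: h; rewrite -x12 (_ : x1 + b / 3 - x1 = b / 3); last by ring.
  move: (\int[leb]_(t in _) _) (u x ^+ 2) => I U; lra.
have [|||x1 x1b h1] := mean 0 (b / 3); [exact: lexx|by rewrite add0r|lra|].
have [|||x2 x2b h2] := mean (2 * b / 3) b; [lra|by field|exact: lexx|].
have e1 : `|u x1 - u 0 - x1 * u1 0| <= b * T by apply: d2; lra.
have e2 : `|u x2 - u 0 - x2 * u1 0| <= b * T by apply: d2; lra.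
pose m := `|u x1| + `|u x2| + T.
have m0 : 0 <= m by rewrite !addr_ge0.
have x21 : b / 3 <= x2 - x1 by lra.
have bb : `|u1 0| <= k1 * m.
  have : (x2 - x1) * `|u1 0| <= `|u x1| + `|u x2| + 2 * b * T.
    have x210 : 0 <= x2 - x1 by lra.
    rewrite -[x2 - x1 in leLHS]ger0_norm// -normrM.
    have -> : (x2 - x1) * u1 0 = (u x2 - u x1) - (u x2 - u 0 - x2 * u1 0) +
       (u x1 - u 0 - x1 * u1 0) by ring.
    apply: le_trans (ler_normD _ _) _; apply: le_trans (lerD (ler_normB _ _) (lexx _)) _.
    have := ler_normB (u x2) (u x1); move: e1 e2; lra.
  have h3 : b / 3 * `|u1 0| <= (x2 - x1) * `|u1 0| by rewrite ler_wpM2r.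
  move=> /(le_trans h3) h4.
  have -> : k1 * m = 3 / b * (m + 2 * b * m) by rewrite /k1; field; rewrite gt_eqF.
  rewrite -ler_pdivrMl ?divr_gt0// invf_div.
  have : b * T <= b * m by rewrite ler_wpM2l ?(ltW b0)// /m lerDr addr_ge0.
  move: h4; rewrite /m; move: (normr_ge0 (u x1)) (normr_ge0 (u x2)) T0; lra.
have b1 : `|u 0| <= k2 * m.
  have x1b' : x1 * `|u1 0| <= b * (k1 * m).
    by apply: ler_pM => //; lra.
  have : `|u 0| <= `|u x1| + b * T + x1 * `|u1 0|.
    have -> : u 0 = u x1 - (u x1 - u 0 - x1 * u1 0) - x1 * u1 0 by ring.
    apply: le_trans (ler_normB _ _) _; rewrite normrM (ger0_norm (_ : 0 <= x1)); last lra.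
    rewrite lerD2r; apply: le_trans (ler_normB _ _) _; lra.
  have : b * T <= b * m by rewrite ler_wpM2l ?(ltW b0)// /m lerDr addr_ge0.
  have : `|u x1| <= m by rewrite /m -addrA lerDl addr_ge0.
  move: x1b'; rewrite /k2; lra.
have mm : m ^+ 2 <= 3 * k3 * (A + S).
  have q1 : u x1 ^+ 2 <= 3 / b * A by rewrite mulrAC ler_pdivlMr.
  have q2 : u x2 ^+ 2 <= 3 / b * A by rewrite mulrAC ler_pdivlMr.
  have : m ^+ 2 <= 3 * (u x1 ^+ 2 + u x2 ^+ 2 + T ^+ 2).
    rewrite -[u x1 ^+ 2]real_normK ?num_real// -[u x2 ^+ 2]real_normK ?num_real// /m.
    have := sqr_ge0 (`|u x1| - `|u x2|); have := sqr_ge0 (`|u x1| - T).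
    have := sqr_ge0 (`|u x2| - T); nra.
  have r1 : 0 <= 6 / b * S by rewrite mulr_ge0// divr_ge0// ltW.
  have r2 : 0 <= b * A by rewrite mulr_ge0// ltW.
  have r3 : 6 / b * A = 3 / b * A + 3 / b * A by ring.
  rewrite /k3; move: q1 q2 TS; nra.
have s1 : u1 0 ^+ 2 <= (k1 * m) ^+ 2.
  by rewrite -[leLHS]real_normK ?num_real// lerXn2r ?nnegrE// mulr_ge0.
have s2 : u 0 ^+ 2 <= (k2 * m) ^+ 2.
  by rewrite -[leLHS]real_normK ?num_real// lerXn2r ?nnegrE// mulr_ge0.
have : (k1 ^+ 2 + k2 ^+ 2) * m ^+ 2 <= (k1 ^+ 2 + k2 ^+ 2) * (3 * k3 * (A + S)).
  by rewrite ler_wpM2l// addr_ge0 ?sqr_ge0.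
rewrite [X in _ -> _ <= X](_ : _ = (k1 ^+ 2 + k2 ^+ 2) * (3 * k3 * (A + S))); last by ring.
move: s1 s2; rewrite !exprMn; lra.
Qed.

Lemma ctrace_bound (b : R) : 0 < b -> exists2 K, 0 <= K &
  forall l (u u1 u2 : R -> C), edge l b -> cprim l u u1 -> cprim l u1 u2 ->
  csq (edge l) u -> csq (edge l) u2 ->
  sqmod (u 0) + sqmod (u1 0) <= K * (\int[leb]_(t in edge l) sqmod (u t) +
                              \int[leb]_(t in edge l) sqmod (u2 t)).
Proof.
move=> b0; have [K K0 HK] := trace_bound b0; exists K => // l u u1 u2 lb [p1 p2] [p3 p4].
move=> [s1 s2] [s3 s4].
have := HK l _ _ _ lb p1 p3 s1 s3; have := HK l _ _ _ lb p2 p4 s2 s4.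
case: s1 s2 s3 s4 => _ s1 [_ s2] [_ s3] [_ s4] /=.
rewrite /sqmod !(@RintegralD _ _ _ leb (edge l))//; do 1?[exact: measurable_edge].
rewrite !mulrDr; lra.
Qed.

End Schroedinger.

(** * Square-integrable solutions on a half-line *)

Section HalfLine.
Variable R : realType.
Local Notation leb := (@lebesgue_measure R).
Local Notation integ D f := (leb.-integrable D (EFin \o f)).
Local Notation C := R[i].
Local Notation cRe := (@complex.Re R).
Local Notation cIm := (@complex.Im R).

Definition zext (D : set R) (f : R -> C) (x : R) : C := if x \in D then f x else 0.

Lemma zextE D f x : D x -> zext D f x = f x.
Proof. by move=> Dx; rewrite /zext mem_set. Qed.

Lemma cmeas_zext (D : set R) (f : R -> C) D' : measurable D -> measurable D' -> cmeas D f ->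
  cmeas D' (zext D f).
Proof.
move=> mD mD' [h1 h2].
have e1 : cRe \o zext D f = (cRe \o f) \_ D.
  by apply/funext => x; rewrite /= /zext patchE; case: ifP.
have e2 : cIm \o zext D f = (cIm \o f) \_ D.
  by apply/funext => x; rewrite /= /zext patchE; case: ifP.
rewrite /cmeas e1 e2.
by split; apply: (measurable_funS measurableT) => //;
  [have [h _] := measurable_restrictT (cRe \o f) mD|
   have [h _] := measurable_restrictT (cIm \o f) mD]; exact: h.
Qed.

Lemma csq_zext (D : set R) (f : R -> C) D' : measurable D -> measurable D' -> csq D f ->
  csq D' (zext D f).
Proof.
move=> mD mD' sf; apply: csqE => //; first by apply: cmeas_zext => //; exact: csq_meas.
apply: (@integS _ _ setT) => //.
apply: integ_ext (integ_restrict mD (csq_sqmod mD sf)) => // x _.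
by rewrite patchE /zext; case: ifP => //; rewrite sqmod0.
Qed.

Lemma halfline_EU (x : R) : 0 <= x -> edge None = `[0, x] `|` `]x, +oo[ :> set R.
Proof.
move=> x0; apply/seteqP; split => t /=; rewrite !in_itv /= ?andbT.
  by move=> t0; case: (leP t x) => tx; [left; rewrite t0|right].
by move=> [/andP[]//|tx]; exact: le_trans x0 (ltW tx).
Qed.

Lemma Rint_split (x : R) (f : R -> R) : 0 <= x -> integ (edge None) f ->
  \int[leb]_(t in edge None) f t =
  \int[leb]_(t in `[0, x]) f t + \int[leb]_(t in `]x, +oo[) f t.
Proof.
move=> x0.
have dis : [disjoint `[0, x]%classic & `]x, +oo[%classic].
  rewrite disj_set2E; apply/eqP; rewrite -subset0 => t /= []; rewrite !in_itv /= andbT.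
  by move=> /andP[_ tx] /(le_lt_trans tx); rewrite ltxx.
by rewrite (halfline_EU x0) => i1; rewrite Rintegral_setU.
Qed.

Lemma cintegral_split (x : R) (f : R -> C) : 0 <= x -> cint (edge None) f ->
  cintegral (edge None) f = cintegral `[0, x] f + cintegral `]x, +oo[ f.
Proof.
move=> x0 [i1 i2].
by apply: cext; rewrite cReE [LHS]/= (Rint_split x0).
Qed.

Lemma prim_sqmod l (g g1 : R -> C) : cprim l g g1 ->
  prim l (fun x => sqmod (g x))
    (fun x => 2 * (cRe (g x) * cRe (g1 x) + cIm (g x) * cIm (g1 x))).
Proof.
move=> [p1 p2]; apply: prim_ext (primD (prim_mul p1 p1) (prim_mul p2 p2)) => x _ /=.
  by rewrite /sqmod !expr2.
by ring.
Qed.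

(** The pointwise inequality bounds [sqmod g] by the derivative of [s * sqmod g] plus an integrable
    term; it is integrated over [[0, x]]. The sign [s] is [1] for an equation with growing
    homogeneous solution, where [g] must be known to be bounded, and [-1] for a decaying one, where
    the last hypothesis is automatic. *)
Lemma energy_sq (g g1 : R -> C) (k : R -> R) (ka s M : R) : 0 < ka ->
  cprim None g g1 -> integ (edge None) k -> (forall x, 0 <= k x) ->
  (forall x, 0 <= x ->
    ka * sqmod (g x) <= s * (2 * (cRe (g x) * cRe (g1 x) + cIm (g x) * cIm (g1 x))) + k x) ->
  (forall x, 0 <= x -> s * (sqmod (g x) - sqmod (g 0)) <= M) ->
  csq (edge None) g.
Proof.
move=> ka0 pg ik k0 le bd.
have pS := prim_sqmod pg.
have mE := measurable_edge (None : option R).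
apply: csqE => //; first exact: cprim_meas pg.
pose KK := \int[leb]_(t in edge None) k t.
have KK0 : 0 <= KK by apply: Rintegral_ge0.
have iS (x : R) : integ `[0, x] (fun t => sqmod (g t)).
  have [x0|x0] := leP 0 x.
    by apply: csq_sqmod => //; exact: cprim_csq pg x0.
  rewrite set_itv_ge; last by rewrite bnd_simp -ltNge.
  exact: integrable_set0.
have H := @integ_exhaust R 0 (ka^-1 * (M + KK)) (fun t => sqmod (g t)).
rewrite edge_None; apply H => //.
  by move=> x _; exact: sqmod_ge0.
move=> x; have [x0|x0] := leP 0 x; last first.
  rewrite set_itv_ge; last by rewrite bnd_simp -ltNge.
  rewrite Rintegral_set0 mulr_ge0 ?invr_ge0 ?(ltW ka0)// addr_ge0//.
  by have := bd 0 (lexx _); rewrite subrr mulr0.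
rewrite ler_pdivlMl// -RintegralZl//.
have sub : `[0, x] `<=` edge (None : option R) := @edge_sub R None x x0.
have ikx : integ `[0, x] k by exact: integS ik.
have i1 := pS.1 x x0.
apply: (@le_trans _ _ (\int[leb]_(t in `[0, x])
   (s * (2 * (cRe (g t) * cRe (g1 t) + cIm (g t) * cIm (g1 t))) + k t))).
  apply: Rint_le => //; first exact: integZ.
    by apply: integD => //; exact: integZ.
  by move=> t /=; rewrite in_itv /= => /andP[t0 _]; exact: le.
rewrite RintegralD//; last exact: integZ.
rewrite RintegralZl//; apply: lerD; last exact: Rint_subset.
by apply: le_trans (bd x x0); rewrite (pS.2 x x0) [_ + _ - _]addrAC subrr add0r.
Qed.

(** The function is [e^(- la x)], written with real exponential, cosine and sine; afterwards only
    its equation and its modulus are used. *)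
Lemma decaying_exp (la : C) : exists E : R -> C,
  cprim None E (fun x => - la * E x) /\
  forall x, sqmod (E x) = expR (- (2 * cRe la) * x).
Proof.
pose ka := cRe la; pose p := cIm la.
pose e x : R := expR (- ka * x).
pose E (x : R) : C := (e x * cos (p * x)) +i* (- (e x * sin (p * x))).
have de (x : R) : is_derive x 1 e (- ka * e x).
  rewrite /e; apply: is_derive_eq; rewrite /GRing.scale /=; ring.
have dc (x : R) : is_derive x 1 (fun x => cos (p * x)) (- (p * sin (p * x))).
  apply: is_derive_eq; rewrite /GRing.scale /=; ring.
have ds (x : R) : is_derive x 1 (fun x => sin (p * x)) (p * cos (p * x)).
  apply: is_derive_eq; rewrite /GRing.scale /=; ring.
have cd (f f1 : R -> R) : (forall x : R, is_derive x 1 f (f1 x)) -> continuous f.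
  move=> df x; apply: differentiable_continuous; apply/derivable1_diffP; by case: (df x).
have ce := cd _ _ de; have cc := cd _ _ dc; have cs := cd _ _ ds.
have cst (a : R) (f : R -> R) : continuous f -> continuous (fun x => a * f x).
  by move=> cf x; apply: continuousM; [exact: cvg_cst|exact: cf].
have pe : prim None e (fun x => - ka * e x) by apply: prim_C1 => //; exact: cst.
have pc : prim None (fun x => cos (p * x)) (fun x => - p * sin (p * x)).
  by apply: prim_C1 => [x|]; [rewrite mulNr; exact: dc|exact: cst].
have ps : prim None (fun x => sin (p * x)) (fun x => p * cos (p * x)).
  by apply: prim_C1 => //; exact: cst.
exists E; split.
  split.
    apply: prim_ext (prim_mul pe pc) => x _ //=.
    by rewrite !cReE /= -/ka -/p; ring.
  apply: prim_ext (primN (prim_mul pe ps)) => x _ //=.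
  by rewrite !cReE /= -/ka -/p; ring.
move=> x; rewrite /sqmod /=.
have -> : (e x * cos (p * x)) ^+ 2 + (- (e x * sin (p * x))) ^+ 2 =
   e x ^+ 2 * (cos (p * x) ^+ 2 + sin (p * x) ^+ 2) by ring.
rewrite cos2Dsin2 mulr1 /e -/ka -expRM_natl; congr expR; ring.
Qed.

(** The derivative of [E * g] is [E * h], so the compatibility condition says that [E * g] tends to
    zero, that is [E x * g x] is minus the integral of [E * h] beyond [x]. Cauchy-Schwarz then
    bounds [g], and the energy inequality with [s = 1] makes it square-integrable. *)
Lemma halfline_sq (la : C) (E g h : R -> C) : 0 < cRe la ->
  cprim None E (fun x => - la * E x) ->
  (forall x, sqmod (E x) = expR (- (2 * cRe la) * x)) ->
  cprim None g (fun x => la * g x + h x) -> csq (edge None) h ->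
  E 0 * g 0 + cintegral (edge None) (fun t => E t * h t) = 0 ->
  csq (edge None) E /\ csq (edge None) g.
Proof.
set ka := cRe la => ka0 pE sE pg sh c0.
have mE := measurable_edge (None : option R).
(* The integral of [sqmod E] beyond [x] is [sqmod (E x) / (2 ka)]; the decay of [E] therefore
   compensates the division by [E x] below. *)
have tail (x y : R) : 0 <= x -> integ `[x, y] (fun t => sqmod (E t)) /\
    \int[leb]_(t in `[x, y]) sqmod (E t) <= (2 * ka)^-1 * sqmod (E x).
  move=> x0.
  have [xy|xy] := leP x y; last first.
    rewrite set_itv_ge; last by rewrite bnd_simp -ltNge.
    split; first exact: integrable_set0.
    by rewrite Rintegral_set0 mulr_ge0 ?sqmod_ge0// invr_ge0 mulr_ge0// ltW.
  have y0 := le_trans x0 xy.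
  have iE : integ `[0, y] (fun t => sqmod (E t)).
    by apply: csq_sqmod => //; exact: cprim_csq pE y0.
  have iE' : integ `[x, y] (fun t => sqmod (E t)).
    apply: integS iE => // t /=; rewrite !in_itv /= => /andP[xt ->].
    by rewrite (le_trans x0).
  split => //.
  have := prim_diff (prim_exp (- (2 * ka))) (y0 : edge None y) x0 xy.
  under [X in _ = X -> _]Rint_ext => t _ do rewrite -sE.
  rewrite RintegralZl// -!sE => e1.
  have := sqmod_ge0 (E y); rewrite ler_pdivlMl ?mulr_gt0// => e2.
  rewrite -[X in _ <= X](subrK (sqmod (E y))) -[X in X + _]opprB e1; lra.
have sqE : csq (edge None) E.
  apply: csqE => //; first exact: cprim_meas pE.
  rewrite edge_None; have [|||] := @integ_exhaust R 0 ((2 * ka)^-1 * sqmod (E 0)) (fun t => sqmod (E t)) => //.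
  - by move=> x _; exact: sqmod_ge0.
  - by move=> x; case: (tail 0 x (lexx _)).
  - by move=> x; case: (tail 0 x (lexx _)).
split => //.
pose N := \int[leb]_(t in edge None) sqmod (h t).
have N0 : 0 <= N by apply: Rintegral_ge0 => t _; exact: sqmod_ge0.
have iEh : cint (edge None) (fun t => E t * h t) by exact: csq_mul.
have pEg : cprim None (fun x => E x * g x) (fun x => E x * h x).
  by apply: cprim_ext (cprim_mul pE pg) => x _ //; ring.
have Egx x : 0 <= x -> E x * g x = - cintegral `]x, +oo[ (fun t => E t * h t).
  move=> x0; have := cprim_primitive pEg (x0 : edge None x) => ->.
  apply/eqP; rewrite -addr_eq0 -addrA; apply/eqP; rewrite -[RHS]c0; congr +%R.
  by rewrite -cintegral_split.
(* Passing from [n1] to [sqmod] costs a factor [2] for [E] and another for [h]; with [(2 ka)^-1]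
   from [tail] this gives [2 N / ka]. *)
have gb x : 0 <= x -> sqmod (g x) <= 2 * N / ka.
  move=> x0; pose D : set R := `]x, +oo[%classic.
  have mD : measurable D by exact: measurable_itv.
  have subD : D `<=` edge None.
    by move=> t; rewrite /D /= in_itv /= andbT => /ltW; exact: le_trans.
  have [t1 t2] : integ `[x, +oo[ (fun t => sqmod (E t)) /\
      \int[leb]_(t in `[x, +oo[) sqmod (E t) <= (2 * ka)^-1 * sqmod (E x).
    apply: integ_exhaust => [y _|y|y]; [exact: sqmod_ge0|by case: (tail x y x0)..].
  have t3 : \int[leb]_(t in D) sqmod (E t) <= (2 * ka)^-1 * sqmod (E x).
    apply: le_trans t2; apply: Rint_subset => //.
      by move=> t; rewrite /D /= !in_itv /= !andbT => /ltW.
    by move=> t _; exact: sqmod_ge0.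
  have t4 : \int[leb]_(t in D) sqmod (h t) <= N.
    apply: Rint_subset => //; first exact: csq_sqmod.
    by move=> t _; exact: sqmod_ge0.
  have sn (f : R -> C) : csq (edge None) f -> sqint D (fun t => n1 (f t)) /\
      \int[leb]_(t in D) n1 (f t) ^+ 2 <= 2 * \int[leb]_(t in D) sqmod (f t).
    move=> sf; have sfD : csq D f by exact: csq_sub sf.
    have i2 : integ D (fun t => 2 * sqmod (f t)) by apply: integZ => //; exact: csq_sqmod.
    have s1 : integ D (fun t => n1 (f t) ^+ 2).
      apply: integ_le i2 => //; first by apply: measurable_funX; exact: cmeas_n1 (csq_meas sfD).
      by move=> t _; rewrite ger0_norm ?sqr_ge0// n1_le_sqmod.
    split; first by split => //; exact: cmeas_n1 (csq_meas sfD).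
    rewrite -RintegralZl//; last exact: csq_sqmod.
    by apply: Rint_le => // t _; exact: n1_le_sqmod.
  have [sE1 sE2] := sn _ sqE; have [sh1 sh2] := sn _ sh.
  have CS := Rint_CS mD sE1 sh1.
  have iD : cint D (fun t => E t * h t) by exact: cint_sub iEh.
  have le1 : n1 (E x * g x) <= \int[leb]_(t in D) (`|n1 (E t)| * `|n1 (h t)|).
    rewrite Egx// n1N; apply: le_trans (n1_cintegral mD iD) _.
    apply: Rint_le => //; first exact: cint_n1.
      by have := integ_norm (sqint_mul mD sE1 sh1); apply: integ_ext => // t _; rewrite normrM.
    by move=> t _; rewrite !ger0_norm ?n1_ge0// n1M.
  have Ex0 : 0 < sqmod (E x) by rewrite sE expR_gt0.
  rewrite -(ler_pM2l Ex0) -sqmodM; apply: le_trans (sqmod_le_n1 _) _.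
  apply: (@le_trans _ _ ((\int[leb]_(t in D) (`|n1 (E t)| * `|n1 (h t)|)) ^+ 2)).
    by rewrite lerXn2r ?nnegrE ?n1_ge0// (le_trans (n1_ge0 _) le1).
  apply: le_trans CS _.
  apply: (@le_trans _ _ ((2 * ((2 * ka)^-1 * sqmod (E x))) * (2 * N))).
    apply: ler_pM.
    - by apply: Rintegral_ge0 => t _; exact: sqr_ge0.
    - by apply: Rintegral_ge0 => t _; exact: sqr_ge0.
    - by apply: le_trans sE2 _; rewrite ler_wpM2l.
    - by apply: le_trans sh2 _; rewrite ler_wpM2l.
  by rewrite le_eqVlt; apply/orP; left; apply/eqP; field; rewrite gt_eqF.
apply: (@energy_sq g _ (fun t => ka^-1 * sqmod (h t)) ka 1 (2 * N / ka) ka0 pg).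
- by apply: integZ => //; exact: csq_sqmod.
- by move=> x; rewrite mulr_ge0 ?sqmod_ge0// invr_ge0 ltW.
- move=> x _; rewrite !cReE -/ka mul1r /sqmod.
  move: (cRe (g x)) (cIm (g x)) (cRe (h x)) (cIm (h x)) (cIm la) => a b c d p.
  rewrite -subr_ge0.
  have -> : 2 * (a * (ka * a - p * b + c) + b * (ka * b + p * a + d)) +
    ka^-1 * (c ^+ 2 + d ^+ 2) - ka * (a ^+ 2 + b ^+ 2) =
    ka^-1 * ((ka * a + c) ^+ 2 + (ka * b + d) ^+ 2) by field; rewrite gt_eqF.
  by rewrite mulr_ge0 ?invr_ge0 ?(ltW ka0)// addr_ge0// sqr_ge0.
- by move=> x x0; rewrite mul1r; have := gb x x0; have := sqmod_ge0 (g 0); lra.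
Qed.

(** The homogeneous solution decays, so the energy inequality is used with [s = -1] and the bound at
    infinity is just [sqmod (u 0)]. *)
Lemma stable_sq (la : C) (u g : R -> C) : 0 < cRe la ->
  cprim None u (fun x => - la * u x + g x) -> csq (edge None) g ->
  csq (edge None) u.
Proof.
set ka := cRe la => ka0 pu sg.
have mE := measurable_edge (None : option R).
apply: (@energy_sq u _ (fun t => ka^-1 * sqmod (g t)) ka (-1) (sqmod (u 0)) ka0 pu).
- by apply: integZ => //; exact: csq_sqmod.
- by move=> x; rewrite mulr_ge0 ?sqmod_ge0// invr_ge0 ltW.
- move=> x _; rewrite !cReE -/ka mulN1r /sqmod.
  move: (cRe (u x)) (cIm (u x)) (cRe (g x)) (cIm (g x)) (cIm la) => a b c d p.
  rewrite -subr_ge0.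
  have -> : - (2 * (a * (- ka * a - - p * b + c) + b * (- ka * b + - p * a + d))) +
    ka^-1 * (c ^+ 2 + d ^+ 2) - ka * (a ^+ 2 + b ^+ 2) =
    ka^-1 * ((ka * a - c) ^+ 2 + (ka * b - d) ^+ 2) by field; rewrite gt_eqF.
  by rewrite mulr_ge0 ?invr_ge0 ?(ltW ka0)// addr_ge0// sqr_ge0.
- by move=> x x0; have := sqmod_ge0 (u x); lra.
Qed.

(** A purely imaginary root of [- z] would make [z] real; of the two opposite roots, one has
    positive real part. *)
Lemma sqrt_right (z : C) : cIm z != 0 -> exists la : C, la ^+ 2 = - z /\ 0 < cRe la.
Proof.
move=> z0; pose s := sqrtC (- z).
have s2 : s ^+ 2 = - z by exact: sqrtCK.
have sr : cRe s != 0.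
  apply: contra z0 => /eqP s0; have := congr1 cIm s2.
  by rewrite expr2 !cReE s0 mul0r mulr0 addr0 => /esym/eqP; rewrite oppr_eq0.
have [s0|s0] := ltP 0 (cRe s); first by exists s.
exists (- s); rewrite sqrrN; split => //; rewrite cReE oppr_gt0 lt_neqAle sr//.
Qed.

Lemma csq_compact (B : R -> R) (u u1 : R -> C) (K r : R) :
  measurable_fun (edge None) B -> (forall x, 0 <= x -> `|B x| <= K) ->
  (forall x, 0 <= x -> r < x -> B x = 0) -> cprim None u u1 ->
  csq (edge None) (fun x => (B x)%:C * u x).
Proof.
move=> mB BK Br pu.
have mE := measurable_edge (None : option R).
have mBc : cmeas (edge None) (fun x => (B x)%:C).
  by split; [exact: mB|exact: measurable_cst].
pose r' := Num.max r 0.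
have r0 : edge None r' by rewrite /= /r' le_max lexx orbT.
apply: csq_ext (@csq_zext `[0, r'] (fun x => (B x)%:C * u x) _ _ mE _) => //.
  move=> x x0; rewrite /zext; case: ifPn => //.
  move=> xr; rewrite Br ?mul0r// ltNge; apply/negP => h.
  by move/negP: xr; apply; apply/mem_set; rewrite /= in_itv /= (x0 : 0 <= x) /= /r' le_max h.
have sub : `[0, r'] `<=` edge (None : option R) by exact: edge_sub.
apply: (@csq_mulb _ _ _ _ K) => //.
- exact: cmeas_sub mBc.
- by move=> x /= xr; rewrite n1_real; apply: BK; move: xr; rewrite in_itv /= => /andP[].
- exact: cprim_csq pu r0.
Qed.

(* [u1 + la u] solves a first-order equation with growing homogeneous solution
   [exp (la x)]; its coefficient at infinity is the expression below. *)
Lemma halfline_H2 (z la : C) (E : R -> C) (B : R -> R) (f u u1 : R -> C) (K r : R) :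
  la ^+ 2 = - z -> 0 < cRe la ->
  cprim None E (fun x => - la * E x) ->
  (forall x, sqmod (E x) = expR (- (2 * cRe la) * x)) ->
  measurable_fun (edge None) B -> (forall x, 0 <= x -> `|B x| <= K) ->
  (forall x, 0 <= x -> r < x -> B x = 0) ->
  csq (edge None) f -> cprim None u u1 ->
  cprim None u1 (fun x => ((B x)%:C - z) * u x - f x) ->
  E 0 * (u1 0 + la * u 0) +
    cintegral (edge None) (fun t => E t * ((B t)%:C * u t - f t)) = 0 ->
  csq (edge None) u /\ csq (edge None) u1.
Proof.
move=> la2 la0 pE sE mB BK Br sf pu pu1 c0.
have mE := measurable_edge (None : option R).
have sBu : csq (edge None) (fun x => (B x)%:C * u x) by exact: csq_compact mB BK Br pu.
have sh : csq (edge None) (fun x => (B x)%:C * u x - f x) by exact: csqB.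
(* Since [la ^ 2 = - z], the second-order operator factors into two first-order ones: [g] solves the
   unstable equation, and [u] is recovered from [g] by the stable one. *)
pose g x := u1 x + la * u x.
have pg : cprim None g (fun x => la * g x + ((B x)%:C * u x - f x)).
  apply: cprim_ext (cprimD pu1 (cprimZ la pu)) => x _ //.
  rewrite /g mulrDr mulrA -expr2 la2; ring.
have [sqE sg] := halfline_sq la0 pE sE pg sh c0.
have su : csq (edge None) u.
  apply: (stable_sq la0 _ sg); apply: cprim_ext pu => x _ //.
  by rewrite /g; ring.
split => //; apply: csq_ext (csqB mE sg (csqZ la mE su)) => // x _.
by rewrite /g; ring.
Qed.

End HalfLine.

(** * Energy identity and resolvents on a graph *)

Section EdgeGreen.
Variable R : realType.
Local Notation leb := (@lebesgue_measure R).
Local Notation integ D f := (leb.-integrable D (EFin \o f)).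
Local Notation C := R[i].
Local Notation cRe := (@complex.Re R).
Local Notation cIm := (@complex.Im R).
Implicit Types (l : option R).

Lemma ae_imp (P Q : R -> Prop) : (forall x, P x -> Q x) ->
  {ae leb, forall x, P x} -> {ae leb, forall x, Q x}.
Proof. by move=> PQ [N [mN N0 h]]; exists N; split => // x nQ; apply: h => /= /PQ. Qed.

Lemma Rint_norm (D : set R) (f : R -> R) : measurable D -> integ D f ->
  `|\int[leb]_(t in D) f t| <= \int[leb]_(t in D) `|f t|.
Proof. by move=> mD fi; apply: le_normr_Rintegral. Qed.

Lemma integ_ae (D : set R) (f g : R -> R) : measurable D -> integ D f ->
  measurable_fun D g -> {ae leb, forall x, D x -> f x = g x} ->
  integ D g /\ \int[leb]_(x in D) f x = \int[leb]_(x in D) g x.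
Proof.
move=> mD fi mg fg.
have mf := integ_meas fi.
have fgE : ae_eq leb D (EFin \o f) (EFin \o g).
  by apply: ae_imp fg => x h /h /= ->.
split; last first.
  congr fine; apply: ae_eq_integral => //; exact/measurable_EFinP.
move: fi => /integrableP[_ fi]; apply/integrableP; split; first exact/measurable_EFinP.
rewrite (_ : (\int[leb]_(x in D) `|(EFin \o g) x|)%E = (\int[leb]_(x in D) `|(EFin \o f) x|)%E)//.
apply: ae_eq_integral => //.
- by apply/measurable_EFinP/measurableT_comp.
- by apply/measurable_EFinP/measurableT_comp.
- by apply: ae_imp fg => x h /h /= ->.
Qed.

Lemma Rint_ae (D : set R) (f g : R -> R) : measurable D -> measurable_fun D f ->
  measurable_fun D g -> {ae leb, forall x, D x -> f x = g x} ->
  \int[leb]_(x in D) f x = \int[leb]_(x in D) g x.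
Proof.
move=> mD mf mg fg; congr fine; apply: ae_eq_integral => //; do 1?exact/measurable_EFinP.
by apply: ae_imp fg => x h /h /= ->.
Qed.

(** The definition of the operators fixes the second derivative only almost everywhere, which
    primitives do not see; this allows it to be replaced by the expression given by the equation. *)
Lemma cprim_ae l (f g h : R -> C) : cprim l f g -> cmeas (edge l) h ->
  eq_ae (edge l) g h -> cprim l f h.
Proof.
move=> [[i1 p1] [i2 p2]] [m1 m2] gh.
have sub (F G : R -> R) x : {ae leb, forall x, edge l x -> F x = G x} -> edge l x ->
    {ae leb, forall y, `[0, x]%classic y -> F y = G y}.
  by move=> FG lx; apply: ae_imp FG => y h0 xy; apply: h0; exact: edge_sub lx _ xy.
have re : {ae leb, forall x, edge l x -> (cRe \o g) x = (cRe \o h) x}.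
  by apply: ae_imp gh => x h0 /h0 /= ->.
have im : {ae leb, forall x, edge l x -> (cIm \o g) x = (cIm \o h) x}.
  by apply: ae_imp gh => x h0 /h0 /= ->.
have mI := measurable_edge l.
split; split => x lx.
- have ms : measurable_fun `[0, x] (cRe \o h) by apply: measurable_funS m1 => //; exact: edge_sub.
  by have [] := integ_ae (measurable_itv _) (i1 x lx) ms (sub _ _ x re lx).
- have ms : measurable_fun `[0, x] (cRe \o h) by apply: measurable_funS m1 => //; exact: edge_sub.
  by have [_ <-] := integ_ae (measurable_itv _) (i1 x lx) ms (sub _ _ x re lx); exact: p1.
- have ms : measurable_fun `[0, x] (cIm \o h) by apply: measurable_funS m2 => //; exact: edge_sub.
  by have [] := integ_ae (measurable_itv _) (i2 x lx) ms (sub _ _ x im lx).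
- have ms : measurable_fun `[0, x] (cIm \o h) by apply: measurable_funS m2 => //; exact: edge_sub.
  by have [_ <-] := integ_ae (measurable_itv _) (i2 x lx) ms (sub _ _ x im lx); exact: p2.
Qed.

(* An integrable function with integrable derivative vanishes at infinity. *)
Lemma prim_infty (W w : R -> R) : prim None W w -> integ (edge None) w ->
  integ (edge None) W -> \int[leb]_(t in edge None) w t = - W 0.
Proof.
move=> [_ pW] iw iW.
have mE := measurable_edge (None : option R).
set J := \int[leb]_(t in _) _.
apply/eqP; rewrite -addr_eq0; apply/negP => /negP L0.
set L := J + W 0 in L0.
pose e := `|L| / 2.
have e0 : 0 < e by rewrite divr_gt0 ?normr_gt0.
pose A := \int[leb]_(t in edge None) `|w t|.
have iaw := integ_norm iw.
have subE (x : R) : 0 <= x -> `[0, x] `<=` edge (None : option R) by exact: (@edge_sub R None).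
(* Beyond [X] the remaining integral of [|w|] is below [e = |L| / 2], where [L] is the limit of [W];
   hence [|W| >= e] from there on. *)
have [X X0 XA] : exists2 X : R, 0 <= X & A - e < \int[leb]_(t in `[0, X]) `|w t|.
  apply: contrapT => H.
  have H1 x : \int[leb]_(t in `[0, x]) `|w t| <= A - e.
    have H0 y : 0 <= y -> \int[leb]_(t in `[0, y]) `|w t| <= A - e.
      by move=> y0; rewrite leNgt; apply/negP => h; apply: H; exists y.
    have [/H0//|x0] := leP 0 x.
    rewrite set_itv_ge; last by rewrite bnd_simp -ltNge.
    by rewrite Rintegral_set0 -(Rint_itv0 (fun t => `|w t|)); exact: H0.
  have [|||] := @integ_exhaust R 0 (A - e) (fun t => `|w t|) => //.
    move=> x; have [x0|x0] := leP 0 x; first by apply: integS iaw => //; exact: subE.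
    rewrite set_itv_ge; last by rewrite bnd_simp -ltNge.
    exact: integrable_set0.
  by move=> _; rewrite -edge_None -/A => h; lra.
have near x : X <= x -> e <= `|W x|.
  move=> Xx; have x0 := le_trans X0 Xx.
  have mo : measurable (`]x, +oo[%classic : set R) by exact: measurable_itv.
  have subo : `]x, +oo[ `<=` edge (None : option R).
    by move=> t /=; rewrite in_itv /= andbT => /ltW; exact: le_trans.
  have iwo : integ `]x, +oo[ w by exact: integS iw.
  have E1 := Rint_split x0 iw; have E2 := Rint_split x0 iaw.
  have h1 : \int[leb]_(t in `[0, X]) `|w t| <= \int[leb]_(t in `[0, x]) `|w t|.
    apply: Rint_subset => //; last by apply: integS iaw => //; exact: subE.
    by move=> t /=; rewrite !in_itv /= => /andP[-> /le_trans]; apply.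
  have h2 := Rint_norm mo iwo.
  have h3 : `|L - W x| <= e.
    rewrite (pW x x0) /L /J E1 (_ : _ + _ + _ - _ = \int[leb]_(t in `]x, +oo[) w t); last first.
      by move: (Rintegral _ _ _) (Rintegral _ _ _) (W 0) => *; ring.
    apply: le_trans h2 _; move: E2 h1 XA; rewrite -/A; move: (Rintegral _ _ _) => I1.
    by move: (Rintegral _ _ _) => I2; move: (Rintegral _ _ _) => I3; lra.
  have := lerB_dist L (W x); rewrite /e in h3 *; lra.
pose K := \int[leb]_(t in edge None) `|W t|.
have K0 : 0 <= K by apply: Rintegral_ge0.
(* On [[X, Y]] the integral of [|W|] would be at least [K + 1], more than its total [K]. *)
pose Y := X + (K + 1) / e.
have XY : X <= Y by rewrite /Y lerDl divr_ge0// ?addr_ge0// ltW.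
have subXY : `[X, Y] `<=` edge (None : option R).
  by move=> t /=; rewrite in_itv /= => /andP[Xt _]; exact: le_trans Xt.
have iaW := integ_norm iW.
have h1 : \int[leb]_(t in `[X, Y]) e <= \int[leb]_(t in `[X, Y]) `|W t|.
  apply: Rint_le => //.
  - apply: measurable_bounded_integrable => //=; last exact: bounded_cst.
    by rewrite lebesgue_measure_itv /=; case: ifPn => //; rewrite ltry.
  - exact: integS iaW.
  - by move=> t /=; rewrite in_itv /= => /andP[Xt _]; exact: near.
have h2 : \int[leb]_(t in `[X, Y]) `|W t| <= K by exact: Rint_subset.
have eY : e * (Y - X) = K + 1 by rewrite /Y; field; rewrite gt_eqF.
move: h1; rewrite Rint_cst// eY => h1; lra.
Qed.

Definition wronsk (u u1 : R -> C) (x : R) : R := cIm ((u x)^* * u1 x).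

Definition end_term l (F : R -> R) : R := if l is Some a then F a else 0.

(** The derivative of [wronsk] is the integrand, because the other term [conj u1 * u1] is real. On a
    half-line the boundary term at infinity vanishes by [prim_infty], in agreement with
    [end_term]. *)
Lemma edge_green l (u u1 u2 : R -> C) : (forall a, l = Some a -> 0 < a) ->
  cprim l u u1 -> cprim l u1 u2 -> csq (edge l) u -> csq (edge l) u1 ->
  csq (edge l) u2 ->
  \int[leb]_(t in edge l) cIm ((u t)^* * u2 t) = end_term l (wronsk u u1) - wronsk u u1 0.
Proof.
move=> l0 pu pu1 su su1 su2.
have mE := measurable_edge l.
have pW : prim l (wronsk u u1) (fun t => cIm ((u t)^* * u2 t)).
  have [_ p] := cprim_mul (cprimJ pu) pu1.
  apply: prim_ext p => x _ //=.
  by rewrite !cReE; ring.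
case: l l0 pu pu1 su su1 su2 mE pW => [a|] l0 pu pu1 su su1 su2 mE pW.
  have ea : edge (Some a) a by rewrite /= lexx (ltW (l0 a erefl)).
  by have [_ H] := pW; rewrite edge_Some /end_term (H a ea) addrC addKr.
rewrite /end_term sub0r; apply: prim_infty => //.
  by have [] := csq_mul mE (csqJ mE su) su2.
by have [] := csq_mul mE (csqJ mE su) su1.
Qed.

End EdgeGreen.

Section GraphResolvent.
Variable R : realType.
Local Notation leb := (@lebesgue_measure R).
Local Notation integ D f := (leb.-integrable D (EFin \o f)).
Local Notation C := R[i].
Local Notation cRe := (@complex.Re R).
Local Notation cIm := (@complex.Im R).
Variables (I : finType) (l : I -> option R).
Implicit Types (f psi : gfun R I).

Definition N2 f : R := \sum_i \int[leb]_(x in edge (l i)) sqmod (f i x).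

Lemma N2_ge0 f : 0 <= N2 f.
Proof. by apply: sumr_ge0 => i _; apply: Rintegral_ge0 => x _; exact: sqmod_ge0. Qed.

Lemma gnormE f : Defs.gnorm l f = Num.sqrt (N2 f). Proof. by []. Qed.

Lemma N2_le_edge f i : \int[leb]_(x in edge (l i)) sqmod (f i x) <= N2 f.
Proof.
rewrite /N2 (bigD1 i)//= lerDl; apply: sumr_ge0 => j _.
by apply: Rintegral_ge0 => x _; exact: sqmod_ge0.
Qed.

Lemma gL2E f : gL2 l f <-> forall i, csq (edge (l i)) (f i).
Proof. by split=> h i; apply/in_L2E; exact: h. Qed.

Lemma N2_eq0 f : gL2 l f -> N2 f <= 0 -> geq_ae l f (@gzero R I).
Proof.
move=> /gL2E sf h i.
have mE := measurable_edge (l i).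
have Z : \int[leb]_(x in edge (l i)) sqmod (f i x) = 0.
  by apply/le_anti; rewrite (le_trans (N2_le_edge f i) h)/=; apply: Rintegral_ge0 => x _; exact: sqmod_ge0.
have ifi := csq_sqmod mE (sf i).
have : (\int[leb]_(x in edge (l i)) `|(sqmod (f i x))%:E|)%E = 0%E.
  under eq_integral do rewrite gee0_abs ?lee_fin ?sqmod_ge0//.
  by rewrite EFin_Rint// Z.
move=> /(ae_eq_integral_abs leb mE (measurable_int _ ifi)); apply: ae_imp => x h0 /h0 [] e.
by apply: sqmod_eq0; rewrite e.
Qed.

Lemma N2_ae f g : gL2 l f -> gL2 l g -> geq_ae l f g -> N2 f = N2 g.
Proof.
move=> /gL2E sf /gL2E sg fg; apply: eq_bigr => i _.
have mE := measurable_edge (l i).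
apply: Rint_ae => //; do 1?[by apply: cmeas_sqmod; exact: csq_meas].
by apply: ae_imp (fg i) => x h /h ->.
Qed.

Lemma gL2_lin (w : C) f g : gL2 l f -> gL2 l g -> gL2 l (gaxpy w f g).
Proof.
move=> /gL2E sf /gL2E sg; apply/gL2E => i; have mE := measurable_edge (l i).
by apply: csqD => //; exact: csqZ.
Qed.

Lemma gL2_sub f g : gL2 l f -> gL2 l g -> gL2 l (gsub f g).
Proof.
move=> /gL2E sf /gL2E sg; apply/gL2E => i; have mE := measurable_edge (l i).
exact: csqB.
Qed.

Lemma gL2_0 : gL2 l (@gzero R I).
Proof. by apply/gL2E => i; apply: csq0; exact: measurable_edge. Qed.

Variables (B : I -> R -> R) (K r : R).
Hypothesis l_gt0 : forall i a, l i = Some a -> 0 < a.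
Hypothesis B_meas : forall i, measurable_fun (edge (l i)) (B i).
Hypothesis B_le : forall i x, edge (l i) x -> `|B i x| <= K.

(** The resolvent equation in integrated form. The second derivative is eliminated by the equation,
    so no statement almost everywhere remains and the identities hold at every point of the
    edges. *)
Definition solves (z : C) f psi psi1 := forall i,
  [/\ csq (edge (l i)) (psi i), csq (edge (l i)) (psi1 i),
      cprim (l i) (psi i) (psi1 i)
    & cprim (l i) (psi1 i) (fun x => ((B i x)%:C - z) * psi i x - f i x)].

Lemma edge0 i : edge (l i) 0.
Proof.
case E: (l i) => [a|] /=; last exact: lexx.
by rewrite lexx (ltW (l_gt0 E)).
Qed.

Lemma cmeas_pot (z : C) i : cmeas (edge (l i)) (fun x => (B i x)%:C - z).
Proof.
by apply: cmeasB; [split; [exact: B_meas|exact: measurable_cst]|exact: cmeas_cst].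
Qed.

Lemma pot_le (z : C) i x : edge (l i) x -> n1 ((B i x)%:C - z) <= K + n1 z.
Proof. by move=> lx; apply: le_trans (n1B _ _) _; rewrite lerD2r n1_real B_le. Qed.

Lemma csq_pot (z : C) f psi i : csq (edge (l i)) (psi i) -> csq (edge (l i)) (f i) ->
  csq (edge (l i)) (fun x => ((B i x)%:C - z) * psi i x - f i x).
Proof.
move=> s1 s2; have mE := measurable_edge (l i); apply: csqB => //.
by apply: csq_mulb s1 => //; [exact: cmeas_pot|exact: pot_le].
Qed.

Lemma schrE (bc : gfun R I -> gfun R I -> Prop) (z : C) f psi : gL2 l f ->
  schrodinger l B bc psi (gaxpy z psi f) <->
  exists2 psi1, solves z f psi psi1 & bc psi psi1.
Proof.
move=> /gL2E sf; split.
  move=> [psi1 [psi2 [H2 hbc ae]]]; exists psi1 => // i.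
  have [/in_L2E s0 /in_L2E s1 /in_L2E s2 p0 p1] := H2 i.
  split => //.
    by apply: cprimE => // x; exact: csq_loc s1.
  have p1' : cprim (l i) (psi1 i) (psi2 i) by apply: cprimE => // x; exact: csq_loc s2.
  apply: cprim_ae p1' _ _; first by apply: csq_meas; exact: csq_pot.
  apply: ae_imp (ae i) => x h /h; rewrite /gaxpy => e.
  have -> : psi2 i x = (B i x)%:C * psi i x - (- psi2 i x + (B i x)%:C * psi i x) by ring.
  by rewrite -e; ring.
move=> [psi1 sol hbc]; exists psi1, (fun i x => ((B i x)%:C - z) * psi i x - f i x).
split => //.
  move=> i; have [s0 s1 p0 p1] := sol i.
  split; try (by apply/in_L2E); try exact: cprim_primitive.
  by apply/in_L2E; exact: csq_pot.
by move=> i; apply: nearW => x _; rewrite /gaxpy; ring.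
Qed.

Lemma solves_sub (z : C) f g psi psi1 chi chi1 : solves z f psi psi1 ->
  solves z g chi chi1 ->
  solves z (gsub f g) (gsub psi chi) (gsub psi1 chi1).
Proof.
move=> h1 h2 i; have [s0 s1 p0 p1] := h1 i; have [t0 t1 q0 q1] := h2 i.
have mE := measurable_edge (l i); split; try exact: csqB; try exact: cprimB.
by apply: cprim_ext (cprimB p1 q1) => x _ //; rewrite /gsub; ring.
Qed.

Lemma solves_lin (z w : C) f g psi psi1 chi chi1 : solves z f psi psi1 ->
  solves z g chi chi1 ->
  solves z (gaxpy w f g) (gaxpy w psi chi) (gaxpy w psi1 chi1).
Proof.
move=> h1 h2 i; have [s0 s1 p0 p1] := h1 i; have [t0 t1 q0 q1] := h2 i.
have mE := measurable_edge (l i).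
split; try (by apply: csqD => //; exact: csqZ); try (by apply: cprimD => //; exact: cprimZ).
by apply: cprim_ext (cprimD (cprimZ w p1) q1) => x _ //; rewrite /gaxpy; ring.
Qed.

Definition bform psi psi1 : R :=
  \sum_i (wronsk (psi i) (psi1 i) 0 - end_term (l i) (wronsk (psi i) (psi1 i))).

(** Imaginary part of the equation tested against [psi]: the real potential drops out, and the
    boundary terms of [edge_green] form [bform]. *)
Lemma energy_identity (z : C) f psi psi1 : gL2 l f -> solves z f psi psi1 ->
  cIm z * N2 psi = bform psi psi1 -
    \sum_i \int[leb]_(x in edge (l i)) cIm ((psi i x)^* * f i x).
Proof.
move=> /gL2E sf sol; rewrite mulr_sumr -sumrB; apply: eq_bigr => i _.
have [s0 s1 p0 p1] := sol i; have mE := measurable_edge (l i).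
have s2 := csq_pot z s0 (sf i).
have := edge_green (@l_gt0 i) p0 p1 s0 s1 s2.
have iz : integ (edge (l i)) (fun x => - cIm z * sqmod (psi i x)).
  by apply: integZ => //; exact: csq_sqmod.
have if_ : integ (edge (l i)) (fun x => cIm ((psi i x)^* * f i x)).
  by have [] := csq_mul mE (csqJ mE s0) (sf i).
have -> : \int[leb]_(x in edge (l i)) cIm ((psi i x)^* * (((B i x)%:C - z) * psi i x - f i x)) =
  - cIm z * \int[leb]_(x in edge (l i)) sqmod (psi i x) -
  \int[leb]_(x in edge (l i)) cIm ((psi i x)^* * f i x).
  rewrite -RintegralZl//; last exact: csq_sqmod.
  rewrite -RintegralB//; apply: Rint_ext => x _.
  by rewrite /sqmod !cReE /=; ring.
move: (Rintegral _ _ _) (Rintegral _ _ _) (end_term _ _) (wronsk _ _ _) => a b c d; lra.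
Qed.

(** Young's inequality applied pointwise to [Im (conj psi * f)]. The boundary form is kept as an
    error term: it vanishes on the domains, giving the resolvent bound, and it is merely small for
    the difference of two solutions with different conditions at the origin. *)
Lemma apriori (z : C) f psi psi1 : gL2 l f -> solves z f psi psi1 ->
  cIm z ^+ 2 * N2 psi <= N2 f + 2 * (`|cIm z| * `|bform psi psi1|).
Proof.
move=> Lf sol; have := energy_identity Lf sol; have sf := (gL2E f).1 Lf.
set J := \sum_i _ => e.
have [->|z0] := eqVneq (cIm z) 0.
  by rewrite expr0n mul0r normr0 mul0r mulr0 addr0 N2_ge0.
have az : 0 < `|cIm z| by rewrite normr_gt0.
have J1 : 2 * `|cIm z| * `|J| <= cIm z ^+ 2 * N2 psi + N2 f.
  have c0 : 0 <= 2 * `|cIm z| by rewrite mulr_ge0.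
  apply: le_trans (ler_wpM2l c0 (ler_norm_sum _ _ _)) _.
  rewrite [X in X <= _]mulr_sumr /N2 [X in _ <= X + _]mulr_sumr -big_split /=.
  apply: ler_sum => i _.
  have [s0 s1 p0 p1] := sol i; have mE := measurable_edge (l i).
  have if_ : integ (edge (l i)) (fun x => cIm ((psi i x)^* * f i x)).
    by have [] := csq_mul mE (csqJ mE s0) (sf i).
  have ia := integ_norm if_.
  apply: le_trans (ler_wpM2l c0 (Rint_norm mE if_)) _.
  rewrite -!RintegralZl//; try exact: csq_sqmod; try exact: integZ.
  rewrite -RintegralD//; try exact: csq_sqmod; last by apply: integZ => //; exact: csq_sqmod.
  apply: Rint_le => //.
  - exact: integZ.
  - by apply: integD => //; [apply: integZ => //|]; exact: csq_sqmod.
  move=> x _; rewrite -[cIm z ^+ 2]real_normK ?num_real//.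
  move: (`|cIm z|) az {c0} => y y0.
  rewrite /sqmod !cReE.
  move: (cRe (psi i x)) (cIm (psi i x)) (cRe (f i x)) (cIm (f i x)) => a b c d.
  rewrite -[2 * y](@gtr0_norm _ (2 * y)) ?mulr_gt0// -normrM ler_norml; apply/andP; split.
    have := sqr_ge0 (y * a + d); have := sqr_ge0 (y * b - c); nra.
  have := sqr_ge0 (y * a - d); have := sqr_ge0 (y * b + c); nra.
have : cIm z ^+ 2 * N2 psi <= `|cIm z| * (`|bform psi psi1| + `|J|).
  rewrite expr2 -mulrA e; apply: le_trans (ler_norm _) _; rewrite normrM ler_wpM2l//.
  exact: ler_normB.
rewrite mulrDr; lra.
Qed.

End GraphResolvent.

Lemma lin_solve (F : fieldType) n (L : 'rV[F]_n -> 'rV[F]_n) : linear L ->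
  (forall P, L P = 0 -> P = 0) -> forall y, exists P, L P = y.
Proof.
move=> linL injL y.
pose L' : {linear 'rV[F]_n -> 'rV[F]_n} :=
  HB.pack L (GRing.isLinear.Build _ _ _ _ L linL).
have E P : P *m lin1_mx L' = L P by rewrite mul_rV_lin1.
have U : lin1_mx L' \in unitmx.
  rewrite -row_free_unit -kermx_eq0; apply/eqP/row_matrixP => i.
  rewrite row0; apply: injL; rewrite -E; apply/sub_kermxP; exact: row_sub.
by exists (y *m invmx (lin1_mx L')); rewrite -E mulmxKV.
Qed.

(** The map may have a kernel. A pseudo-inverse provides another preimage of the same value which is
    controlled by that value, so a vector is small modulo the kernel when its image is small. *)
Lemma lin_pinv (R : realType) n (L : 'rV[R[i]]_n -> 'rV[R[i]]_n) : linear L ->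
  exists2 c : R, 0 <= c & forall P, exists P', L P' = L P /\
    forall j, n1 (P' 0 j) <= c * \sum_k n1 (L P 0 k).
Proof.
move=> linL.
pose L' : {linear 'rV[R[i]]_n -> 'rV[R[i]]_n} :=
  HB.pack L (GRing.isLinear.Build _ _ _ _ L linL).
have E P : P *m lin1_mx L' = L P by rewrite mul_rV_lin1.
pose Q := pinvmx (lin1_mx L').
exists (\sum_j \sum_k n1 (Q k j)).
  by apply: sumr_ge0 => j _; apply: sumr_ge0 => k _; exact: n1_ge0.
move=> P; exists (L P *m Q); split.
  by rewrite -!E mulmxKpV// submxMl.
move=> j; rewrite mxE; apply: le_trans (n1_sum _ _ _) _.
rewrite mulr_sumr; apply: ler_sum => k _; apply: le_trans (n1M _ _) _.
rewrite mulrC ler_wpM2r ?n1_ge0// (bigD1 j)//= (bigD1 k)//= -addrA lerDl.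
by rewrite addr_ge0//; do ?apply: sumr_ge0 => *; rewrite ?n1_ge0//; apply: sumr_ge0 => *; exact: n1_ge0.
Qed.

Lemma N2Z0 (R : realType) (I : finType) (l : I -> option R) : N2 l (@gzero R I) = 0.
Proof.
rewrite /N2 big1// => i _; rewrite /gzero.
by under Rint_ext do rewrite sqmod0; rewrite /Rintegral integral0.
Qed.

Lemma gnorm_le (R : realType) (I : finType) (l : I -> option R) (f psi : gfun R I) (c : R) :
  N2 l psi <= N2 l f / c ^+ 2 -> Defs.gnorm l psi <= `|c|^-1 * Defs.gnorm l f.
Proof.
move=> h; rewrite !gnormE mulrC -[`|c|]sqrtr_sqr -sqrtrV ?sqr_ge0// -sqrtrM ?N2_ge0//.
exact: ler_wsqrtr.
Qed.

(** * Solvability of the resolvent equation as a finite linear system *)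

Section GraphSolve.
Variable R : realType.
Local Notation leb := (@lebesgue_measure R).
Local Notation integ D f := (leb.-integrable D (EFin \o f)).
Local Notation C := R[i].
Local Notation cRe := (@complex.Re R).
Local Notation cIm := (@complex.Im R).
Variables (I : finType) (l : I -> option R).
Implicit Types (f psi : gfun R I).
Variables (B : I -> R -> R) (K r : R).
Hypothesis l_gt0 : forall i a, l i = Some a -> 0 < a.
Hypothesis B_meas : forall i, measurable_fun (edge (l i)) (B i).
Hypothesis B_le : forall i x, edge (l i) x -> `|B i x| <= K.

(** Candidates live on [[0, +oo[] for every edge, including finite ones, so that one existence
    theorem serves all edges; only the restriction to the edge matters in the end. *)
Definition regular psi psi1 := forall i, cprim None (psi i) (psi1 i).

Lemma edge_None_sub l0 : edge l0 `<=` edge (None : option R).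
Proof. by move=> x /edge_ge0. Qed.

Lemma regular_lin (a : C) psi psi1 chi chi1 : regular psi psi1 -> regular chi chi1 ->
  regular (gaxpy a psi chi) (gaxpy a psi1 chi1).
Proof. by move=> h1 h2 i; apply: cprimD => //; exact: cprimZ. Qed.

Lemma edge_pos i : exists2 b : R, 0 < b & edge (l i) b.
Proof.
case E: (l i) => [a|]; last by exists 1 => //=.
by exists a; [exact: l_gt0 E|rewrite /= lexx (ltW (l_gt0 E))].
Qed.

(** The equation expresses the second derivative by [psi] and [f], so the interpolation bound
    applies. The constant depends only on the edges, the bound of the potential and [z], which later
    makes it independent of [eps] on the outer edges. *)
Lemma trace_solves (z : C) : exists2 T, 0 <= T & forall f psi psi1 i, gL2 l f ->
  solves l B z f psi psi1 -> sqmod (psi i 0) + sqmod (psi1 i 0) <= T * (N2 l psi + N2 l f).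
Proof.
have H i : exists2 T, 0 <= T & forall f psi psi1, gL2 l f ->
    solves l B z f psi psi1 -> sqmod (psi i 0) + sqmod (psi1 i 0) <= T * (N2 l psi + N2 l f).
  have [b b0 lb] := edge_pos i; have [T T0 HT] := ctrace_bound b0.
  pose c := 2 * (K + n1 z) ^+ 2.
  have c0 : 0 <= c by rewrite mulr_ge0// sqr_ge0.
  exists (T * (c + 3)); first by rewrite mulr_ge0// addr_ge0.
  move=> f psi psi1 /gL2E sf sol; have [s0 s1 p0 p1] := sol i.
  have mE := measurable_edge (l i).
  apply: le_trans (HT _ _ _ _ lb p0 p1 s0 _) _; first exact: (csq_pot B_meas B_le).
  rewrite -mulrA ler_wpM2l//.
  have ip := csq_sqmod mE s0; have iff := csq_sqmod mE (sf i).
  have le1 : \int[leb]_(t in edge (l i)) sqmod (((B i t)%:C - z) * psi i t - f i t) <=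
     c * \int[leb]_(t in edge (l i)) sqmod (psi i t) + 2 * \int[leb]_(t in edge (l i)) sqmod (f i t).
    rewrite -!RintegralZl// -RintegralD//; try exact: integZ.
    apply: Rint_le => //.
    - by apply: csq_sqmod => //; exact: (csq_pot B_meas B_le).
    - by apply: integD => //; exact: integZ.
    move=> x lx; apply: le_trans (sqmodD _ _) _; rewrite sqmodN lerD2r sqmodM mulrA.
    rewrite ler_wpM2r ?sqmod_ge0// ler_wpM2l//; apply: le_trans (sqmod_le_n1 _) _.
    have := pot_le B_le z lx => h; rewrite lerXn2r ?nnegrE ?n1_ge0//.
    exact: le_trans (n1_ge0 _) h.
  have h1 := N2_le_edge l psi i; have h2 := N2_le_edge l f i.
  have g1 : 0 <= \int[leb]_(t in edge (l i)) sqmod (f i t).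
    by apply: Rintegral_ge0 => x _; exact: sqmod_ge0.
  have g2 : 0 <= \int[leb]_(t in edge (l i)) sqmod (psi i t).
    by apply: Rintegral_ge0 => x _; exact: sqmod_ge0.
  move: le1 h1 h2 g1 g2; move: (Rintegral _ _ _) (Rintegral _ _ _) (Rintegral _ _ _) (N2 _ _) (N2 _ _) => a1 a2 a3 a4 a5 *.
  have : c * a2 <= c * a5 by rewrite ler_wpM2l.
  have : 0 <= c * a4 by rewrite mulr_ge0//; lra.
  lra.
have [T HT] := choice (fun i => let: ex_intro2 T T0 HT := H i in
  ex_intro (fun T => 0 <= T /\ forall f psi psi1, gL2 l f ->
    solves l B z f psi psi1 -> sqmod (psi i 0) + sqmod (psi1 i 0) <= T * (N2 l psi + N2 l f)) T (conj T0 HT)).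
exists (\sum_i T i); first by apply: sumr_ge0 => i _; case: (HT i).
move=> f psi psi1 i Lf sol; have [T0 h] := HT i; apply: le_trans (h f psi psi1 Lf sol) _.
rewrite ler_wpM2r ?addr_ge0 ?N2_ge0// (bigD1 i)//= lerDl.
by apply: sumr_ge0 => j _; case: (HT j).
Qed.

Definition pot (z : C) i := zext (edge (l i)) (fun x => (B i x)%:C - z).

Lemma cmeas_pot_ext z i : cmeas (edge None) (pot z i).
Proof. by apply: cmeas_zext; [exact: measurable_edge|exact: measurable_edge|exact: cmeas_pot]. Qed.

Lemma pot_ext_le z i x : 0 <= x -> n1 (pot z i x) <= K + n1 z.
Proof.
move=> _; rewrite /pot /zext; case: ifPn => [/set_mem|_]; first exact: (pot_le B_le).
rewrite n1_0 addr_ge0 ?n1_ge0//.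
by have := B_le (edge0 l_gt0 i); apply: le_trans.
Qed.

(** Fundamental system with unit initial data: the index [false] has value [1] and slope [0], the
    index [true] has value [0] and slope [1]. *)
Lemma fundamental z : exists U U1 : I -> bool -> R -> C, forall i b,
  [/\ cprim None (U i b) (U1 i b), cprim None (U1 i b) (fun x => pot z i x * U i b x),
      U i b 0 = (~~ b)%:R & U1 i b 0 = b%:R].
Proof.
have H (k : I * bool) : exists u : (R -> C) * (R -> C),
  [/\ cprim None u.1 u.2, cprim None u.2 (fun x => pot z k.1 x * u.1 x),
      u.1 0 = (~~ k.2)%:R & u.2 0 = k.2%:R].
  have [u [u1 [p0 p1 e0 e1]]] := schr_exists (~~ k.2)%:R k.2%:R (cmeas_pot_ext z k.1)
    (pot_ext_le z k.1) (csq0 (measurable_edge (None : option R))).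
  exists (u, u1); split => //=; apply: cprim_ext p1 => x _ //; exact: subr0.
have [F HF] := choice H.
exists (fun i b => (F (i, b)).1), (fun i b => (F (i, b)).2) => i b; exact: (HF (i, b)).
Qed.

(** The coefficient at [(i, false)] is the initial value on edge [i] and that at [(i, true)] the
    initial slope. Indexing the unknowns by [I * bool] makes them as numerous as the edge ends. *)
Definition comb (U : I -> bool -> R -> C) (P : I * bool -> C) : gfun R I :=
  fun i x => P (i, false) * U i false x + P (i, true) * U i true x.

Lemma comb_lin U (a : C) P Q : comb U (fun h => a * P h + Q h) = gaxpy a (comb U P) (comb U Q).
Proof. by apply/funext => i; apply/funext => x; rewrite /comb /gaxpy; ring. Qed.

Section Fundamental.
Variables (z : C) (U U1 : I -> bool -> R -> C).
Hypothesis HU : forall i b,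
  [/\ cprim None (U i b) (U1 i b), cprim None (U1 i b) (fun x => pot z i x * U i b x),
      U i b 0 = (~~ b)%:R & U1 i b 0 = b%:R].

Lemma comb_regular P : regular (comb U P) (comb U1 P).
Proof.
move=> i; have [p0 _ _ _] := HU i false; have [q0 _ _ _] := HU i true.
by apply: cprimD; exact: cprimZ.
Qed.

Lemma comb_eq P i : cprim (l i) (comb U1 P i) (fun x => ((B i x)%:C - z) * comb U P i x).
Proof.
have [_ p0 _ _] := HU i false; have [_ q0 _ _] := HU i true.
apply: cprim_ext (cprim_sub (@edge_None_sub (l i)) (cprimD (cprimZ (P (i, false)) p0) (cprimZ (P (i, true)) q0))) => x lx //.
by rewrite /pot zextE// /comb; ring.
Qed.

Lemma comb0 P i : comb U P i 0 = P (i, false) /\ comb U1 P i 0 = P (i, true).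
Proof.
have [_ _ e1 e2] := HU i false; have [_ _ e3 e4] := HU i true.
by rewrite /comb e1 e2 e3 e4 /= !mulr1 !mulr0 addr0 add0r.
Qed.

End Fundamental.

Hypothesis B_cpt : forall i x, l i = None -> 0 <= x -> r < x -> B i x = 0.

Definition linear_res (rs : gfun R I -> gfun R I -> C) := forall a psi psi1 chi chi1,
  rs (gaxpy a psi chi) (gaxpy a psi1 chi1) = a * rs psi psi1 + rs chi chi1.

(** The pair [(i, true)] of a half-line is not an end of the graph. It stays in the index type
    because it labels the equation that excludes growth at infinity. *)
Definition actual_end (h : I * bool) := ~~ (h.2 && (l h.1 == None)).

Section Resolvent.
Variables (z la : C) (E : R -> C).
Hypotheses (z_im : cIm z != 0) (la2 : la ^+ 2 = - z) (la0 : 0 < cRe la)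
  (pE : cprim None E (fun x => - la * E x))
  (sE : forall x, sqmod (E x) = expR (- (2 * cRe la) * x)).

(** For a solution, this is the limit at infinity of [E * (psi1 + la * psi)], the coefficient of the
    growing exponential. *)
Definition growth (i : I) f psi psi1 : C := E 0 * (psi1 i 0 + la * psi i 0) +
  cintegral (edge None) (fun t => E t * ((B i t)%:C * psi i t - f i t)).

(** By-product of [halfline_sq], applied with [g] and [h] equal to zero. *)
Lemma csq_E : csq (edge None) E.
Proof.
have mE := measurable_edge (None : option R).
have [|||//] := @halfline_sq R la E (fun=> 0) (fun=> 0) la0 pE sE.
- by apply: cprim_ext (cprim_cst None 0) => x _ //; rewrite mulr0 addr0.
- exact: csq0.
- rewrite mulr0 add0r -[RHS](cintegral0 (edge None)); apply: cintegral_ext => x _.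
  by rewrite mulr0.
Qed.

Lemma growth_int i f psi psi1 : l i = None -> gL2 l f -> regular psi psi1 ->
  cint (edge None) (fun t => E t * ((B i t)%:C * psi i t - f i t)).
Proof.
move=> li /gL2E /(_ i) sf reg; rewrite li in sf.
have mE := measurable_edge (None : option R).
apply: csq_mul => //; first exact: csq_E; apply: csqB => //.
apply: (@csq_compact R (B i) _ (psi1 i) K r) => //.
- by have := @B_meas i; rewrite li.
- by move=> x x0; apply: B_le; rewrite li.
- by move=> x; exact: B_cpt.
Qed.

Lemma growth_lin i a f g psi psi1 chi chi1 : l i = None -> gL2 l f -> gL2 l g ->
  regular psi psi1 -> regular chi chi1 ->
  growth i (gaxpy a f g) (gaxpy a psi chi) (gaxpy a psi1 chi1) =
  a * growth i f psi psi1 + growth i g chi chi1.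
Proof.
move=> li Lf Lg r1 r2; have i1 := growth_int li Lf r1; have i2 := growth_int li Lg r2.
have mE := measurable_edge (None : option R).
have Ec : cintegral (edge None) (fun t => E t * ((B i t)%:C * gaxpy a psi chi i t - gaxpy a f g i t)) =
    a * cintegral (edge None) (fun t => E t * ((B i t)%:C * psi i t - f i t)) +
    cintegral (edge None) (fun t => E t * ((B i t)%:C * chi i t - g i t)).
  rewrite -cintegralZ// -cintegralD//; last exact: cintZ.
  by apply: cintegral_ext => x _; rewrite /gaxpy; ring.
by rewrite /growth Ec /gaxpy; move: (cintegral _ _) (cintegral _ _) => c1 c2; ring.
Qed.

(** Square integrability is automatic on bounded edges; on half-lines it follows from the absence of
    the growing mode. *)
Lemma solves_of f psi psi1 : gL2 l f -> regular psi psi1 ->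
  (forall i, cprim (l i) (psi1 i) (fun x => ((B i x)%:C - z) * psi i x - f i x)) ->
  (forall i, l i = None -> growth i f psi psi1 = 0) -> solves l B z f psi psi1.
Proof.
move=> /gL2E sf reg p1 gr i.
have p0 : cprim (l i) (psi i) (psi1 i) by apply: cprim_sub (reg i); exact: edge_None_sub.
case li : (l i) => [a|]; rewrite -li.
  have la' : edge (l i) a by rewrite li /= lexx (ltW (l_gt0 li)).
  have Ee : edge (l i) = `[0, a]%classic by rewrite li edge_Some.
  by split => //; rewrite Ee; [exact: cprim_csq p0 la'|exact: cprim_csq (p1 i) la'].
have sfi := sf i; have p1i := p1 i; have Bm := @B_meas i; have Bl := @B_le i.
rewrite li in p0 sfi p1i Bm Bl.
have [] := halfline_H2 la2 la0 pE sE Bm Bl (fun x => @B_cpt i x li) sfi p0 p1i (gr i li).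
by move=> s0 s1; rewrite li; split.
Qed.

Variables (bc : gfun R I -> gfun R I -> Prop)
  (res : gfun R I -> gfun R I -> I * bool -> C).
Hypotheses (res_lin : forall h, linear_res (fun psi psi1 => res psi psi1 h))
  (bcE : forall psi psi1, bc psi psi1 <-> forall h, actual_end h -> res psi psi1 h = 0)
  (bc_sym : forall psi psi1, bc psi psi1 -> bform l psi psi1 = 0).

Lemma solves_bound f psi psi1 : gL2 l f -> solves l B z f psi psi1 -> bc psi psi1 ->
  N2 l psi <= N2 l f / cIm z ^+ 2.
Proof.
move=> Lf sol hbc; have := apriori l_gt0 B_meas B_le Lf sol.
rewrite bc_sym// normr0 !mulr0 addr0 => h.
rewrite ler_pdivlMr; first by rewrite mulrC.
by rewrite lt_neqAle eq_sym sqrf_eq0 z_im sqr_ge0.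
Qed.

(* One scalar equation per edge end; at the infinite end of a half-line it removes
   the growing mode. *)
Definition total_res f psi psi1 (h : I * bool) : C :=
  if actual_end h then res psi psi1 h else growth h.1 f psi psi1.

Lemma total_res_lin a f g psi psi1 chi chi1 h : gL2 l f -> gL2 l g ->
  regular psi psi1 -> regular chi chi1 ->
  total_res (gaxpy a f g) (gaxpy a psi chi) (gaxpy a psi1 chi1) h =
  a * total_res f psi psi1 h + total_res g chi chi1 h.
Proof.
move=> Lf Lg r1 r2; rewrite /total_res; case: ifPn => [_|]; first exact: res_lin.
by rewrite /actual_end negbK => /andP[_ /eqP li]; exact: growth_lin.
Qed.

Lemma solves_total f psi psi1 : gL2 l f -> regular psi psi1 ->
  (forall i, cprim (l i) (psi1 i) (fun x => ((B i x)%:C - z) * psi i x - f i x)) ->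
  (forall h, total_res f psi psi1 h = 0) -> solves l B z f psi psi1 /\ bc psi psi1.
Proof.
move=> Lf reg p1 tr; split.
  apply: solves_of => // i li; have := tr (i, true); rewrite /total_res ifF//.
  by rewrite /actual_end /= li.
by apply/bcE => h ah; have := tr h; rewrite /total_res ah.
Qed.

(** A particular solution is corrected by a combination of fundamental solutions that cancels its
    residuals. The correction exists because an injective endomorphism of a finite-dimensional space
    is surjective, and injectivity is uniqueness for the resolvent equation. *)
Lemma graph_solvable f : gL2 l f -> exists psi psi1, solves l B z f psi psi1 /\ bc psi psi1.
Proof.
move=> Lf; have sf := (gL2E l f).1 Lf.
have [U [U1 HU]] := fundamental z.
have L0 := gL2_0 l.
(* Particular solution with zero initial data, for the source extended by zero beyond the edge. *)
have part i : exists v : (R -> C) * (R -> C),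
    cprim None v.1 v.2 /\ cprim None v.2 (fun x => pot z i x * v.1 x - zext (edge (l i)) (f i) x).
  have [u [u1 [p0 p1 _ _]]] := schr_exists 0 0 (cmeas_pot_ext z i) (pot_ext_le z i)
    (csq_zext (measurable_edge _) (measurable_edge None) (sf i)).
  by exists (u, u1).
have [V HV] := choice part.
pose v : gfun R I := fun i => (V i).1; pose v1 : gfun R I := fun i => (V i).2.
have rv : regular v v1 by move=> i; case: (HV i).
have ev i : cprim (l i) (v1 i) (fun x => ((B i x)%:C - z) * v i x - f i x).
  have [_ p] := HV i; apply: cprim_ext (cprim_sub (@edge_None_sub (l i)) p) => x lx //.
  by rewrite /pot !zextE.
pose n := #|{: I * bool}|.
pose pc (P : 'rV[C]_n) (h : I * bool) : C := P 0 (enum_rank h).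
pose L (P : 'rV[C]_n) : 'rV[C]_n :=
  \row_j total_res (@gzero R I) (comb U (pc P)) (comb U1 (pc P)) (enum_val j).
have pc_lin a P Q : pc (a *: P + Q) = (fun h => a * pc P h + pc Q h).
  by apply/funext => h; rewrite /pc !mxE.
have g0 a : gaxpy a (@gzero R I) (@gzero R I) = @gzero R I.
  by apply/funext => i; apply/funext => x; rewrite /gaxpy /gzero mulr0 addr0.
have linL : linear L.
  move=> a P Q; apply/rowP => j; rewrite !mxE pc_lin !comb_lin -{1}(g0 a).
  by apply: total_res_lin => //; exact: (comb_regular HU).
(* A combination without residuals solves the equation with zero source, hence has norm zero;
   [trace_solves] then kills its initial data, which are the coordinates of [P]. *)
have injL P : L P = 0 -> P = 0.
  move=> LP.
  have [||sol hbc] := @solves_total (@gzero R I) (comb U (pc P)) (comb U1 (pc P)) L0 (comb_regular HU _).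
  - by move=> i; apply: cprim_ext (comb_eq HU (pc P) i) => x _ //; rewrite /gzero subr0.
  - by move=> h; have /rowP /(_ (enum_rank h)) := LP; rewrite !mxE enum_rankK.
  have N0 := N2Z0 l.
  have := solves_bound L0 sol hbc; rewrite N0 mul0r => Nle.
  have Npsi : N2 l (comb U (pc P)) = 0 by apply/le_anti; rewrite Nle N2_ge0.
  have [T T0 HT] := trace_solves z.
  apply/rowP => j; rewrite mxE; have := HT _ _ _ (enum_val j).1 L0 sol.
  rewrite Npsi N0 addr0 mulr0; have [-> ->] := comb0 HU (pc P) (enum_val j).1 => tr.
  have p1 : pc P ((enum_val j).1, false) = 0.
    by apply: sqmod_eq0; apply: le_trans tr; rewrite lerDl sqmod_ge0.
  have p2 : pc P ((enum_val j).1, true) = 0.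
    by apply: sqmod_eq0; apply: le_trans tr; rewrite lerDr sqmod_ge0.
  rewrite -(enum_valK j) -/(pc P (enum_val j)).
  by case: (enum_val j) p1 p2 => i [].
have [P HP] := lin_solve linL injL (- \row_j total_res f v v1 (enum_val j)).
exists (gaxpy 1 (comb U (pc P)) v), (gaxpy 1 (comb U1 (pc P)) v1).
have ef : f = gaxpy 1 (@gzero R I) f.
  by apply/funext => i; apply/funext => x; rewrite /gaxpy /gzero mulr0 add0r.
apply: solves_total => //.
- by apply: regular_lin => //; exact: (comb_regular HU).
- move=> i; apply: cprim_ext (cprimD (comb_eq HU (pc P) i) (ev i)) => x _ //.
    by rewrite /gaxpy mul1r.
  by rewrite /gaxpy mul1r; ring.
- move=> h; rewrite {1}ef total_res_lin//; last exact: (comb_regular HU).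
  have /rowP /(_ (enum_rank h)) := HP; rewrite !mxE !enum_rankK => ->.
  by rewrite mul1r addNr.
Qed.

Lemma graph_resolvent_set : resolvent_set l (schrodinger l B bc) z.
Proof.
split.
- move=> f Lf; have [psi [psi1 [sol hbc]]] := graph_solvable Lf.
  by exists psi; apply/(schrE B_meas B_le) => //; exists psi1.
- move=> f psi chi Lf /(schrE B_meas B_le _ _ _ Lf)[psi1 sol1 bc1] /(schrE B_meas B_le _ _ _ Lf)[chi1 sol2 bc2].
  have L1 : gL2 l psi by apply/gL2E => i; case: (sol1 i).
  have L2 : gL2 l chi by apply/gL2E => i; case: (sol2 i).
  have sol := solves_lin (-1) sol2 sol1.
  have L0 := gL2_0 l.
  have ff : gaxpy (-1) f f = @gzero R I.
    by apply/funext => i; apply/funext => x; rewrite /gaxpy /gzero mulN1r addNr.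
  rewrite ff in sol.
  have hbc : bc (gaxpy (-1) chi psi) (gaxpy (-1) chi1 psi1).
    apply/bcE => h ah; rewrite res_lin.
    by rewrite ((bcE chi chi1).1 bc2 h ah) ((bcE psi psi1).1 bc1 h ah) mulr0 addr0.
  have := solves_bound L0 sol hbc; rewrite (N2Z0 l) mul0r => Nle.
  have := N2_eq0 (gL2_lin (-1) L2 L1) Nle.
  move=> h i; apply: ae_imp (h i) => x e /e; rewrite /gaxpy /gzero mulN1r addrC => /eqP.
  by rewrite subr_eq0 => /eqP.
- exists (`|cIm z|^-1) => f psi Lf /(schrE B_meas B_le _ _ _ Lf)[psi1 sol1 bc1].
  exact: gnorm_le (solves_bound Lf sol1 bc1).
Qed.

End Resolvent.
End GraphSolve.

(** Interface for the concrete operators: the boundary condition has to be a family of linear scalar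
    residuals, one for each genuine edge end, and has to annihilate the boundary form. *)
Lemma schrodinger_resolvent_set (R : realType) (I : finType) (l : I -> option R)
  (B : I -> R -> R) (K r : R) (z : R[i])
  (bc : gfun R I -> gfun R I -> Prop) (res : gfun R I -> gfun R I -> I * bool -> R[i]) :
  (forall i a, l i = Some a -> 0 < a) ->
  (forall i, measurable_fun (edge (l i)) (B i)) ->
  (forall i x, edge (l i) x -> `|B i x| <= K) ->
  (forall i x, l i = None -> 0 <= x -> r < x -> B i x = 0) ->
  complex.Im z != 0 ->
  (forall h, linear_res (fun psi psi1 => res psi psi1 h)) ->
  (forall psi psi1, bc psi psi1 <-> forall h, actual_end l h -> res psi psi1 h = 0) ->
  (forall psi psi1, bc psi psi1 -> bform l psi psi1 = 0) ->
  resolvent_set l (schrodinger l B bc) z.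
Proof.
move=> l0 mB BK Br z0 lin bcE sym.
have [la [la2 la0]] := sqrt_right z0.
have [E [pE sE]] := decaying_exp la.
exact: (graph_resolvent_set l0 mB BK Br z0 la2 la0 pE sE lin bcE sym).
Qed.

Lemma resolventP (R : realType) (I : finType) (l : I -> option R) (A : gop R I)
  (z : R[i]) (f : gfun R I) : resolvent_set l A z -> gL2 l f ->
  A (resolvent A z f) (gaxpy z (resolvent A z f) f).
Proof.
move=> [ex _ _] Lf; rewrite /resolvent.
by have [psi hpsi] := ex f Lf; exact: (@xgetI _ (@gzero R I) [set psi | A psi (gaxpy z psi f)] psi hpsi).
Qed.

(** * Vertex conditions *)

Section VertexConditions.
Variables (R : realType).
Local Notation C := R[i].
Local Notation cRe := (@complex.Re R).
Local Notation cIm := (@complex.Im R).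

Lemma conj_conjc (w : C) : Num.conj w = conjc w.
Proof. by []. Qed.

Lemma cdotE n (u v : 'cV[C]_n) : cdot u v = \sum_i (u i 0)^* * v i 0.
Proof. by []. Qed.

Lemma cdot_adj n (A : 'M[C]_n) (u v : 'cV[C]_n) : cdot u (A *m v) = cdot (adjmx A *m u) v.
Proof.
rewrite /cdot.
transitivity (\sum_i \sum_j (u i 0)^* * (A i j * v j 0)).
  by apply: eq_bigr => i _; rewrite mxE mulr_sumr.
rewrite exchange_big /=; apply: eq_bigr => j _.
rewrite mxE rmorph_sum /= mulr_suml; apply: eq_bigr => i _.
have aE : adjmx A j i = (A i j)^* by rewrite !mxE.
have h : conjc (adjmx A j i * u i 0) = A i j * conjc (u i 0).
  by apply: cext; rewrite aE !cReE; ring.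
by rewrite mulrCA mulrA; congr (_ * _); exact: esym h.
Qed.

Lemma cdotJ n (u v : 'cV[C]_n) : (cdot u v)^* = cdot v u.
Proof.
rewrite /cdot rmorph_sum /=; apply: eq_bigr => i _.
by rewrite rmorphM /= conjcK mulrC.
Qed.

Lemma cdot_col m n (a c : 'cV[C]_m) (b d : 'cV[C]_n) :
  cdot (col_mx a b) (col_mx c d) = cdot a c + cdot b d.
Proof.
by rewrite /cdot big_split_ord; congr (_ + _); apply: eq_bigr => i _;
  rewrite ?col_mxEu ?col_mxEd.
Qed.

Lemma cdot_const n (a b : C) : cdot (const_mx a : 'cV[C]_n) (const_mx b) = n%:R * (a^* * b).
Proof.
rewrite /cdot (eq_bigr (fun=> a^* * b)); last by move=> i _; rewrite !mxE.
by rewrite sumr_const card_ord mulr_natl.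
Qed.

(* The two summands lie in orthogonal subspaces, so [vres = 0] is equivalent to
   [vertex_cond]. *)
Definition vres n (P Th : 'M[C]_n) (Psi Psi1 : 'cV[C]_n) : 'cV[C]_n :=
  (1%:M - P) *m Psi + (P *m Psi1 - Th *m (P *m Psi)).

Lemma vres_lin n (P Th : 'M[C]_n) a (u u1 v v1 : 'cV[C]_n) :
  vres P Th (a *: u + v) (a *: u1 + v1) = a *: vres P Th u u1 + vres P Th v v1.
Proof.
rewrite /vres !mulmxDr -!scalemxAr !scalerDr scalerN opprD.
by rewrite [X in _ + X = _]addrACA [LHS]addrACA.
Qed.

Lemma selfadjoint_l n (P Th : 'M[C]_n) : orth_projection P -> selfadjoint_in P Th ->
  P *m Th = Th /\ Th *m P = Th.
Proof.
move=> [PP _] [PTP _]; split.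
  by rewrite -{1}PTP !mulmxA PP.
by rewrite -{1}PTP -!mulmxA PP mulmxA.
Qed.

Lemma vertex_condE n (P Th : 'M[C]_n) (u v : 'cV[C]_n) : orth_projection P ->
  selfadjoint_in P Th -> vertex_cond P Th u v <-> vres P Th u v = 0.
Proof.
move=> oP sT; have [h1 h2] := selfadjoint_l oP sT; have [PP _] := oP.
split => [[e1 e2]|e]; first by rewrite /vres e1 e2 addr0.
(* Multiplication by [P] kills the first summand of [vres] and fixes the second, because
   [P *m Th = Th]. *)
have e2 : P *m v - Th *m (P *m u) = 0.
  have := congr1 (mulmx P) e; rewrite mulmx0 /vres mulmxDr mulmxBr !mulmxA.
  by rewrite mulmxBr mulmx1 PP subrr mul0mx add0r h1 -!mulmxA.
by split => //; move: e; rewrite /vres e2 addr0.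
Qed.

(** Both [u] and [v] lie in [Ran P], so only the [P]-components of [u1] and [v1] are seen; these are
    [Th u] and [Th v], and [Th] is self-adjoint. *)
Lemma vertex_sym n (P Th : 'M[C]_n) (u u1 v v1 : 'cV[C]_n) : orth_projection P ->
  selfadjoint_in P Th -> vertex_cond P Th u u1 -> vertex_cond P Th v v1 ->
  cdot u v1 = cdot u1 v.
Proof.
move=> oP sT [e1 e2] [e3 e4]; have [h1 h2] := selfadjoint_l oP sT.
have [PP aP] := oP; have [_ aT] := sT.
have Pu : P *m u = u.
  by move: e1; rewrite mulmxBl mul1mx => /eqP; rewrite subr_eq0 => /eqP <-.
have Pv : P *m v = v.
  by move: e3; rewrite mulmxBl mul1mx => /eqP; rewrite subr_eq0 => /eqP <-.
have Pu1 : P *m u1 = Th *m u by move/eqP: e2; rewrite subr_eq0 Pu => /eqP.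
have Pv1 : P *m v1 = Th *m v by move/eqP: e4; rewrite subr_eq0 Pv => /eqP.
have -> : cdot u v1 = cdot u (P *m v1) by rewrite cdot_adj aP Pu.
rewrite Pv1 cdot_adj aT -Pu1.
have -> : P *m u1 = adjmx P *m u1 by rewrite aP.
by rewrite -cdot_adj Pv.
Qed.

Lemma vertex_real n (P Th : 'M[C]_n) (u u1 : 'cV[C]_n) : orth_projection P ->
  selfadjoint_in P Th -> vertex_cond P Th u u1 -> cIm (cdot u u1) = 0.
Proof.
move=> oP sT vc; have := vertex_sym oP sT vc vc; rewrite -[RHS]cdotJ.
by case: (cdot u u1) => a b [] /= e; lra.
Qed.

Lemma kirchhoffM n (u : 'cV[C]_n) : kirchhoff_proj R n *m u = const_mx (n%:R^-1 * \sum_i u i 0).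
Proof.
apply/colP => i; rewrite !mxE mulr_sumr; apply: eq_bigr => j _.
by rewrite !mxE.
Qed.

Lemma natC_neq0 n : (0 < n)%N -> (n%:R : C) != 0.
Proof. by rewrite pnatr_eq0 -lt0n. Qed.

Lemma kirchhoff_orth n : (0 < n)%N -> orth_projection (kirchhoff_proj R n).
Proof.
move=> n0; split.
  apply/matrixP => i j; rewrite !mxE.
  rewrite (eq_bigr (fun=> n%:R^-1 * n%:R^-1)); last by move=> k _; rewrite !mxE.
  by rewrite sumr_const card_ord -[LHS]mulr_natr divfK ?natC_neq0.
apply/matrixP => i j; rewrite !mxE /= conj_conjc conjc_inv conjc_nat//.
Qed.

Lemma selfadjoint0 n (P : 'M[C]_n) : selfadjoint_in P 0.
Proof.
split; first by rewrite mulmx0 mul0mx.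
by apply/matrixP => i j; rewrite !mxE; exact: conjc0.
Qed.

Lemma kirchhoff_const n (u u1 : 'cV[C]_n) : (0 < n)%N -> vertex_cond (kirchhoff_proj R n) 0 u u1 ->
  (forall i j, u i 0 = u j 0) /\ \sum_i u1 i 0 = 0.
Proof.
move=> n0 [e1 e2]; split.
  move=> i j; move/eqP: e1; rewrite mulmxBl mul1mx kirchhoffM subr_eq0 => /eqP e.
  by rewrite e !mxE.
move: e2; rewrite mul0mx subr0 kirchhoffM => /colP /(_ (Ordinal n0)); rewrite !mxE => /eqP.
by rewrite mulf_eq0 invr_eq0 (negbTE (natC_neq0 n0)) => /eqP.
Qed.

Lemma const_kirchhoff n (u : 'cV[C]_n) : (0 < n)%N -> (forall i j, u i 0 = u j 0) ->
  (1%:M - kirchhoff_proj R n) *m u = 0.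
Proof.
move=> n0 e; rewrite mulmxBl mul1mx kirchhoffM; apply/colP => i; rewrite !mxE.
rewrite (eq_bigr (fun=> u i 0)); last by move=> j _; exact: e.
by rewrite sumr_const card_ord -[u i 0 *+ n]mulr_natl mulKf ?natC_neq0// subrr.
Qed.

Section Ends.
Variables (E V : finType) (endpt : E * bool -> V).

Lemma sum_ends (X : E * bool -> C) :
  \sum_h X h = \sum_v \sum_(i < degree endpt v) X (enum_val i).
Proof.
rewrite (partition_big endpt predT)//=; apply: eq_bigr => v _.
transitivity (\sum_(h in ends endpt v) X h); last exact: big_enum_val.
by apply: eq_bigl => h; rewrite inE.
Qed.

Lemma sum_conn n (c : 'I_n -> V) (F : V -> C) : injective c ->
  \sum_v F v = \sum_j F (c j) + \sum_(v | v \notin codom c) F v.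
Proof.
move=> ic; rewrite (bigID (mem (codom c)))/=; congr (_ + _).
rewrite -big_uniq; last by rewrite map_inj_uniq ?enum_uniq.
by rewrite big_map big_enum.
Qed.

Variables (n : nat) (c : 'I_n -> V).
Hypothesis ic : injective c.

(** Flattens residual vectors, whose dimensions depend on the vertex, into one scalar per edge end.
    Exactly one summand survives, the position of [h] at its own vertex; the sums avoid casts
    between dependent dimensions. Connecting vertices have a separate family because they are
    indexed by outer edges. *)
Definition spread (Yc : forall j, 'I_(degree endpt (c j)) -> C)
    (Yv : forall v, 'I_(degree endpt v) -> C) (h : E * bool) : C :=
  \sum_j \sum_(i | enum_val i == h) Yc j i +
  \sum_(v | v \notin codom c) \sum_(i | enum_val i == h) Yv v i.

Lemma endpt_enum v (i : 'I_(degree endpt v)) : endpt (enum_val i) = v.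
Proof. by have := enum_valP i; rewrite inE => /eqP. Qed.

Lemma spread_conn Yc Yv j i : spread Yc Yv (enum_val i) = Yc j i.
Proof.
rewrite /spread [X in _ + X]big1 ?addr0; last first.
  move=> v vc; rewrite big1// => k /eqP e; case/negP: vc.
  by rewrite -(endpt_enum k) e endpt_enum codom_f.
rewrite (bigD1 j)//= [X in _ + X]big1 ?addr0; last first.
  move=> j' jj'; rewrite big1// => k /eqP e; case/negP: jj'.
  by apply/eqP/ic; rewrite -(endpt_enum k) e endpt_enum.
by apply: big_pred1 => k; apply/eqP/eqP => [/enum_val_inj|->].
Qed.

Lemma spread_vert Yc Yv v i : v \notin codom c -> spread Yc Yv (enum_val i) = Yv v i.
Proof.
move=> vc; rewrite /spread [X in X + _]big1 ?add0r; last first.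
  move=> j _; rewrite big1// => k /eqP e; case/negP: vc.
  by rewrite -(endpt_enum i) -e endpt_enum codom_f.
rewrite (bigD1 v)//= [X in _ + X]big1 ?addr0; last first.
  move=> v' /andP[_ vv']; rewrite big1// => k /eqP e; case/negP: vv'.
  by rewrite -(endpt_enum k) e endpt_enum.
by apply: big_pred1 => k; apply/eqP/eqP => [/enum_val_inj|->].
Qed.

Lemma spread0P Yc Yv : (forall h, spread Yc Yv h = 0) <->
  (forall j i, Yc j i = 0) /\ (forall v i, v \notin codom c -> Yv v i = 0).
Proof.
split=> [h|[h1 h2] h]; first split.
- by move=> j i; rewrite -(spread_conn Yc Yv).
- by move=> v i vc; rewrite -(spread_vert Yc Yv).
rewrite /spread big1 ?add0r ?big1// => [v vc|j _]; rewrite big1// => i _.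
exact: h2.
Qed.

Lemma spread_lin a Yc Yv Zc Zv h :
  spread (fun j i => a * Yc j i + Zc j i) (fun v i => a * Yv v i + Zv v i) h =
  a * spread Yc Yv h + spread Zc Zv h.
Proof.
rewrite /spread mulrDr addrACA; congr (_ + _).
  rewrite mulr_sumr -big_split /=; apply: eq_bigr => j _.
  by rewrite mulr_sumr -big_split.
rewrite mulr_sumr -big_split /=; apply: eq_bigr => j _.
by rewrite mulr_sumr -big_split.
Qed.

Lemma spread_n1 Yc Yv h (M : R) : 0 <= M -> (forall j i, n1 (Yc j i) <= M) ->
  (forall v i, v \notin codom c -> n1 (Yv v i) <= M) -> n1 (spread Yc Yv h) <= M.
Proof.
move=> M0 h1 h2.
have [i <-] : exists i : 'I_(degree endpt (endpt h)), enum_val i = h.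
  have hin : h \in ends endpt (endpt h) by rewrite inE.
  by exists (enum_rank_in hin h); rewrite enum_rankK_in.
have [/codomP[j e]|vc] := boolP (endpt h \in codom c).
  move: i; rewrite e => i; rewrite spread_conn; exact: h1.
by rewrite spread_vert//; exact: h2.
Qed.

Variable len : E -> R.

Definition bderiv (psi1 : gfun R E) (h : E * bool) : C :=
  if h.2 then - end_value len psi1 h else end_value len psi1 h.

Lemma bvalues_lin a psi chi v : bvalues endpt len (gaxpy a psi chi) v =
  a *: bvalues endpt len psi v + bvalues endpt len chi v.
Proof. by apply/colP => i; rewrite !mxE. Qed.

Lemma bderivs_lin a psi chi v : bderivs endpt len (gaxpy a psi chi) v =
  a *: bderivs endpt len psi v + bderivs endpt len chi v.
Proof.
apply/colP => i; rewrite !mxE /end_value /gaxpy.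
by case: ((enum_val i).2) => //; rewrite mulrN opprD.
Qed.

Lemma cdot_bvalues (psi chi1 : gfun R E) v :
  cdot (bvalues endpt len psi v) (bderivs endpt len chi1 v) =
  \sum_(i < degree endpt v) (end_value len psi (enum_val i))^* * bderiv chi1 (enum_val i).
Proof. by apply: eq_bigr => i _; rewrite !mxE. Qed.

Lemma cdot_bderivs (psi1 chi : gfun R E) v :
  cdot (bderivs endpt len psi1 v) (bvalues endpt len chi v) =
  \sum_(i < degree endpt v) (bderiv psi1 (enum_val i))^* * end_value len chi (enum_val i).
Proof. by apply: eq_bigr => i _; rewrite !mxE. Qed.

Lemma sum_ends_pair (X : E * bool -> C) : \sum_h X h = \sum_e (X (e, false) + X (e, true)).
Proof.
rewrite (eq_bigr (fun h : E * bool => X (h.1, h.2))); last by case.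
rewrite -(pair_bigA _ (fun e b => X (e, b))) /=; apply: eq_bigr => e _.
by rewrite big_bool addrC.
Qed.

End Ends.
End VertexConditions.

Section InnerForms.
Variables (R : realType) (E V : finType) (endpt : E * bool -> V) (len : E -> R).
Local Notation C := R[i].
Local Notation cIm := (@complex.Im R).

(** Boundary terms produced edge by edge are regrouped by vertices; the sign at the far end of an
    edge is absorbed by the outgoing derivative. *)
Lemma inner_form (phi phi1 u u1 : gfun R E) :
  \sum_e (((phi e 0)^* * u1 e 0 - (phi1 e 0)^* * u e 0) -
          ((phi e (len e))^* * u1 e (len e) - (phi1 e (len e))^* * u e (len e))) =
  \sum_v (cdot (bvalues endpt len phi v) (bderivs endpt len u1 v) -
          cdot (bderivs endpt len phi1 v) (bvalues endpt len u v)).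
Proof.
have E1 : \sum_v cdot (bvalues endpt len phi v) (bderivs endpt len u1 v) =
    \sum_h (end_value len phi h)^* * bderiv len u1 h.
  by rewrite (sum_ends endpt); apply: eq_bigr => v _; rewrite cdot_bvalues.
have E2 : \sum_v cdot (bderivs endpt len phi1 v) (bvalues endpt len u v) =
    \sum_h (bderiv len phi1 h)^* * end_value len u h.
  by rewrite (sum_ends endpt); apply: eq_bigr => v _; rewrite cdot_bderivs.
rewrite [RHS]sumrB E1 E2 !sum_ends_pair -sumrB; apply: eq_bigr => e _.
rewrite /bderiv /end_value /=.
by case: (phi1 e (len e)) => a b; apply: cext; rewrite !cReE /=; ring.
Qed.

Lemma inner_wronsk (psi psi1 : gfun R E) :
  \sum_e (wronsk (psi e) (psi1 e) 0 - wronsk (psi e) (psi1 e) (len e)) =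
  cIm (\sum_v cdot (bvalues endpt len psi v) (bderivs endpt len psi1 v)).
Proof.
have -> : \sum_v cdot (bvalues endpt len psi v) (bderivs endpt len psi1 v) =
    \sum_h (end_value len psi h)^* * bderiv len psi1 h.
  by rewrite (sum_ends endpt); apply: eq_bigr => v _; rewrite cdot_bvalues.
rewrite sum_ends_pair cIm_sum; apply: eq_bigr => e _.
by rewrite /wronsk /bderiv /end_value /= !cReE; ring.
Qed.

End InnerForms.

Lemma selfadjoint_scale (R : realType) n (c : R) (P Th : 'M[R[i]]_n) :
  selfadjoint_in P Th -> selfadjoint_in P (c%:C *: Th).
Proof.
move=> [e1 e2]; split; first by rewrite -scalemxAr -scalemxAl e1.
apply/matrixP => i j; have /matrixP /(_ i j) := e2; rewrite !mxE => e3.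
rewrite -[in RHS]e3 /= conj_conjc; apply: cext; rewrite !cReE /=; ring.
Qed.

Lemma vertex_cond0E (R : realType) n (P : 'M[R[i]]_n) u u1 : orth_projection P ->
  vertex_cond P 0 u u1 <-> vres P 0 u u1 = 0.
Proof. by move=> oP; apply: vertex_condE => //; exact: selfadjoint0. Qed.

Lemma colvec1 (R : realType) (v : 'cV[R[i]]_1) : v 0 0 = 0 -> v = 0.
Proof. by move=> e; apply/colP => i; rewrite ord1 mxE e. Qed.

Lemma mx_linE (R : realType) m n (a : R[i]) (A B : 'M[R[i]]_(m, n)) i j :
  (a *: A + B) i j = a * A i j + B i j.
Proof. by rewrite mxE [(a *: A) i j]mxE. Qed.

(** * The full and outer Hamiltonians as instances of the abstract solvability result *)

Section Operators.
Variables (R : realType) (N : nat) (G : qgraph R N).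
Local Notation C := R[i].
Local Notation cIm := (@complex.Im R).
Local Notation IE := ('I_N + iedge G)%type.

Lemma fedges_gt0 eps : 0 < eps -> forall (i : IE) a, fedges eps i = Some a -> 0 < a.
Proof.
move=> e0 [j|e] a /=; first exact: olen_gt0.
by move=> [<-]; rewrite mulr_gt0// ilen_gt0.
Qed.

Lemma inner_scale eps (e : iedge G) x : 0 < eps -> edge (iedges_eps eps e) x ->
  edge (iedges G e) (x / eps).
Proof.
move=> e0 /= /andP[x0 xe]; rewrite /= divr_ge0 ?(ltW e0)//=.
by rewrite ler_pdivrMr// mulrC.
Qed.

Lemma Bfull_meas eps : 0 < eps -> forall i : IE,
  measurable_fun (edge (fedges eps i)) (Bfull_eps eps i).
Proof.
move=> e0 [j|e]; first exact: (@Bout_meas _ _ G j).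
apply: measurable_funM; first exact: measurable_cst.
apply: (measurable_comp (measurable_edge (iedges G e))).
- by move=> _ [x lx <-]; exact: inner_scale.
- exact: (@Bin_meas _ _ G e).
- by apply: measurable_funM => //; exact: measurable_cst.
Qed.

Lemma potential_bounds : exists M : R, (forall j x, edge (olen G j) x -> `|Bout G j x| <= M) /\
  (forall e x, edge (iedges G e) x -> `|Bin G e x| <= M).
Proof.
have [M1 h1] := Bout_bounded G; have [M2 h2] := Bin_bounded G.
exists (Num.max M1 M2); split => i x lx; rewrite le_max.
  by rewrite h1.
by rewrite h2 ?orbT.
Qed.

Lemma Bfull_le eps : 0 < eps -> exists M : R, forall (i : IE) x,
  edge (fedges eps i) x -> `|Bfull_eps eps i x| <= M.
Proof.
move=> e0; have [M [h1 h2]] := potential_bounds.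
exists (Num.max M (eps ^- 2 * M)) => -[j|e] x lx; rewrite le_max.
  by rewrite /= h1.
apply/orP; right; rewrite /= /Bin_eps normrM ger0_norm ?invr_ge0 ?sqr_ge0//.
rewrite ler_wpM2l ?invr_ge0 ?sqr_ge0// h2//; exact: inner_scale.
Qed.

Lemma Bfull_cpt eps : exists r : R, forall (i : IE) x, fedges eps i = None -> 0 <= x -> r < x ->
  Bfull_eps eps i x = 0.
Proof.
have [r hr] := Bout_compact G; exists r => -[j|e] x //= lj x0 rx.
by apply: hr => //; rewrite lj.
Qed.

Section Full.
Variable eps : R.
Hypothesis eps0 : 0 < eps.
Local Notation deg j := (degree (iend G) (conn G j)).

Definition bc_full (psi psi1 : gfun R IE) : Prop :=
  [/\ bc_Vin_eps eps (finner psi) (finner psi1),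
      bc_Vout G (fouter psi) (fouter psi1) & bc_conn_eps eps psi psi1].

Definition vres_conn (psi psi1 : gfun R IE) j : 'cV[C]_(deg j + 1) :=
  vres (kirchhoff_proj R (deg j + 1)) 0
    (col_mx (bvalues (iend G) (ilens eps) (finner psi) (conn G j))
            (const_mx (fouter psi j 0)))
    (col_mx (bderivs (iend G) (ilens eps) (finner psi1) (conn G j))
            (const_mx (fouter psi1 j 0))).

Definition vres_vert (psi psi1 : gfun R IE) v : 'cV[C]_(degree (iend G) v) :=
  vres (Pin G v) ((eps^-1)%:C *: Thetain G v)
    (bvalues (iend G) (ilens eps) (finner psi) v)
    (bderivs (iend G) (ilens eps) (finner psi1) v).

Definition vres_out (psi psi1 : gfun R 'I_N) j : 'cV[C]_1 :=
  if olen G j is Some a then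
    vres (Pout G j) (Thetaout G j) (const_mx (psi j a)) (const_mx (- psi1 j a))
  else 0.

(** A connecting vertex yields one residual more than it has inner ends. The last one is attached to
    the origin of the outer edge, the others to the inner ends; the far end of a finite outer edge
    carries its own vertex condition. *)
Definition res_full (psi psi1 : gfun R IE) (h : IE * bool) : C :=
  match h.1 with
  | inl j => if h.2 then vres_out (fouter psi) (fouter psi1) j 0 0
             else vres_conn psi psi1 j (rshift (deg j) 0) 0
  | inr e => @spread R _ _ (iend G) N (conn G) (fun j i => vres_conn psi psi1 j (lshift 1 i) 0)
                (fun v i => vres_vert psi psi1 v i 0) (e, h.2)
  end.

Lemma const_mx_lin m n (a b c : C) :
  (const_mx (a * b + c) : 'M[C]_(m, n)) = a *: const_mx b + const_mx c.
Proof. by apply/matrixP => i j; rewrite !mxE. Qed.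

Lemma vres_out_lin a psi psi1 chi chi1 j :
  vres_out (gaxpy a psi chi) (gaxpy a psi1 chi1) j =
  a *: vres_out psi psi1 j + vres_out chi chi1 j.
Proof.
rewrite /vres_out; case: (olen G j) => [b|]; last by rewrite scaler0 addr0.
rewrite -vres_lin /gaxpy; congr vres; first exact: const_mx_lin.
by rewrite -const_mx_lin mulrN opprD.
Qed.

Lemma vres_conn_lin a psi psi1 chi chi1 j :
  vres_conn (gaxpy a psi chi) (gaxpy a psi1 chi1) j =
  a *: vres_conn psi psi1 j + vres_conn chi chi1 j.
Proof.
rewrite -vres_lin; congr vres; rewrite scale_col_mx add_col_mx; congr col_mx.
- exact: (bvalues_lin (iend G) (ilens eps) a (finner psi) (finner chi)).
- exact: const_mx_lin.
- exact: (bderivs_lin (iend G) (ilens eps) a (finner psi1) (finner chi1)).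
- exact: const_mx_lin.
Qed.

Lemma vres_vert_lin a psi psi1 chi chi1 v :
  vres_vert (gaxpy a psi chi) (gaxpy a psi1 chi1) v =
  a *: vres_vert psi psi1 v + vres_vert chi chi1 v.
Proof.
rewrite -vres_lin; congr vres.
  exact: (bvalues_lin (iend G) (ilens eps) a (finner psi) (finner chi)).
exact: (bderivs_lin (iend G) (ilens eps) a (finner psi1) (finner chi1)).
Qed.

Lemma res_full_lin h : linear_res (fun psi psi1 => res_full psi psi1 h).
Proof.
move=> a psi psi1 chi chi1; rewrite /res_full; case: h => -[j|e] b /=.
  case: b.
    rewrite (_ : fouter (gaxpy a psi chi) = gaxpy a (fouter psi) (fouter chi))//.
    rewrite (_ : fouter (gaxpy a psi1 chi1) = gaxpy a (fouter psi1) (fouter chi1))//.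
    by rewrite vres_out_lin mx_linE.
  by rewrite vres_conn_lin mx_linE.
rewrite -spread_lin; congr spread.
  by apply: functional_extensionality_dep => j; apply/funext => i; rewrite vres_conn_lin mx_linE.
by apply: functional_extensionality_dep => v; apply/funext => i; rewrite vres_vert_lin mx_linE.
Qed.

Lemma kirchhoff_full_orth j : orth_projection (kirchhoff_proj R (deg j + 1)).
Proof. by apply: kirchhoff_orth; rewrite addn1. Qed.

Lemma vres_outP psi psi1 : bc_Vout G psi psi1 <-> forall j, olen G j <> None -> vres_out psi psi1 j = 0.
Proof.
rewrite /vres_out; split=> [h j|h j a lj].
  case lj : (olen G j) => [a|] // _; have nj : olen G j <> None by rewrite lj.
  by apply/vertex_condE; [exact: Pout_proj|exact: Thetaout_sa|exact: h].
have nj : olen G j <> None by rewrite lj.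
have := h j nj; rewrite lj => e.
by apply/vertex_condE; [exact: Pout_proj|exact: Thetaout_sa|].
Qed.

Lemma bc_fullE psi psi1 : bc_full psi psi1 <->
  forall h, actual_end (fedges (G := G) eps) h -> res_full psi psi1 h = 0.
Proof.
split.
  move=> [bcv bco bcc].
  have hc j : vres_conn psi psi1 j = 0.
    by apply/vertex_cond0E; [exact: kirchhoff_full_orth|exact: bcc].
  have hv v : v \notin codom (conn G) -> vres_vert psi psi1 v = 0.
    move=> vc; apply/vertex_condE; [exact: Pin_proj|exact/selfadjoint_scale/Thetain_sa|exact: bcv].
  move=> [[j|e] b] /=; rewrite /res_full /=.
    case: b => [|_]; last by rewrite hc mxE.
    rewrite /actual_end /= => /eqP nj.
    by have /vres_outP -> := bco; rewrite ?mxE.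
  move=> _; move: (e, b).
  by apply/spread0P; [exact: conn_inj|split => [j i|v i vc]; rewrite ?hc ?hv// mxE].
move=> h.
have [h1 h2] : (forall j i, vres_conn psi psi1 j (lshift 1 i) 0 = 0) /\
    (forall v i, v \notin codom (conn G) -> vres_vert psi psi1 v i 0 = 0).
  apply/(spread0P (conn_inj (q := G))) => -[e b]; by apply: (h (inr e, b)); rewrite /actual_end /= andbF.
split.
- move=> v vc; apply/vertex_condE; [exact: Pin_proj|exact/selfadjoint_scale/Thetain_sa|].
  by apply/colP => i; rewrite [RHS]mxE; exact: h2.
- apply/vres_outP => j nj; apply: colvec1; apply: (h (inl j, true)).
  by rewrite /actual_end /=; apply/eqP.
- move=> j; apply/vertex_cond0E; first exact: kirchhoff_full_orth.
  apply/colP => i; rewrite [RHS]mxE -(splitK i); case: (fintype.split i) => k /=; first exact: h1.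
  by rewrite ord1; exact: (h (inl j, false) isT).
Qed.

Lemma out_end_zero psi psi1 j : bc_Vout G psi psi1 ->
  end_term (olen G j) (wronsk (psi j) (psi1 j)) = 0.
Proof.
move=> bco; case lj : (olen G j) => [a|] //=.
have nj : olen G j <> None by rewrite lj.
have := vertex_real (Pout_proj nj) (Thetaout_sa nj) (bco j a lj).
by rewrite cdot_const mul1r /wronsk !cReE => e; lra.
Qed.

(** The boundary term of outer edge [j] at the origin completes the inner terms at [conn G j] to the
    scalar product of the full vectors there, which is real by the Kirchhoff condition. Every other
    vertex contributes a real number by itself. *)
Lemma bc_full_sym psi psi1 : bc_full psi psi1 -> bform (fedges (G := G) eps) psi psi1 = 0.
Proof.
move=> [bcv bco bcc]; rewrite /bform big_sumType /=.
rewrite [X in _ + X](inner_wronsk (iend G) (ilens eps) (finner psi) (finner psi1)).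
rewrite (sum_conn _ (conn_inj (q := G))) cImD !cIm_sum [X in _ + (_ + X)]big1 ?addr0; last first.
  move=> v vc; apply: vertex_real (bcv v vc); first exact: Pin_proj.
  exact/selfadjoint_scale/Thetain_sa.
rewrite -big_split /= big1// => j _.
rewrite (out_end_zero j bco) subr0.
have := vertex_real (kirchhoff_full_orth j) (selfadjoint0 _) (bcc j).
by rewrite cdot_col cdot_const mul1r cImD addrC.
Qed.

Lemma Hfull_resolvent_set z : cIm z != 0 -> resolvent_set (fedges (G := G) eps) (@Hfull R N G eps) z.
Proof.
move=> z0; have [M hM] := Bfull_le eps0; have [r hr] := Bfull_cpt eps.
exact: (schrodinger_resolvent_set (fedges_gt0 eps0) (Bfull_meas eps0) hM hr z0
  res_full_lin bc_fullE bc_full_sym).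
Qed.

End Full.

Section OutHat.
Variable P : 'M[C]_N.
Hypothesis oP : orth_projection P.

Definition bc_hat (psi psi1 : gfun R 'I_N) : Prop :=
  bc_Vout G psi psi1 /\ vertex_cond P 0 (values0 psi) (values0 psi1).

Definition res_hat (psi psi1 : gfun R 'I_N) (h : 'I_N * bool) : C :=
  if h.2 then vres_out psi psi1 h.1 0 0 else vres P 0 (values0 psi) (values0 psi1) h.1 0.

Lemma values0_lin a (psi chi : gfun R 'I_N) : values0 (gaxpy a psi chi) = a *: values0 psi + values0 chi.
Proof. by apply/colP => i; rewrite !mxE. Qed.

Lemma res_hat_lin h : linear_res (fun psi psi1 => res_hat psi psi1 h).
Proof.
move=> a psi psi1 chi chi1; rewrite /res_hat; case: h.2; first by rewrite vres_out_lin mx_linE.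
by rewrite !values0_lin vres_lin mx_linE.
Qed.

Lemma bc_hatE psi psi1 : bc_hat psi psi1 <->
  forall h, actual_end (olen G) h -> res_hat psi psi1 h = 0.
Proof.
split.
  move=> [bco bc0] [j [|]] /=; rewrite /actual_end /res_hat /=.
    by move=> /eqP nj; have /vres_outP -> := bco; rewrite ?mxE.
  by move=> _; move/vertex_cond0E: bc0 => ->//; rewrite mxE.
move=> h; split.
  apply/vres_outP => j nj; apply: colvec1; apply: (h (j, true)).
  by rewrite /actual_end /=; apply/eqP.
by apply/vertex_cond0E => //; apply/colP => j; rewrite [RHS]mxE; exact: (h (j, false) isT).
Qed.

Lemma values0_wronsk (psi psi1 : gfun R 'I_N) :
  \sum_j wronsk (psi j) (psi1 j) 0 = cIm (cdot (values0 psi) (values0 psi1)).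
Proof. by rewrite cIm_sum; apply: eq_bigr => j _; rewrite !mxE. Qed.

(** Only the conditions at the far ends are used, so the formula also serves for differences of
    functions that violate the condition at the origin. *)
Lemma bform_out psi psi1 : bc_Vout G psi psi1 ->
  bform (olen G) psi psi1 = cIm (cdot (values0 psi) (values0 psi1)).
Proof.
move=> bco; rewrite -values0_wronsk; apply: eq_bigr => j _.
by rewrite (out_end_zero j bco) subr0.
Qed.

Lemma bc_hat_sym psi psi1 : bc_hat psi psi1 -> bform (olen G) psi psi1 = 0.
Proof.
move=> [bco bc0]; rewrite bform_out//; exact: vertex_real (selfadjoint0 _) bc0.
Qed.

Lemma Hout_hat_resolvent_set z : cIm z != 0 -> resolvent_set (olen G) (Hout_hat G P) z.
Proof.
move=> z0; have [M [hM _]] := potential_bounds; have [r hr] := Bout_compact G.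
apply: (schrodinger_resolvent_set (@olen_gt0 _ _ G) (@Bout_meas _ _ G) hM (r := r) _ z0
  res_hat_lin bc_hatE bc_hat_sym).
by move=> j x lj x0 rx; apply: hr => //; rewrite lj.
Qed.

End OutHat.

Lemma Hout_hat0 : Hout_hat G 0 = Hout_ring G.
Proof.
apply/funext => psi; apply/funext => eta; apply/propext.
have key psi0 psi1 : (bc_Vout G psi0 psi1 /\ vertex_cond 0 0 (values0 psi0) (values0 psi1)) <->
   (bc_Vout G psi0 psi1 /\ values0 psi0 = 0) :> Prop.
  by split => -[h1]; [move=> [e _]|move=> e]; split => //; move: e;
    rewrite /vertex_cond subr0 mul1mx// => ->; rewrite !mul0mx subrr.
by split => -[psi1 [psi2 [h1 h2 h3]]]; exists psi1, psi2; split => //; apply/key.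
Qed.

End Operators.

(** * Dilations *)

Section Scaling.
Variable R : realType.
Local Notation leb := (@lebesgue_measure R).
Local Notation integ D f := (leb.-integrable D (EFin \o f)).
Local Notation C := R[i].
Implicit Types (D : set R) (f : R -> R).

Section Factor.
Variable s : R.
Hypothesis s0 : 0 < s.

Let dil : measurableTypeR R -> measurableTypeR R := *%R s.

Let mdil : measurable_fun setT dil.
Proof. exact: mulrl_measurable. Qed.

Let sn : {nonneg R} := NngNum (ltW s0).

Let pf : {measure set (measurableTypeR R) -> \bar R}.
Proof. refine (pushforward leb dil : measure _ _); exact: mdil. Defined.

Lemma dil_preimage (a : R) : (fun x => s * x) @^-1` (edge (Some (s * a))) = edge (Some a).
Proof.
apply/seteqP; split=> x /=.
  by rewrite pmulr_rge0 // ler_pM2l.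
by rewrite pmulr_rge0 // ler_pM2l.
Qed.

(** Lebesgue measure is determined by its values on half-open intervals; the preimage of []a, b]]
    under the dilation has length [(b - a) / s], which the factor [s] restores. *)
Lemma lebesgue_measure_dil (A : set R) : measurable A -> leb A = mscale sn pf A.
Proof.
move=> mA; apply: lebesgue_measure_unique => //= _ [[a b]] _ <-.
change (leb `]a, b] = (s%:E * leb (dil @^-1` `]a, b]%classic))%E).
have -> : dil @^-1` `]a, b]%classic = `](a / s), (b / s)]%classic.
  apply/seteqP; split=> x /=; rewrite !in_itv /= /dil /=.
    by rewrite ltr_pdivrMr // ler_pdivlMr // !(mulrC x).
  by rewrite ltr_pdivrMr // ler_pdivlMr // !(mulrC x).
rewrite !lebesgue_measure_itv /= !lte_fin ltr_pM2r ?invr_gt0 //.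
case: ifP => _; last by rewrite mule0.
by rewrite -EFinB -EFinM; congr (_%:E); field; rewrite gt_eqF.
Qed.

Lemma ge0_integral_dil D (f : R -> \bar R) : measurable D -> measurable_fun D f ->
  (forall x, D x -> (0 <= f x)%E) ->
  (\int[leb]_(x in D) f x = s%:E * \int[leb]_(x in (fun x => s * x)%R @^-1` D) f (s * x)%R)%E.
Proof.
move=> mD mf f0.
rewrite (eq_measure_integral (mscale sn pf)); last first.
  by move=> A mA _; exact: lebesgue_measure_dil.
rewrite ge0_integral_mscale //; congr (_ * _)%E.
have f0' : {in D, forall y : measurableTypeR R, (0 <= f y)%E} by move=> y; rewrite inE; exact: f0.
have H := @ge0_integral_pushforward _ _ (measurableTypeR R) (measurableTypeR R) R dil mdil lebesgue_measure D f mD mf f0'.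
transitivity (\int[pushforward leb dil]_(y in D) f y)%E; first by [].
rewrite H. reflexivity.
Qed.

Lemma measurable_preimage_dil D : measurable D -> measurable ((fun x => s * x) @^-1` D).
Proof. by move=> mD; rewrite -[X in measurable X]setTI; exact: mdil. Qed.

Lemma meas_dil D f : measurable D -> measurable_fun D f ->
  measurable_fun ((fun x => s * x) @^-1` D) (fun x => f (s * x)).
Proof.
move=> mD mf; apply: (measurable_comp mD) => //; by move=> _ [x Dx <-].
Qed.

Lemma integ_dil D f : measurable D -> integ D f ->
  integ ((fun x => s * x) @^-1` D) (fun x => f (s * x)).
Proof.
move=> mD iF; have mf := integ_meas iF.
apply/integrableP; split; first by apply/measurable_EFinP; exact: (meas_dil mD mf).
have /integrableP[_] := iF; rewrite ge0_integral_dil //; last first.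
  exact/measurableT_comp/measurable_EFinP.
move=> H.
have : (s^-1%:E * (s%:E * \int[leb]_(x in (fun x => s * x)%R @^-1` D) `|(f (s * x)%R)%:E|) < +oo)%E.
  by apply: lte_mul_pinfty => //; rewrite lee_fin invr_ge0 ltW.
by rewrite muleA -EFinM mulVf ?gt_eqF // mul1e.
Qed.

Lemma Rint_dil D f : measurable D -> integ D f ->
  \int[leb]_(x in D) f x = s * \int[leb]_(x in (fun x => s * x) @^-1` D) f (s * x).
Proof.
move=> mD iF.
have ge0 g : integ D g -> (forall x, 0 <= g x) ->
    \int[leb]_(x in D) g x = s * \int[leb]_(x in (fun x => s * x) @^-1` D) g (s * x).
  move=> ig g0; apply: EFin_inj; rewrite EFinM -!EFin_Rint //; first last.
  - exact: integ_dil.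
  - exact: measurable_preimage_dil.
    apply: (ge0_integral_dil (f := EFin \o g)) => //; last by move=> x _; rewrite /= lee_fin.
    by apply/measurable_EFinP; exact: integ_meas ig.
have iN := integ_norm iF.
have mD' := measurable_preimage_dil mD; have iF' := integ_dil mD iF.
(* An integrable [g] is the difference of the nonnegative functions [g + |g|] and [|g|], for which
   the formula is already known. *)
have split_abs D' g : measurable D' -> integ D' g -> \int[leb]_(x in D') g x =
    \int[leb]_(x in D') (g x + `|g x|) - \int[leb]_(x in D') `|g x|.
  move=> mD0 ig; rewrite -RintegralB //; last 2 first.
  - exact: integD mD0 ig (integ_norm ig).
  - exact: integ_norm ig.
  by apply: Rint_ext => x _; rewrite addrK.
rewrite (split_abs D f) // (split_abs _ (fun x => f (s * x))) // mulrBr; congr (_ - _).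
  apply: (ge0 (fun x => f x + `|f x|)); first exact: integD.
  by move=> x; have := ler_norm (- f x); rewrite normrN; lra.
by apply: (ge0 (fun x => `|f x|)).
Qed.

Variable a : R.

Lemma integ_dil_edge f : integ (edge (Some (s * a))) f ->
  integ (edge (Some a)) (fun x => f (s * x)).
Proof. by move=> /(integ_dil (measurable_edge _)); rewrite dil_preimage. Qed.

Lemma Rint_dil_edge f : integ (edge (Some (s * a))) f ->
  \int[leb]_(x in edge (Some (s * a))) f x = s * \int[leb]_(x in edge (Some a)) f (s * x).
Proof. by move=> iF; rewrite (Rint_dil (measurable_edge _) iF) dil_preimage. Qed.

Lemma meas_dil_edge f : measurable_fun (edge (Some (s * a))) f ->
  measurable_fun (edge (Some a)) (fun x => f (s * x)).
Proof. by move=> /(meas_dil (measurable_edge _)); rewrite dil_preimage. Qed.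

Lemma sqint_dil f : sqint (edge (Some (s * a))) f -> sqint (edge (Some a)) (fun x => f (s * x)).
Proof. by move=> [mf iF]; split; [exact: meas_dil_edge|exact: integ_dil_edge iF]. Qed.

Lemma csq_dil (f : R -> C) : csq (edge (Some (s * a))) f ->
  csq (edge (Some a)) (fun x => f (s * x)).
Proof. by move=> [f1 f2]; split; [exact: sqint_dil f1|exact: sqint_dil f2]. Qed.

Lemma cintegral_dil (f : R -> C) : cint (edge (Some (s * a))) f ->
  cintegral (edge (Some (s * a))) f = s%:C * cintegral (edge (Some a)) (fun x => f (s * x)).
Proof.
move=> [f1 f2]; apply: cext; rewrite ?cReE /= mul0r ?subr0 ?addr0.
  exact: Rint_dil_edge f1.
exact: Rint_dil_edge f2.
Qed.

Lemma dil_edge x : edge (Some a) x -> edge (Some (s * a)) (s * x).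
Proof. by rewrite -{1}dil_preimage. Qed.

End Factor.

Lemma prim_dil (s a : R) f f1 : 0 < s -> prim (Some (s * a)) f f1 ->
  prim (Some a) (fun x => f (s * x)) (fun x => s * f1 (s * x)).
Proof.
move=> s0 [i1 e1].
have I1 x : edge (Some a) x -> integ (edge (Some (s * x))) f1.
  by move=> /(dil_edge s0) /i1; rewrite -edge_Some.
split=> x ax; rewrite -edge_Some.
  by apply: integZ; [exact: measurable_edge|exact: integ_dil_edge (I1 _ ax)].
rewrite mulr0 (e1 _ (dil_edge s0 ax)) -edge_Some (Rint_dil_edge s0 (I1 _ ax)).
by rewrite RintegralZl //; [exact: measurable_edge|exact: integ_dil_edge (I1 _ ax)].
Qed.

Lemma cprim_dil (s a : R) (f f1 : R -> C) : 0 < s -> cprim (Some (s * a)) f f1 ->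
  cprim (Some a) (fun x => f (s * x)) (fun x => s%:C * f1 (s * x)).
Proof.
move=> s0 [p1 p2]; split.
  apply: prim_ext (prim_dil s0 p1) => // x _ /=.
  by rewrite cReE /= mul0r subr0.
apply: prim_ext (prim_dil s0 p2) => // x _ /=.
by rewrite cReE /= mul0r addr0.
Qed.

End Scaling.

(** * The inner problem at energy zero *)

Section Bounds.
Variable R : realType.
Local Notation C := R[i].

Lemma le_sum_term (I : finType) (f : I -> R) i : (forall i, 0 <= f i) -> f i <= \sum_i f i.
Proof. by move=> f0; rewrite (bigD1 i) //= lerDl sumr_ge0. Qed.

Lemma mulmx_n1 m n (A : 'M[C]_(m, n)) : exists2 a, 0 <= a & forall (u : 'cV[C]_n) M,
  0 <= M -> (forall j, n1 (u j 0) <= M) -> forall i, n1 ((A *m u) i 0) <= a * M.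
Proof.
exists (\sum_i \sum_j n1 (A i j)).
  by apply: sumr_ge0 => i _; apply: sumr_ge0 => j _; exact: n1_ge0.
move=> u M M0 uM i.
rewrite mxE; apply: (le_trans (n1_sum _ _ _)).
apply: (@le_trans _ _ (\sum_j n1 (A i j) * M)).
  apply: ler_sum => j _; apply: (le_trans (n1M _ _)).
  by rewrite ler_wpM2l ?n1_ge0.
rewrite -mulr_suml ler_wpM2r //.
apply: (le_sum_term (f := fun i => \sum_j n1 (A i j))) => k.
by apply: sumr_ge0 => j _; exact: n1_ge0.
Qed.

Lemma vres_n1 n (P Th : 'M[C]_n) : exists2 a, 0 <= a & forall (u u1 : 'cV[C]_n) M,
  (forall j, n1 (u j 0) <= M) -> (forall j, n1 (u1 j 0) <= M) ->
  forall i, n1 (vres P Th u u1 i 0) <= a * M.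
Proof.
have [a a0 Ha] := mulmx_n1 (1%:M - P - Th *m P); have [b b0 Hb] := mulmx_n1 P.
exists (a + b); first exact: addr_ge0.
move=> u u1 M uM u1M i; have M0 : 0 <= M by apply: le_trans (uM i); exact: n1_ge0.
have -> : vres P Th u u1 = (1%:M - P - Th *m P) *m u + P *m u1.
  by rewrite /vres !mulmxBl mulmxA addrA addrAC.
rewrite mxE mulrDl; apply: (le_trans (n1D _ _)).
by apply: lerD; [exact: Ha|exact: Hb].
Qed.

End Bounds.

Section InnerProblem.
Variables (R : realType) (N : nat) (G : qgraph R N).
Local Notation leb := (@lebesgue_measure R).
Local Notation C := R[i].
Local Notation IG := (gfun R (iedge G)).
Local Notation deg j := (degree (iend G) (conn G j)).
Local Notation bv := (bvalues (iend G) (ilen G)).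
Local Notation bd := (bderivs (iend G) (ilen G)).
Implicit Types (psi chi u F : IG).

(** The part of the conditions that the rescaled solution satisfies exactly; at connecting vertices
    it is continuous but its flux does not vanish. *)
Definition bc_vert psi psi1 := forall v, v \notin codom (conn G) ->
  vertex_cond (Pin G v) (Thetain G v) (bv psi v) (bd psi1 v).

Definition bc_in psi psi1 := bc_vert psi psi1 /\
  forall j, vertex_cond (kirchhoff_proj R (deg j)) 0 (bv psi (conn G j)) (bd psi1 (conn G j)).

Definition res_in psi psi1 (h : iedge G * bool) : C :=
  @spread R _ _ (iend G) N (conn G)
    (fun j i => vres (kirchhoff_proj R (deg j)) 0 (bv psi (conn G j)) (bd psi1 (conn G j)) i 0)
    (fun v i => vres (Pin G v) (Thetain G v) (bv psi v) (bd psi1 v) i 0) h.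

Lemma res_in_lin h : linear_res (fun psi psi1 => res_in psi psi1 h).
Proof.
move=> a psi psi1 chi chi1; rewrite /res_in -spread_lin; congr (spread _ _ h).
  apply: functional_extensionality_dep => j; apply: functional_extensionality_dep => i.
  by rewrite !bvalues_lin !bderivs_lin vres_lin mx_linE.
apply: functional_extensionality_dep => v; apply: functional_extensionality_dep => i.
by rewrite !bvalues_lin !bderivs_lin vres_lin mx_linE.
Qed.

Lemma bc_inE psi psi1 : bc_in psi psi1 <-> forall h, res_in psi psi1 h = 0.
Proof.
rewrite /res_in (spread0P (conn_inj (q:=G))); split.
  move=> [b1 b2]; split=> [j i|v i vc].
    have /vertex_cond0E -> := b2 j; first by rewrite mxE.
    by apply: kirchhoff_orth; exact: conn_degree.
  have /vertex_condE -> := b1 v vc; [by rewrite mxE|exact: Pin_proj|exact: Thetain_sa].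
move=> [b1 b2]; split=> [v vc|j].
  apply/vertex_condE; [exact: Pin_proj|exact: Thetain_sa|].
  by apply/matrixP => i k; rewrite (ord1 k) b2 // mxE.
apply/vertex_cond0E; first by apply: kirchhoff_orth; exact: conn_degree.
by apply/matrixP => i k; rewrite (ord1 k) b1 mxE.
Qed.

Lemma res_in_n1 : exists2 a, 0 <= a & forall psi psi1 M h, 0 <= M ->
  (forall e x, edge (iedges G e) x -> n1 (psi e x) + n1 (psi1 e x) <= M) ->
  n1 (res_in psi psi1 h) <= a * M.
Proof.
have /choice[ac Hc] : forall j, exists a, 0 <= a /\ forall (u u1 : 'cV[C]_(deg j)) M,
    (forall i, n1 (u i 0) <= M) -> (forall i, n1 (u1 i 0) <= M) ->
    forall i, n1 (vres (kirchhoff_proj R (deg j)) 0 u u1 i 0) <= a * M.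
  by move=> j; have [a a0 Ha] := vres_n1 (kirchhoff_proj R (deg j)) 0; exists a.
have /choice[av Hv] : forall v, exists a, 0 <= a /\ forall (u u1 : 'cV[C]_(degree (iend G) v)) M,
    (forall i, n1 (u i 0) <= M) -> (forall i, n1 (u1 i 0) <= M) ->
    forall i, n1 (vres (Pin G v) (Thetain G v) u u1 i 0) <= a * M.
  by move=> v; have [a a0 Ha] := vres_n1 (Pin G v) (Thetain G v); exists a.
have c0 j : 0 <= ac j by have [] := Hc j.
have v0 v : 0 <= av v by have [] := Hv v.
exists (\sum_j ac j + \sum_v av v); first by rewrite addr_ge0 // sumr_ge0.
move=> psi psi1 M h M0 pM.
have end_edge (k : iedge G * bool) : edge (iedges G k.1) (if k.2 then ilen G k.1 else 0).
  by case: k.2; rewrite /edge /= ?lexx ltW ?ilen_gt0.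
have vM v i : n1 (bv psi v i 0) <= M.
  rewrite mxE /end_value; apply: le_trans (pM _ _ (end_edge (enum_val i))).
  by rewrite lerDl n1_ge0.
have dM v i : n1 (bd psi1 v i 0) <= M.
  have H : n1 (end_value (ilen G) psi1 (enum_val i)) <= M.
    by rewrite /end_value; apply: le_trans (pM _ _ (end_edge (enum_val i))); rewrite lerDr n1_ge0.
  by rewrite mxE /=; case: (_.2); rewrite ?n1N.
apply: (spread_n1 (conn_inj (q:=G))).
- by apply: mulr_ge0 => //; rewrite addr_ge0 // sumr_ge0.
- move=> j i; apply: le_trans ((Hc j).2 _ _ M _ _ i) _ => //.
  by rewrite ler_wpM2r //; apply: (le_trans (le_sum_term j c0)); rewrite lerDl sumr_ge0.
- move=> v i _; apply: le_trans ((Hv v).2 _ _ M _ _ i) _ => //.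
  by rewrite ler_wpM2r //; apply: (le_trans (le_sum_term v v0)); rewrite lerDr sumr_ge0.
Qed.

Lemma iedges_gt0 e a : iedges G e = Some a -> 0 < a.
Proof. by move=> [<-]; exact: ilen_gt0. Qed.

Lemma inner_gronwall : exists2 c, 0 <= c & forall F u u1 e x, gL2 (iedges G) F ->
  solves (iedges G) (Bin G) 0 F u u1 -> edge (iedges G e) x ->
  n1 (u e x) + n1 (u1 e x) <=
  c * (n1 (u e 0) + n1 (u1 e 0) + \int[leb]_(t in edge (iedges G e)) n1 (F e t)).
Proof.
have [K [_ BK]] := potential_bounds G.
pose K' : R := `|K|; have K'0 : 0 <= K' := normr_ge0 K.
have BK' e x : edge (iedges G e) x -> `|Bin G e x| <= K'.
  by move=> /BK /le_trans; apply; exact: ler_norm.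
pose c e := 2 * expR (2 * (K' + 1) * ilen G e).
have c0 e : 0 <= c e by rewrite mulr_ge0 ?expR_ge0.
exists (\sum_e c e); first by rewrite sumr_ge0.
move=> F u u1 e x /gL2E F2 /(_ e)[_ _ p p1] ex.
have iF : cint `[0, ilen G e] (F e) by apply: csq_loc (F2 e) _; rewrite /= lexx ltW // ilen_gt0.
have H : n1 (u e x) + n1 (u1 e x) <=
  2 * (n1 (u e 0) + n1 (u1 e 0) + \int[leb]_(t in `[0, ilen G e]) n1 (F e t)) *
    expR (2 * (K' + 1) * ilen G e).
  apply: (schr_gronwall (q := fun x => (Bin G e x)%:C - 0) _ _ iF p p1) => //.
  by move=> y ey; rewrite subr0 n1_real; exact: BK'.
apply: (le_trans H); rewrite -edge_Some mulrAC.
rewrite ler_wpM2r //; last exact: (le_sum_term e c0).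
by rewrite !addr_ge0 ?n1_ge0 //; apply: Rintegral_ge0 => ? _; exact: n1_ge0.
Qed.

Lemma Rint_n1_gzero D e : \int[leb]_(t in D) n1 (@gzero R (iedge G) e t) = 0.
Proof. by rewrite (Rint_ext (g := fun=> 0)) ?/Rintegral ?integral0 // => t _; exact: n1_0. Qed.

(** Vanishing almost everywhere forces zero initial data by the trace bound, then zero everywhere by
    Gronwall. The pointwise statement is needed because vertex values are read off at single
    points. *)
Lemma solves_in_zero u u1 : solves (iedges G) (Bin G) 0 (@gzero R _) u u1 ->
  geq_ae (iedges G) u (@gzero R _) ->
  forall e x, edge (iedges G e) x -> u e x = 0.
Proof.
move=> su u0 e x ex.
have [K [_ BK]] := potential_bounds G.
have [T T0 /(_ _ _ _ e (gL2_0 _) su) Ht] :=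
  trace_solves iedges_gt0 (@Bin_meas _ _ G) BK 0.
have u2 : gL2 (iedges G) u by apply/gL2E => i; have [] := su i.
rewrite (N2_ae u2 (gL2_0 _) u0) N2Z0 addr0 mulr0 in Ht.
have a0 : u e 0 = 0 by apply: sqmod_eq0; apply: le_trans Ht; rewrite lerDl sqmod_ge0.
have a1 : u1 e 0 = 0 by apply: sqmod_eq0; apply: le_trans Ht; rewrite lerDr sqmod_ge0.
have [c c0 /(_ _ _ _ _ _ (gL2_0 _) su ex)] := inner_gronwall.
rewrite Rint_n1_gzero a0 a1 n1_0 !addr0 mulr0 => H; apply: n1_eq0; apply: le_trans H.
by rewrite lerDl n1_ge0.
Qed.


Definition coords (p : 'rV[C]_#|{: iedge G * bool}|) (h : iedge G * bool) : C :=
  p 0 (enum_rank h).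

Lemma solves_comb (U U1 : iedge G -> bool -> R -> C) : (forall i b,
    [/\ cprim None (U i b) (U1 i b),
        cprim None (U1 i b) (fun x => pot (iedges G) (Bin G) 0 i x * U i b x),
        U i b 0 = (~~ b)%:R & U1 i b 0 = b%:R]) ->
  forall P, solves (iedges G) (Bin G) 0 (@gzero R _) (comb U P) (comb U1 P).
Proof.
move=> HU P e; have r := comb_regular HU P e.
have p := comb_eq HU P e.
have ee : edge (None : option R) (ilen G e) by rewrite /edge /= ltW ?ilen_gt0.
split.
- by rewrite [edge _]edge_Some; exact: cprim_csq r ee.
- have p' : cprim (Some (ilen G e)) (comb U1 P e) _ := p.
  rewrite [edge _]edge_Some; apply: cprim_csq p' _.
  by rewrite /edge /= lexx ltW ?ilen_gt0.
- by apply: cprim_sub r; exact: edge_None_sub.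
- by apply: (cprim_ext _ _ p) => // x _; rewrite /gzero [RHS]subr0.
Qed.

Section Decomposition.
Variables (m : nat) (phi : 'I_m -> IG).
Hypothesis phi_basis : zero_eigenbasis (iedges G) (Hin_ring G) phi.

Lemma Hin_ring0P psi : Hin_ring G psi (@gzero R _) <->
  exists2 psi1, solves (iedges G) (Bin G) 0 (@gzero R _) psi psi1 & bc_in psi psi1.
Proof.
have [K [_ BK]] := potential_bounds G.
have E : gaxpy 0 psi (@gzero R _) = @gzero R _.
  by apply/funext => i; apply/funext => x; rewrite /gaxpy /gzero mul0r addr0.
rewrite -{1}E.
exact: (schrE (@Bin_meas _ _ G) BK bc_in 0 psi (gL2_0 _)).
Qed.

Lemma eigen_solves : exists phi1 : 'I_m -> IG, forall k,
  solves (iedges G) (Bin G) 0 (@gzero R _) (phi k) (phi1 k) /\ bc_in (phi k) (phi1 k).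
Proof.
have H k : exists p, solves (iedges G) (Bin G) 0 (@gzero R _) (phi k) p /\ bc_in (phi k) p.
  by have [H _ _] := phi_basis; have /Hin_ring0P[p] := H k; exists p.
by have [phi1 Hp] := choice H; exists phi1.
Qed.

Lemma solves_sum n (q q1 : 'I_n -> IG) (b : 'I_n -> C) :
  (forall k, solves (iedges G) (Bin G) 0 (@gzero R _) (q k) (q1 k)) ->
  solves (iedges G) (Bin G) 0 (@gzero R _) (fun e x => \sum_k b k * q k e x)
    (fun e x => \sum_k b k * q1 k e x).
Proof.
move=> H e; have mE := measurable_edge (iedges G e); split.
- by apply: csq_sum => // k; apply: csqZ => //; have [] := H k e.
- by apply: csq_sum => // k; apply: csqZ => //; have [] := H k e.
- by apply: cprim_sum => k; apply: cprimZ; have [] := H k e.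
- apply: (cprim_ext (f := fun x => \sum_k b k * q1 k e x)
    (f1 := fun x => \sum_k b k * (((Bin G e x)%:C - 0) * q k e x - gzero e x))) => // [x _|].
    rewrite /gzero [RHS]subr0 mulr_sumr; apply: eq_bigr => k _.
    by rewrite [X in b k * X]subr0 mulrCA.
  by apply: cprim_sum => k; apply: cprimZ; have [] := H k e.
Qed.

(** Upgrades the spanning property of the basis, given almost everywhere, to an identity at every
    point, ends of edges included. *)
Lemma eigen_span psi psi1 : solves (iedges G) (Bin G) 0 (@gzero R _) psi psi1 ->
  bc_in psi psi1 -> exists b : 'I_m -> C, forall e x, edge (iedges G e) x ->
    psi e x = \sum_k b k * phi k e x.
Proof.
move=> s bc; have [phi1 Hp] := eigen_solves; have [_ _ sp] := phi_basis.
have /sp[b Hb] : Hin_ring G psi (@gzero R _) by apply/Hin_ring0P; exists psi1.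
exists b => e x ex; apply/eqP; rewrite -subr_eq0; apply/eqP.
have S := solves_sub s (solves_sum b (fun k => (Hp k).1)).
have g0 : gsub (@gzero R (iedge G)) (@gzero R (iedge G)) = @gzero R _.
  by apply/funext => i; apply/funext => y; rewrite /gsub /gzero subrr.
rewrite g0 in S.
apply: (solves_in_zero S _ ex) => i.
by apply: ae_imp (Hb i) => y H iy; rewrite /gsub H // subrr.
Qed.

(* The initial data of zero-energy solutions satisfying the vertex conditions are
   those of the eigenfunctions; [lin_pinv] bounds the remaining part. *)
Lemma inner_decomp : exists2 c, 0 <= c & forall F u u1 (d : R), gL2 (iedges G) F ->
  solves (iedges G) (Bin G) 0 F u u1 -> bc_vert u u1 -> 0 <= d ->
  (forall j, (1%:M - kirchhoff_proj R (deg j)) *m bv u (conn G j) = 0) ->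
  (forall j, n1 (\sum_i bd u1 (conn G j) i 0) <= d) ->
  exists b : 'I_m -> C, forall e x, edge (iedges G e) x ->
    n1 (u e x - \sum_k b k * phi k e x) <=
    c * (d + \sum_e \int[leb]_(t in edge (iedges G e)) n1 (F e t)).
Proof.
have [K [_ BK]] := potential_bounds G.
have [U [U1 HU]] := fundamental iedges_gt0 (@Bin_meas _ _ G) BK 0.
have [a a0 Ha] := res_in_n1; have [g g0 Hg] := inner_gronwall.
pose n := #|{: iedge G * bool}|.
have [L LE] : exists L : 'rV[C]_n -> 'rV[C]_n, forall p k,
    L p 0 k = res_in (comb U (coords p)) (comb U1 (coords p)) (enum_val k).
  exists (fun p => \row_k res_in (comb U (coords p)) (comb U1 (coords p)) (enum_val k)).
  by move=> p k; rewrite mxE.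
have linL : linear L.
  move=> w p q; apply/rowP => k.
  have E (W : iedge G -> bool -> R -> C) : comb W (coords (w *: p + q)) =
      gaxpy w (comb W (coords p)) (comb W (coords q)).
    by rewrite -comb_lin; congr comb; apply/funext => h; rewrite /coords mx_linE.
  by rewrite mx_linE !LE !E; exact: res_in_lin.
have [c c0 Hc] := lin_pinv linL.
exists (g + g * 2 * c * n%:R * (1 + a * g)).
  by rewrite addr_ge0 ?mulr_ge0 ?addr_ge0 ?mulr_ge0.
move=> F u u1 d F2 s bcv d0 K0 K1.
set S := \sum_e _.
have S0 : 0 <= S by apply: sumr_ge0 => e _; apply: Rintegral_ge0 => ? _; exact: n1_ge0.
have Se e : \int[leb]_(t in edge (iedges G e)) n1 (F e t) <= S.
  by apply: (le_sum_term (f := fun e => \int[leb]_(t in edge (iedges G e)) n1 (F e t))) => k;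
     apply: Rintegral_ge0 => ? _; exact: n1_ge0.
(* The initial data of [u]: subtracting the homogeneous solution with these data leaves a function
   with zero data, controlled by the source alone. *)
pose p0 : 'rV[C]_n := \row_k (let h := enum_val k in if h.2 then u1 h.1 0 else u h.1 0).
have f0 h : coords p0 h = if h.2 then u1 h.1 0 else u h.1 0.
  by rewrite /coords mxE enum_rankK.
have gs (A B : IG) : gsub A B = gaxpy (-1) B A.
  by apply/funext => i; apply/funext => y; rewrite /gsub /gaxpy mulN1r addrC.
have v := solves_sub s (solves_comb HU (coords p0)).
have F0 : gsub F (@gzero R _) = F.
  by apply/funext => i; apply/funext => y; rewrite /gsub /gzero subr0.
rewrite F0 in v.
have vM e x : edge (iedges G e) x ->
    n1 (gsub u (comb U (coords p0)) e x) + n1 (gsub u1 (comb U1 (coords p0)) e x) <= g * S.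
  move=> ex; apply: (le_trans (Hg _ _ _ _ _ F2 v ex)).
  have [c1 c2] := comb0 HU (coords p0) e.
  rewrite /gsub c1 c2 !f0 /= !subrr n1_0 !add0r.
  by apply: ler_wpM2l; [exact: g0|exact: Se].
(* The conditions hold exactly away from the connecting vertices; at these, only the flux is wrong,
   by at most [d], and averaging over the degree does not increase it. *)
have ru h : n1 (res_in u u1 h) <= d.
  rewrite /res_in; apply: (spread_n1 (conn_inj (q:=G))) => // [j i|w i wc].
    rewrite /vres K0 add0r mul0mx subr0 kirchhoffM mxE.
    apply: (le_trans (n1M _ _)).
    have dj : (0 < deg j)%N by exact: conn_degree.
    have E : ((deg j)%:R^-1 : C) = ((deg j)%:R^-1 : R)%:C.
      by rewrite fmorphV rmorph_nat.
    apply: (le_trans _ (K1 j)); rewrite E n1_real ger0_norm ?invr_ge0 //.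
    by rewrite ler_piMl ?n1_ge0 // invf_le1 ?ler1n ?ltr0n.
  have /vertex_condE -> := bcv w wc; [by rewrite mxE n1_0|exact: Pin_proj|exact: Thetain_sa].
have Lp k : n1 (L p0 0 k) <= d + a * (g * S).
  rewrite LE; set h := enum_val k.
  have -> : res_in (comb U (coords p0)) (comb U1 (coords p0)) h =
      res_in u u1 h - res_in (gsub u (comb U (coords p0))) (gsub u1 (comb U1 (coords p0))) h.
    rewrite (gs u) (gs u1) (res_in_lin h (-1)).
    by move: (res_in u u1 h) (res_in _ _ h) => A B; rewrite mulN1r opprD opprK addrCA subrr addr0.
  apply: (le_trans (n1B _ _)); apply: lerD; first exact: ru.
  by apply: Ha => //; exact: mulr_ge0.
(* [p'] has the same residuals as [p0] but is small. The difference of the two homogeneous solutions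
   then satisfies all conditions, so it is a combination of eigenfunctions and provides [b]. *)
have [p' [Lp' p'M]] := Hc p0.
have p'B h : n1 (coords p' h) <= c * n%:R * (1 + a * g) * (d + S).
  apply: (le_trans (p'M _)); rewrite -!mulrA ler_wpM2l //.
  apply: (@le_trans _ _ (\sum_(k < n) (d + a * (g * S)))); first exact: ler_sum.
  rewrite sumr_const card_ord -[leLHS]mulr_natl; apply: ler_wpM2l => //.
  have := mulr_ge0 a0 g0; nra.
have sd := solves_lin (-1) (solves_comb HU (coords p')) (solves_comb HU (coords p0)).
have z0 : gaxpy (-1) (@gzero R (iedge G)) (@gzero R (iedge G)) = @gzero R _.
  by apply/funext => i; apply/funext => y; rewrite /gaxpy /gzero mulr0 addr0.
rewrite z0 in sd.
have bcd : bc_in (gaxpy (-1) (comb U (coords p')) (comb U (coords p0)))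
    (gaxpy (-1) (comb U1 (coords p')) (comb U1 (coords p0))).
  apply/bc_inE => h; rewrite (res_in_lin h (-1)).
  have := congr1 (fun r : 'rV[C]_n => r 0 (enum_rank h)) Lp'.
  by rewrite /= !LE enum_rankK => ->; rewrite mulN1r addNr.
have [b Hb] := eigen_span sd bcd.
exists b => e x ex; rewrite -Hb //.
have -> : u e x - gaxpy (-1) (comb U (coords p')) (comb U (coords p0)) e x =
  gsub u (comb U (coords p0)) e x + comb U (coords p') e x.
  by rewrite /gaxpy /gsub mulN1r opprD opprK addrCA addrC.
apply: (le_trans (n1D _ _)); rewrite [leRHS]mulrDl; apply: lerD.
  apply: (@le_trans _ _ (g * S)); last by rewrite ler_wpM2l // lerDr.
  by apply: le_trans (vM _ _ ex); rewrite lerDl n1_ge0.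
have := Hg _ _ _ _ _ (gL2_0 _) (solves_comb HU (coords p')) ex.
have [-> ->] := comb0 HU (coords p') e.
rewrite Rint_n1_gzero addr0 => H.
apply: (@le_trans _ _ (g * (n1 (coords p' (e, false)) + n1 (coords p' (e, true))))).
  by apply: le_trans H; rewrite lerDl n1_ge0.
rewrite -!mulrA ler_wpM2l //.
have H1 := p'B (e, false); have H2 := p'B (e, true).
apply: le_trans (lerD H1 H2) _.
by move: (d + S) (n%:R : R) => D nR; rewrite le_eqVlt; apply/orP; left; apply/eqP; ring.
Qed.

End Decomposition.
End InnerProblem.

(** * The coupling matrix *)

Section LowRank.
Variable R : realType.
Local Notation C := R[i].

Definition madj m n (A : 'M[C]_(m, n)) : 'M[C]_(n, m) := map_mx Num.conj A^T.

Lemma madjM m n p (A : 'M[C]_(m, n)) (B : 'M[C]_(n, p)) :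
  madj (A *m B) = madj B *m madj A.
Proof. by rewrite /madj trmx_mul map_mxM. Qed.

Lemma madjK m n (A : 'M[C]_(m, n)) : madj (madj A) = A.
Proof. by apply/matrixP => i j; rewrite !mxE conjCK. Qed.

Lemma madjB m n (A B : 'M[C]_(m, n)) : madj (A - B) = madj A - madj B.
Proof. by apply/matrixP => i j; rewrite !mxE rmorphB. Qed.

Lemma madj1 n : madj (1%:M : 'M[C]_n) = 1%:M.
Proof. by apply/matrixP => i j; rewrite !mxE rmorph_nat eq_sym. Qed.

Lemma mulmx_madj_eq0 m n (A : 'M[C]_(m, n)) : A *m madj A = 0 -> A = 0.
Proof.
move=> A0; apply/matrixP => i j; rewrite mxE.
have := congr1 (fun B : 'M[C]_m => B i i) A0; rewrite !mxE => S0.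
have /(_ j isT) : forall k, true -> A i k * (A i k)^* = 0.
  apply: psumr_eq0P => [k _|]; first exact: mul_conjC_ge0.
  by rewrite -[RHS]S0; apply: eq_bigr => k _; rewrite !mxE.
by move/eqP; rewrite mul_conjC_eq0 => /eqP.
Qed.

Lemma mxran_factor n p (A : 'M[C]_n) (B : 'M[C]_(n, p)) :
  (forall v, mxran A (B *m v)) -> exists X, B = A *m X.
Proof.
move=> H.
have /choice[x Hx] : forall k, exists y : 'cV[C]_n, A *m y = col k B.
  by move=> k; have [y _ E] := H (delta_mx k 0); exists y; rewrite E colE.
exists (\matrix_(i, k) x k i 0); apply/matrixP => i k.
have := congr1 (fun v : 'cV[C]_n => v i 0) (Hx k); rewrite !mxE => <-.
by apply: eq_bigr => j _; rewrite !mxE.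
Qed.

Variables (N m : nat) (L : 'M[C]_(N, m)) (P : 'M[C]_N).
Local Notation K := (L *m madj L).
Hypothesis oP : orth_projection P.
Hypothesis ranP : mxran P = mxran K.

(* [Q] acts as the inverse of [K] on [Ran P]. *)
Lemma low_rank_factor : exists Q : 'M[C]_N,
  [/\ Q *m K = P, K *m madj Q = P & P *m L = L].
Proof.
have [PP adP] := oP; have aK : madj K = K by rewrite madjM madjK.
(* Equality of ranges yields factorizations in both directions; the adjoint of [X] is the required
   [Q], because [K] and [P] are Hermitian. *)
have [X PX] : exists X, P = K *m X.
  by apply: mxran_factor => v; rewrite -ranP; exists v.
have [Y KY] : exists Y, K = P *m Y.
  by apply: mxran_factor => v; rewrite ranP; exists v.
have PK : P *m K = K by rewrite [in LHS]KY mulmxA PP -KY.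
exists (madj X); split.
- by rewrite -{1}aK -madjM -PX -[RHS]adP.
- by rewrite madjK -PX.
(* The matrix [(1 - P) L] vanishes because its product with its own adjoint is
   [(1 - P) K (1 - P) = 0]. *)
apply/eqP; rewrite eq_sym -subr_eq0 -{1}(mul1mx L) -mulmxBl; apply/eqP.
apply: mulmx_madj_eq0; rewrite madjM -mulmxA (mulmxA L) mulmxA mulmxBl PK mul1mx.
by rewrite subrr mul0mx.
Qed.

Variable Q : 'M[C]_N.
Hypotheses (QK : Q *m K = P) (KQ : K *m madj Q = P) (PL : P *m L = L).

(** In coefficient space this is the orthogonal projection onto the kernel of [L]: it is the
    identity there and annihilates the range of [L^*]. Its range consists of combinations of
    eigenfunctions vanishing at all connecting vertices. *)
Definition defect : 'M[C]_m := 1%:M - madj L *m (Q *m L).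

Lemma defect_madj : defect *m madj L = 0.
Proof.
have [_ adP] := oP.
rewrite mulmxBl mul1mx -!mulmxA QK -{1}PL madjM.
by rewrite -[madj P]/(adjmx P) adP subrr.
Qed.

Lemma mul_defect : L *m defect = 0.
Proof.
have [PP adP] := oP.
have KP : K *m P = K.
  by rewrite -mulmxA -[P]adP -[adjmx P]/(madj P) -madjM PL.
have E (K0 : 'M[C]_N) : K0 *m madj Q = P -> Q *m K0 = P -> K0 *m P = K0 ->
    K0 *m (Q *m L) = L.
  move=> e1 e2 e3.
  by rewrite -[in LHS]PL -{1}e1 -!mulmxA (mulmxA Q K0) e2 !mulmxA e3 e1 PL.
by rewrite mulmxBr mulmx1 (mulmxA L) (E _ KQ QK KP) subrr.
Qed.

End LowRank.

Section CouplingMatrix.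
Variables (R : realType) (N : nat) (G : qgraph R N) (m : nat).
Variables (phi : 'I_m -> gfun R (iedge G)) (Phat : 'M[R[i]]_N).
Local Notation C := R[i].

Definition cmat : 'M[C]_(N, m) := \matrix_(j, k) cvec phi k j 0.

Lemma col_cmat k : col k cmat = cvec phi k.
Proof. by apply/colP => j; rewrite !mxE. Qed.

Lemma ChatE : Chat phi = cmat *m madj cmat.
Proof. by apply/matrixP => i j; rewrite !mxE; apply: eq_bigr => k _; rewrite !mxE. Qed.

Hypothesis oP : orth_projection Phat.
Hypothesis ranP : mxran Phat = mxran (Chat phi).

Section WithInverse.
Variable Q : 'M[C]_N.
Hypotheses (QK : Q *m Chat phi = Phat) (KQ : Chat phi *m madj Q = Phat)
  (PL : Phat *m cmat = cmat).

(** Since [restr_inv] is defined by choice, its value is identified by uniqueness: [Q] recovers [u]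
    in [Ran P] from [Chat u]. Existence is witnessed by [P] applied to the adjoint of [Q] at [w]. *)
Lemma restr_invE w : mxran Phat w -> restr_inv (Chat phi) Phat w = Q *m w.
Proof.
have [PP adP] := oP; move=> rw.
have Pid v : mxran Phat v -> Phat *m v = v by move=> [y _ <-]; rewrite mulmxA PP.
have KP : Chat phi *m Phat = Chat phi.
  by rewrite ChatE -mulmxA -[in LHS]adP -[adjmx _]/(madj _) -madjM PL.
rewrite /restr_inv; case: xgetP => [u _ [ru Ku]|none].
  by rewrite -(Pid u ru) -QK -mulmxA Ku.
have [] := none (Phat *m (madj Q *m w)); split; first by exists (madj Q *m w).
by rewrite mulmxA KP mulmxA KQ Pid.
Qed.

Lemma coef_defect k k' : coef phi Phat k k' = defect cmat Q k k'.
Proof.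
rewrite /coef restr_invE; last by exists (cvec phi k') => //; rewrite -col_cmat colE mulmxA PL.
have -> : defect cmat Q k k' = (k == k')%:R - (madj cmat *m (Q *m cmat)) k k'.
  by rewrite /defect mxE; congr (_ + _); rewrite mxE.
rewrite cdotE [X in _ = _ - X]mxE.
congr (_ - _); apply: eq_bigr => j _.
by rewrite !mxE; congr (_ * _); apply: eq_bigr => i _; rewrite !mxE.
Qed.

Lemma Chat_bij : set_bij (mxran Phat) (mxran Phat) (mulmx (Chat phi) : 'cV[C]_N -> 'cV[C]_N).
Proof.
have [PP adP] := oP.
have Pid v : mxran Phat v -> Phat *m v = v by move=> [y _ <-]; rewrite mulmxA PP.
have KP : Chat phi *m Phat = Chat phi.
  by rewrite ChatE -mulmxA -[in LHS]adP -[adjmx _]/(madj _) -madjM PL.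
split=> [v _|v w|v rv].
- by rewrite ranP; exists v.
- rewrite !inE => /Pid rv /Pid rw E.
  by rewrite -rv -rw -QK -!mulmxA E.
exists (Phat *m (madj Q *m v)); first by exists (madj Q *m v).
by rewrite mulmxA KP mulmxA KQ Pid.
Qed.

(** Each column of the defect lies in the kernel of [L], hence is a vanishing linear combination of
    the vectors [c_k]. *)
Lemma defect_eq0 : free [seq cvec phi k | k <- enum 'I_m] -> defect cmat Q = 0.
Proof.
move=> fr; apply/matrixP => k k'; rewrite [RHS]mxE.
set D := defect cmat Q.
have LD : cmat *m D = 0 by apply: (mul_defect oP) => //; rewrite -ChatE.
have E : \sum_k D k k' *: cvec phi k = 0.
  apply/colP => j; rewrite summxE [RHS]mxE.
  have := congr1 (fun A : 'M[C]_(N, m) => A j k') LD; rewrite !mxE => H.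
  by rewrite -[RHS]H; apply: eq_bigr => i _; rewrite !mxE mulrC.
have sz : size [seq cvec phi k | k <- enum 'I_m] = m by rewrite size_map size_enum_ord.
pose X : m.-tuple 'cV[C]_N := Tuple (introT eqP sz).
have /freeP : free X by [].
move/(_ (fun i => D i k')) => -> //.
rewrite -[RHS]E; apply: eq_bigr => i _; congr (_ *: _).
by rewrite (nth_map i) ?size_enum_ord // nth_ord_enum.
Qed.

End WithInverse.

Lemma Chat_ker_full : mxker (Chat phi) = setT -> cmat = 0 /\ Phat = 0.
Proof.
move=> kK.
have K0 : Chat phi = 0.
  apply/matrixP => i j; rewrite [RHS]mxE.
  have : mxker (Chat phi) (delta_mx j 0) by rewrite kK.
  rewrite /mxker /= -colE => /(congr1 (fun v : 'cV[C]_N => v i 0)).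
  by rewrite !mxE.
split; first by apply: mulmx_madj_eq0; rewrite -ChatE.
apply/matrixP => i j; rewrite [RHS]mxE.
have : mxran (Chat phi) (Phat *m delta_mx j 0) by rewrite -ranP; exists (delta_mx j 0).
move=> [y _]; rewrite K0 mul0mx -colE => /(congr1 (fun v : 'cV[C]_N => v i 0)).
by rewrite !mxE.
Qed.

End CouplingMatrix.

(** * Asymptotics *)

Section InnerScaling.
Variables (R : realType) (N : nat) (G : qgraph R N).
Local Notation leb := (@lebesgue_measure R).
Local Notation integ D f := (leb.-integrable D (EFin \o f)).
Local Notation C := R[i].
Local Notation IE := ('I_N + iedge G)%type.
Local Notation ell eps := (iedges_eps (G := G) eps).

Lemma sqrt_le_sqr (a b : R) : 0 <= b -> a ^+ 2 <= b ^+ 2 -> a <= b.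
Proof.
move=> b0 ab; apply: (le_trans (ler_norm a)).
by rewrite -[leRHS]ger0_norm // -ler_sqr ?nnegrE // !real_normK ?num_real.
Qed.

Lemma gnorm_ge0 (I : finType) (l : I -> option R) f : 0 <= Defs.gnorm l f.
Proof. exact: sqrtr_ge0. Qed.

Lemma gnorm_sqr (I : finType) (l : I -> option R) f : Defs.gnorm l f ^+ 2 = N2 l f.
Proof. by rewrite gnormE sqr_sqrtr // N2_ge0. Qed.


Lemma N2_fedges eps (f : gfun R IE) :
  N2 (fedges eps) f = N2 (olen G) (fouter f) + N2 (ell eps) (finner f).
Proof. by rewrite /N2 big_sumType. Qed.

Lemma gnorm_fouter eps (f : gfun R IE) : Defs.gnorm (olen G) (fouter f) <= Defs.gnorm (fedges eps) f.
Proof.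
apply: sqrt_le_sqr; first exact: gnorm_ge0.
by rewrite !gnorm_sqr N2_fedges lerDl N2_ge0.
Qed.

Lemma gnorm_finner eps (f : gfun R IE) : Defs.gnorm (ell eps) (finner f) <= Defs.gnorm (fedges eps) f.
Proof.
apply: sqrt_le_sqr; first exact: gnorm_ge0.
by rewrite !gnorm_sqr N2_fedges lerDr N2_ge0.
Qed.

Lemma gnorm_split eps (f : gfun R IE) : Defs.gnorm (fedges eps) f <=
  Defs.gnorm (olen G) (fouter f) + Defs.gnorm (ell eps) (finner f).
Proof.
have a0 := gnorm_ge0 (olen G) (fouter f); have b0 := gnorm_ge0 (ell eps) (finner f).
apply: sqrt_le_sqr; first exact: addr_ge0.
rewrite gnorm_sqr N2_fedges -!gnorm_sqr sqrrD lerD2r lerDl.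
by rewrite mulrn_wge0 // mulr_ge0.
Qed.

Lemma gL2_split eps (f : gfun R IE) : gL2 (fedges eps) f <->
  gL2 (olen G) (fouter f) /\ gL2 (ell eps) (finner f).
Proof.
split=> [H|[H1 H2] [j|e]]; [split=> i|exact: H1|exact: H2].
  exact: H (inl i).
exact: H (inr i).
Qed.

(** Plain substitution [x = eps y] without a normalizing factor: supremum norms are preserved, [L^2]
    norms are multiplied by [eps^(-1/2)]. *)
Definition pull (eps : R) (H : gfun R (iedge G)) : gfun R (iedge G) :=
  fun e y => H e (eps * y).

Section Eps.
Variable eps : R.
Hypothesis eps0 : 0 < eps.
Local Notation s := (Num.sqrt eps).

Lemma sqrt_sqr : s * s = eps.
Proof. by rewrite -expr2 sqr_sqrtr // ltW. Qed.

Lemma sqrt_pos : 0 < s.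
Proof. by rewrite sqrtr_gt0. Qed.

Lemma gL2_pull H : gL2 (ell eps) H -> gL2 (iedges G) (pull eps H).
Proof. by move=> /gL2E H2; apply/gL2E => e; exact: csq_dil eps0 _ _ (H2 e). Qed.

Lemma pull_sqmod e H : gL2 (ell eps) H ->
  \int[leb]_(y in edge (iedges G e)) sqmod (pull eps H e y) =
  eps^-1 * \int[leb]_(x in edge (ell eps e)) sqmod (H e x).
Proof.
move=> /gL2E H2.
rewrite (Rint_dil_edge eps0 (f := fun x => sqmod (H e x))).
  by rewrite mulrA mulVf ?gt_eqF // mul1r.
by apply: csq_sqmod (H2 e); exact: measurable_edge.
Qed.

End Eps.

Lemma pull_L1 : exists2 c, 0 <= c & forall eps H, 0 < eps -> gL2 (ell eps) H ->
  \sum_e \int[leb]_(y in edge (iedges G e)) n1 (pull eps H e y) <=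
  c * ((Num.sqrt eps)^-1 * Defs.gnorm (ell eps) H).
Proof.
exists (\sum_e Num.sqrt (2 * ilen G e)); first by rewrite sumr_ge0 // => e _; exact: sqrtr_ge0.
move=> eps H eps0 H2; rewrite mulr_suml; apply: ler_sum => e _.
have l0 : 0 <= ilen G e by rewrite ltW ?ilen_gt0.
have s0 := sqrt_pos eps0; have g0 := gnorm_ge0 (ell eps) H.
apply: sqrt_le_sqr; first by rewrite !mulr_ge0 ?sqrtr_ge0 ?invr_ge0.
have /gL2E /(_ e) := gL2_pull eps0 H2; rewrite [edge _]edge_Some => F2.
apply: (le_trans (csq_L1 l0 F2)).
rewrite -edge_Some (pull_sqmod eps0 e H2) !exprMn sqr_sqrtr ?mulr_ge0 // ler_wpM2l ?mulr_ge0 //.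
rewrite exprVn (sqr_sqrtr (ltW eps0)) gnorm_sqr; apply: ler_wpM2l; first by rewrite invr_ge0 ltW.
exact: N2_le_edge.
Qed.

(** The total length of the inner edges is proportional to [eps], which gains [eps^(1/2)] over the
    supremum norm. *)
Lemma gnorm_sup : exists2 c, 0 <= c & forall eps D M, 0 < eps -> 0 <= M -> gL2 (ell eps) D ->
  (forall e x, edge (ell eps e) x -> n1 (D e x) <= M) ->
  Defs.gnorm (ell eps) D <= c * (Num.sqrt eps * M).
Proof.
exists (Num.sqrt (\sum_e ilen G e)); first exact: sqrtr_ge0.
move=> eps D M eps0 M0 /gL2E D2 DM.
have l0 e : 0 <= ilen G e by rewrite ltW ?ilen_gt0.
apply: sqrt_le_sqr; first by rewrite !mulr_ge0 ?sqrtr_ge0.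
have sl0 : 0 <= \sum_e ilen G e by rewrite sumr_ge0.
rewrite gnorm_sqr !exprMn (sqr_sqrtr (ltW eps0)) (sqr_sqrtr sl0) mulr_suml /N2.
apply: ler_sum => e _.
have el0 : 0 <= eps * ilen G e by rewrite mulr_ge0 // ltW.
have -> : ilen G e * (eps * M ^+ 2) = M ^+ 2 * (eps * ilen G e - 0) by ring.
rewrite -(Rint_cst _ el0).
rewrite [edge _]edge_Some; apply: Rint_le => //.
- by rewrite -edge_Some; apply: csq_sqmod (D2 e); exact: measurable_edge.
- by apply: (integ_bounded (C := `|M ^+ 2|)) => //; exact: measurable_cst.
move=> x /itv0_edge ex; apply: (le_trans (sqmod_le_n1 _)).
by rewrite ler_sqr ?nnegrE ?n1_ge0 // DM.
Qed.

End InnerScaling.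

(** * The solution rescaled to the fixed inner graph *)

Section Rescaling.
Variables (R : realType) (N : nat) (G : qgraph R N) (z : R[i]).
Local Notation leb := (@lebesgue_measure R).
Local Notation C := R[i].
Local Notation cIm := (@complex.Im R).
Local Notation IE := ('I_N + iedge G)%type.
Local Notation ell eps := (iedges_eps (G := G) eps).
Local Notation deg j := (degree (iend G) (conn G j)).
Local Notation bv := (bvalues (iend G) (ilen G)).
Local Notation bd := (bderivs (iend G) (ilen G)).
Hypothesis z_nonreal : cIm z != 0.

Definition full_solution eps (f psi psi1 : gfun R IE) :=
  [/\ gL2 (fedges eps) f, solves (fedges eps) (Bfull_eps eps) z f psi psi1
    & bc_full eps psi psi1].

Definition pull1 eps (H : gfun R (iedge G)) : gfun R (iedge G) :=
  fun e y => eps%:C * H e (eps * y).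

Definition pull_rhs eps (u f : gfun R (iedge G)) : gfun R (iedge G) :=
  fun e y => (eps ^+ 2)%:C * (z * u e (eps * y) + f e (eps * y)).

Section Eps.
Variables (eps : R) (f psi psi1 : gfun R IE).
Hypothesis eps0 : 0 < eps.
Hypothesis sol : full_solution eps f psi psi1.
Local Notation u := (pull eps (finner psi)).
Local Notation u1 := (pull1 eps (finner psi1)).
Local Notation F := (pull_rhs eps (finner psi) (finner f)).

Let f2 : gL2 (fedges eps) f. Proof. by have [] := sol. Qed.

Lemma full_gL2 : gL2 (fedges eps) psi.
Proof. by have [_ s _] := sol; apply/gL2E => i; have [] := s i. Qed.

Lemma full_bound : Defs.gnorm (fedges eps) psi <= `|cIm z|^-1 * Defs.gnorm (fedges eps) f.
Proof.
have [_ s bc] := sol; apply: gnorm_le.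
have [M BM] := Bfull_le G eps0.
have := apriori (fedges_gt0 eps0) (@Bfull_meas _ _ G eps eps0) BM f2 s.
rewrite (bc_full_sym bc) normr0 !mulr0 addr0 => H.
by rewrite ler_pdivlMr ?exprn_even_gt0 // mulrC.
Qed.

(** The factor [eps ^ 2] from two derivatives cancels the scaling [eps^-2] of the potential. *)
Lemma pull_solves : solves (iedges G) (Bin G) 0 F u u1.
Proof.
have [_ s _] := sol; move=> e; have [c0 c1 p p1] := s (inr e).
have me := measurable_edge (iedges G e).
split.
- exact: (csq_dil eps0 c0).
- by apply: csqZ => //; exact: (csq_dil eps0 c1).
- exact: (cprim_dil eps0 p).
have := cprimZ eps%:C (cprim_dil eps0 p1).
apply: cprim_ext => // y ey.
have -> : Bfull_eps eps (inr e) (eps * y) = eps ^- 2 * Bin G e y.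
  by rewrite /Bfull_eps /Bin_eps mulrAC mulfV ?mul1r ?gt_eqF.
rewrite /pull /pull_rhs /finner.
move: (psi _ _) (f _ _) (Bin G e y) => a b c.
have E : eps%:C * (eps%:C * (eps ^- 2 * c)%:C) = c%:C.
  by rewrite -!rmorphM /= mulrA (mulrA _ _ c) -expr2 mulfV ?mul1r ?expf_neq0 ?gt_eqF.
rewrite subr0 -E rmorphXn /=.
by move: (eps ^- 2 * c)%:C (eps%:C) => q t; ring.
Qed.

Lemma pull_rhs_gL2 : gL2 (iedges G) F.
Proof.
apply/gL2E => e; have me := measurable_edge (iedges G e).
have /gL2E/(_ e) p2 : gL2 (iedges G) (pull eps (finner psi)).
  by apply: gL2_pull => //; have [] := (gL2_split eps psi).1 full_gL2.
have /gL2E/(_ e) g2 : gL2 (iedges G) (pull eps (finner f)).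
  by apply: gL2_pull => //; have [] := (gL2_split eps f).1 f2.
by apply: csqZ => //; apply: csqD => //; apply: csqZ.
Qed.

Lemma pull_bv v : bv u v = bvalues (iend G) (ilens eps) (finner psi) v.
Proof.
by apply/colP => i; rewrite !mxE /end_value /pull; case: (_.2); rewrite ?mulr0.
Qed.

Lemma pull_bd v : bd u1 v = eps%:C *: bderivs (iend G) (ilens eps) (finner psi1) v.
Proof.
apply/colP => i; rewrite !mxE /end_value /pull1 /=.
by case: (_.2); rewrite ?mulr0 ?mulrN.
Qed.

(** The derivative acquires a factor [eps], which cancels the scaling [eps^-1] of [Thetain]. *)
Lemma pull_bc_vert : bc_vert u u1.
Proof.
have [_ _ [bc _ _]] := sol; move=> v vc; have [h1 h2] := bc v vc.
rewrite /vertex_cond pull_bv pull_bd; split=> //.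
have := congr1 (fun A => eps%:C *: A) h2.
rewrite scaler0 scalerBr -!scalemxAr -!scalemxAl scalerA.
by rewrite -rmorphM /= mulfV ?gt_eqF // scale1r.
Qed.

Lemma pull_conn j : (forall i, bv u (conn G j) i 0 = psi (inl j) 0) /\
  \sum_i bd u1 (conn G j) i 0 = - (eps%:C * psi1 (inl j) 0).
Proof.
have [_ _ [_ _ bc]] := sol; have [|c0 c1] := kirchhoff_const _ (bc j).
  by rewrite addn1.
split=> [i|].
  have := c0 (lshift 1 i) (rshift (deg j) 0).
  by rewrite col_mxEu col_mxEd [const_mx _ _ _]mxE pull_bv.
move: c1; rewrite big_split_ord /= big_ord1 col_mxEd [const_mx _ _ _]mxE => c1.
rewrite pull_bd; have -> : \sum_i (eps%:C *: bderivs (iend G) (ilens eps) (finner psi1) (conn G j)) i 0 =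
    eps%:C * \sum_i bderivs (iend G) (ilens eps) (finner psi1) (conn G j) i 0.
  by rewrite mulr_sumr; apply: eq_bigr => i _; rewrite mxE.
rewrite -mulrN; congr (_ * _); apply/eqP; rewrite -addr_eq0; apply/eqP; rewrite -[RHS]c1.
by congr (_ + _); apply: eq_bigr => i _; rewrite col_mxEu.
Qed.

End Eps.

(** Outer edges and outer potential do not depend on [eps], so one constant of [trace_solves] serves
    all [eps]; the norm of [psi] is bounded by that of [f] through the resolvent bound. *)
Lemma trace_bounds : exists2 T, 0 <= T & forall eps f psi psi1 j, 0 < eps ->
  full_solution eps f psi psi1 ->
  n1 (psi (inl j) 0) <= T * Defs.gnorm (fedges eps) f /\
  n1 (psi1 (inl j) 0) <= T * Defs.gnorm (fedges eps) f.
Proof.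
have [K [BK _]] := potential_bounds G.
have [T T0 HT] := trace_solves (@olen_gt0 _ _ G) (@Bout_meas _ _ G) BK z.
pose c := 2 * T * (`|cIm z|^-1 ^+ 2 + 1).
have c0 : 0 <= c by rewrite !mulr_ge0 // addr_ge0 ?sqr_ge0.
exists (Num.sqrt c); first exact: sqrtr_ge0.
move=> eps f psi psi1 j eps0 sol; have [f2 s bc] := sol.
have g0 := gnorm_ge0 (fedges eps) f.
have H : sqmod (psi (inl j) 0) + sqmod (psi1 (inl j) 0) <=
    T * (N2 (olen G) (fouter psi) + N2 (olen G) (fouter f)).
  apply: (HT (fouter f) (fouter psi) (fouter psi1) j); last by move=> i; exact: s (inl i).
  by have [] := (gL2_split eps f).1 f2.
have B1 : N2 (olen G) (fouter psi) <= `|cIm z|^-1 ^+ 2 * Defs.gnorm (fedges eps) f ^+ 2.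
  rewrite -gnorm_sqr -exprMn ler_sqr ?nnegrE ?gnorm_ge0 ?mulr_ge0 ?invr_ge0 //.
  apply: le_trans (full_bound eps0 sol); exact: gnorm_fouter.
have B2 : N2 (olen G) (fouter f) <= Defs.gnorm (fedges eps) f ^+ 2.
  by rewrite -gnorm_sqr ler_sqr ?nnegrE ?gnorm_ge0 // gnorm_fouter.
have S : sqmod (psi (inl j) 0) + sqmod (psi1 (inl j) 0) <=
    T * (`|cIm z|^-1 ^+ 2 + 1) * Defs.gnorm (fedges eps) f ^+ 2.
  apply: (le_trans H); rewrite -mulrA ler_wpM2l // mulrDl mul1r; exact: lerD.
have fin w : sqmod w <= T * (`|cIm z|^-1 ^+ 2 + 1) * Defs.gnorm (fedges eps) f ^+ 2 ->
    n1 w <= Num.sqrt c * Defs.gnorm (fedges eps) f.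
  move=> Hw; apply: sqrt_le_sqr; first by rewrite mulr_ge0 ?sqrtr_ge0.
  rewrite exprMn (sqr_sqrtr c0); apply: (le_trans (n1_le_sqmod _)).
  by rewrite /c -!mulrA ler_wpM2l // mulrA.
split; apply: fin; apply: le_trans S; first by rewrite lerDl sqmod_ge0.
by rewrite lerDr sqmod_ge0.
Qed.

(** The prefactor [eps ^ 2] meets the [eps^(-1/2)] of the dilation. The resulting [eps^(3/2)] is
    weakened to [eps], the size of the flux defect that it is added to. *)
Lemma pull_small : exists2 c, 0 <= c & forall eps f psi psi1, 0 < eps -> eps < 1 ->
  full_solution eps f psi psi1 ->
  \sum_e \int[leb]_(y in edge (iedges G e)) n1 (pull_rhs eps (finner psi) (finner f) e y) <=
  c * (eps * Defs.gnorm (fedges eps) f).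
Proof.
have [c c0 Hc] := pull_L1 G.
exists (n1 z * (c * `|cIm z|^-1) + c).
  by rewrite addr_ge0 // !mulr_ge0 ?n1_ge0 ?invr_ge0.
move=> eps f psi psi1 eps0 eps1 sol; have [f2 s bc] := sol.
have g0 := gnorm_ge0 (fedges eps) f.
have fi2 : gL2 (ell eps) (finner f) by have [] := (gL2_split eps f).1 f2.
have pi2 : gL2 (ell eps) (finner psi) by have [] := (gL2_split eps psi).1 (full_gL2 sol).
have s0 := sqrt_pos eps0.
pose sI := (Num.sqrt eps)^-1; have sI0 : 0 <= sI by rewrite invr_ge0 sqrtr_ge0.
have P1 : \sum_e \int[leb]_(y in edge (iedges G e)) n1 (pull eps (finner psi) e y) <=
    c * (sI * (`|cIm z|^-1 * Defs.gnorm (fedges eps) f)).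
  apply: (le_trans (Hc _ _ eps0 pi2)); rewrite ler_wpM2l // ler_wpM2l //.
  apply: le_trans (full_bound eps0 sol); exact: gnorm_finner.
have P2 : \sum_e \int[leb]_(y in edge (iedges G e)) n1 (pull eps (finner f) e y) <=
    c * (sI * Defs.gnorm (fedges eps) f).
  apply: (le_trans (Hc _ _ eps0 fi2)); rewrite ler_wpM2l // ler_wpM2l //.
  exact: gnorm_finner.
have edge_le e : \int[leb]_(y in edge (iedges G e)) n1 (pull_rhs eps (finner psi) (finner f) e y) <=
   eps ^+ 2 * (n1 z * \int[leb]_(y in edge (iedges G e)) n1 (pull eps (finner psi) e y) +
    \int[leb]_(y in edge (iedges G e)) n1 (pull eps (finner f) e y)).
  have me := measurable_edge (iedges G e).
  have ii H : gL2 (ell eps) H -> cint (edge (iedges G e)) (pull eps H e).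
    move=> H2; rewrite [edge _]edge_Some; apply: csq_cint; rewrite -edge_Some.
    by have /gL2E := gL2_pull eps0 H2; apply.
  have i1 := cint_n1 me (ii _ pi2); have i2 := cint_n1 me (ii _ fi2).
  rewrite -RintegralZl // -RintegralD //; last exact: integZ.
  rewrite -RintegralZl //; last by apply: integD => //; exact: integZ.
  apply: Rint_le => //.
  - apply: cint_n1 => //; rewrite [edge _]edge_Some; apply: csq_cint; rewrite -edge_Some.
    by have /gL2E := pull_rhs_gL2 eps0 sol; apply.
  - by apply: integZ => //; apply: integD => //; exact: integZ.
  move=> y ey; apply: (le_trans (n1M _ _)).
  rewrite n1_real ger0_norm ?sqr_ge0 // ler_wpM2l ?sqr_ge0 //.
  by apply: (le_trans (n1D _ _)); rewrite lerD2r; exact: n1M.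
apply: (le_trans (ler_sum _ (fun e _ => edge_le e))).
rewrite -mulr_sumr big_split /= -mulr_sumr.
set A := \sum_e _ in P1 *; set B := \sum_e _ in P2 *.
apply: (@le_trans _ _ (eps ^+ 2 * (n1 z * (c * (sI * (`|cIm z|^-1 * Defs.gnorm (fedges eps) f))) +
   c * (sI * Defs.gnorm (fedges eps) f)))).
  by rewrite ler_wpM2l ?sqr_ge0 // lerD // ler_wpM2l ?n1_ge0.
have -> : eps ^+ 2 * (n1 z * (c * (sI * (`|cIm z|^-1 * Defs.gnorm (fedges eps) f))) +
   c * (sI * Defs.gnorm (fedges eps) f)) =
   (n1 z * (c * `|cIm z|^-1) + c) * (eps * sI * (eps * Defs.gnorm (fedges eps) f)).
  by move: (Defs.gnorm _ _) => g; ring.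
apply: ler_wpM2l; first by rewrite addr_ge0 // !mulr_ge0 ?n1_ge0 ?invr_ge0.
apply: ler_piMl; first by rewrite mulr_ge0 // ltW.
rewrite -{1}(sqrt_sqr eps0) -mulrA mulfV ?gt_eqF // mulr1.
by rewrite -[leRHS]sqrtr1 ler_sqrt // ltW.
Qed.

End Rescaling.

Section InnerProducts.
Variables (R : realType) (I : finType) (l : I -> option R).
Local Notation leb := (@lebesgue_measure R).
Local Notation C := R[i].

Lemma gdot_lin (p f g : gfun R I) w : gL2 l p -> gL2 l f -> gL2 l g ->
  gdot l p (gaxpy w f g) = w * gdot l p f + gdot l p g.
Proof.
move=> /gL2E p2 /gL2E f2 /gL2E g2; rewrite /gdot mulr_sumr -big_split /=.
apply: eq_bigr => i _; have me := measurable_edge (l i).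
have pf := csq_mul me (csqJ me (p2 i)) (f2 i).
have pg := csq_mul me (csqJ me (p2 i)) (g2 i).
rewrite -cintegralZ // -cintegralD //; last exact: cintZ.
by apply: cintegral_ext => x _; rewrite /gaxpy mulrDr mulrCA.
Qed.

Lemma gdot_sum n (b : 'I_n -> C) (p : gfun R I) (q : 'I_n -> gfun R I) : gL2 l p ->
  (forall k, gL2 l (q k)) ->
  gdot l p (fun i x => \sum_k b k * q k i x) = \sum_k b k * gdot l p (q k).
Proof.
move=> /gL2E p2 q2; have {}q2 k i : csq (edge (l i)) (q k i) by have /gL2E := q2 k; apply.
rewrite /gdot; under [RHS]eq_bigr do rewrite mulr_sumr.
rewrite exchange_big; apply: eq_bigr => i _ /=; have me := measurable_edge (l i).
have pq k := csq_mul me (csqJ me (p2 i)) (q2 k i).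
under eq_bigr => k _ do rewrite -(cintegralZ _ me (pq k)).
rewrite -cintegral_sum // => [|k]; last exact: cintZ.
by apply: cintegral_ext => x _; rewrite mulr_sumr; apply: eq_bigr => k _; rewrite mulrCA.
Qed.

Lemma n1_gdot (p f : gfun R I) M : gL2 l p -> gL2 l f ->
  (forall i, l i != None) ->
  (forall i x, edge (l i) x -> n1 (p i x) <= M) ->
  n1 (gdot l p f) <= M * \sum_i \int[leb]_(x in edge (l i)) n1 (f i x).
Proof.
move=> /gL2E p2 /gL2E f2 lN pM; rewrite mulr_sumr; apply: (le_trans (n1_sum _ _ _)).
apply: ler_sum => i _; have me := measurable_edge (l i).
have pf := csq_mul me (csqJ me (p2 i)) (f2 i).
have cf : cint (edge (l i)) (f i).
  have := f2 i; have := lN i; case: (l i) => // a _.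
  by rewrite edge_Some; exact: csq_cint.
apply: (le_trans (n1_cintegral me pf)).
rewrite -RintegralZl //; last exact: cint_n1.
apply: Rint_le => //; [exact: cint_n1|by apply: integZ => //; exact: cint_n1|].
move=> x ex; apply: (le_trans (n1M _ _)).
by rewrite ler_wpM2r ?n1_ge0 //; rewrite n1J pM.
Qed.

End InnerProducts.

(** * Green's identity against zero-energy solutions *)

Section Green.
Variables (R : realType) (N : nat) (G : qgraph R N) (z : R[i]).
Local Notation leb := (@lebesgue_measure R).
Local Notation C := R[i].
Local Notation IE := ('I_N + iedge G)%type.
Local Notation ell eps := (iedges_eps (G := G) eps).
Local Notation deg j := (degree (iend G) (conn G j)).
Local Notation bv := (bvalues (iend G) (ilen G)).
Local Notation bd := (bderivs (iend G) (ilen G)).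

Lemma solves_gL2 (I : finType) (l : I -> option R) B w (F u u1 : gfun R I) :
  solves l B w F u u1 -> gL2 l u.
Proof. by move=> s; apply/gL2E => e; have [] := s e. Qed.

(** The expression [conj p * u1 - conj p1 * u] has derivative [- conj p * F], because both functions
    satisfy the equation at energy zero with the same real potential. *)
Lemma inner_green (F p p1 u u1 : gfun R (iedge G)) : gL2 (iedges G) F ->
  solves (iedges G) (Bin G) 0 (@gzero R _) p p1 -> solves (iedges G) (Bin G) 0 F u u1 ->
  gdot (iedges G) p F = \sum_v (cdot (bv p v) (bd u1 v) - cdot (bd p1 v) (bv u v)).
Proof.
move=> /gL2E F2 sp su; rewrite -inner_form; apply: eq_bigr => e _.
have [p2 _ pp pp1] := sp e; have [u2 _ pu pu1] := su e.
have ee : edge (iedges G e) (ilen G e) by rewrite /edge /= lexx ltW ?ilen_gt0.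
have me := measurable_edge (iedges G e).
have iF := csq_mul me (csqJ me p2) (F2 e).
have W : cprim (iedges G e) (fun x => (p e x)^* * u1 e x - (p1 e x)^* * u e x)
    (fun x => - ((p e x)^* * F e x)).
  apply: (cprim_ext _ _ (cprimB (cprim_mul (cprimJ pp) pu1) (cprim_mul (cprimJ pp1) pu))) => // x _.
  rewrite /gzero !subr0 rmorphM /=.
  rewrite [in RHS]conj_conjc.
  have -> : Complex (Bin G e x) (- 0) = (Bin G e x)%:C by apply: cext; rewrite //= oppr0.
  move: ((Bin G e x)%:C) (conjc (p e x)) (conjc (p1 e x)) (u e x) (u1 e x) (F e x) => a b c d f g.
  ring.
have := cprim_primitive W ee; rewrite -edge_Some cintegralN //.
move: (cintegral _ _) ((p e _)^* * u1 e _ - _) ((p e 0)^* * u1 e 0 - _) => X Y Z ->.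
by rewrite opprD opprK addrA subrr add0r.
Qed.

(** The end picked by [vertex_value] does not depend on the function, so one index serves all
    functions at once. *)
Lemma vertex_value_end (v : ivert G) : (0 < degree (iend G) v)%N ->
  exists i : 'I_(degree (iend G) v), forall psi : gfun R (iedge G),
    vertex_value (iend G) (ilen G) psi v = bv psi v i 0.
Proof.
move=> dv; rewrite /vertex_value; case: pickP => [h hv|none]; last first.
  by have := none (enum_val (Ordinal dv)); rewrite enum_valP.
exists (enum_rank_in hv h) => psi; rewrite mxE.
by rewrite enum_rankK_in.
Qed.

(** Non-connecting vertices cancel by symmetry of their conditions. At a connecting vertex both
    functions are continuous, so only total fluxes enter: that of [p] is zero and that of the
    rescaled solution is [- eps * psi1 (inl j) 0]. *)
Lemma solution_green eps (f psi psi1 : gfun R IE) (p p1 : gfun R (iedge G)) : 0 < eps ->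
  full_solution z eps f psi psi1 ->
  solves (iedges G) (Bin G) 0 (@gzero R _) p p1 -> bc_in p p1 ->
  gdot (iedges G) p (pull_rhs z eps (finner psi) (finner f)) =
  - (eps%:C * \sum_j (vertex_value (iend G) (ilen G) p (conn G j))^* * psi1 (inl j) 0).
Proof.
move=> eps0 sol sp [bcv bcc].
rewrite (inner_green (pull_rhs_gL2 eps0 sol) sp (pull_solves eps0 sol)).
rewrite (sum_conn _ (conn_inj (q:=G))) addrC big1 ?add0r => [|v vc]; last first.
  apply/eqP; rewrite subr_eq0; apply/eqP.
  apply: (vertex_sym (Pin_proj vc) (Thetain_sa vc) (bcv v vc)).
  exact: pull_bc_vert eps0 sol _ vc.
rewrite mulr_sumr -sumrN; apply: eq_bigr => j _.
have dj : (0 < deg j)%N by exact: conn_degree.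
have [i0 vi] := vertex_value_end dj.
have [c0 c1] := kirchhoff_const dj (bcc j).
have [u0 d1] := pull_conn sol j.
rewrite vi !cdotE.
rewrite (eq_bigr (fun i => (bv p (conn G j) i0 0)^* * bd (pull1 eps (finner psi1)) (conn G j) i 0)); last first.
  by move=> i _; rewrite (c0 i i0).
rewrite -mulr_sumr d1 (eq_bigr (fun i => (bd p1 (conn G j) i 0)^* * psi (inl j) 0)); last first.
  by move=> i _; rewrite u0.
rewrite -mulr_suml -rmorph_sum /= c1 rmorph0 mul0r subr0.
by rewrite mulrN mulrCA.
Qed.

End Green.

Section Estimates.
Variables (R : realType) (N : nat) (G : qgraph R N) (z : R[i]).
Local Notation leb := (@lebesgue_measure R).
Local Notation C := R[i].
Local Notation IE := ('I_N + iedge G)%type.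
Local Notation ell eps := (iedges_eps (G := G) eps).
Local Notation deg j := (degree (iend G) (conn G j)).
Local Notation bv := (bvalues (iend G) (ilen G)).
Local Notation bd := (bderivs (iend G) (ilen G)).
Local Notation nrm eps f := (Defs.gnorm (fedges eps) f).
Hypothesis z_nonreal : complex.Im z != 0.
Variables (m : nat) (phi : 'I_m -> gfun R (iedge G)).
Hypothesis phi_basis : zero_eigenbasis (iedges G) (Hin_ring G) phi.
Local Notation L := (cmat phi).

Lemma phi_gL2 k : gL2 (iedges G) (phi k).
Proof. by have [phi1 /(_ k)[/solves_gL2 ]] := eigen_solves phi_basis. Qed.

Lemma phi_bound : exists2 M, 0 <= M & forall k e x, edge (iedges G e) x -> n1 (phi k e x) <= M.
Proof.
have [phi1 H] := eigen_solves phi_basis; have [c c0 Hc] := inner_gronwall G.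
pose a k e := n1 (phi k e 0) + n1 (phi1 k e 0).
have a0 k e : 0 <= a k e by rewrite addr_ge0 ?n1_ge0.
exists (c * \sum_k \sum_e a k e).
  by rewrite mulr_ge0 // sumr_ge0 // => k _; rewrite sumr_ge0.
move=> k e x ex.
have := Hc _ _ _ _ _ (gL2_0 _) (H k).1 ex; rewrite Rint_n1_gzero addr0 => B.
apply: (@le_trans _ _ (c * a k e)); first by apply: le_trans B; rewrite lerDl n1_ge0.
rewrite ler_wpM2l //; apply: (le_trans (le_sum_term (f := a k) e (a0 k))).
by apply: (le_sum_term (f := fun k => \sum_e a k e)) => k'; rewrite sumr_ge0.
Qed.

(** [inner_decomp] is applied with flux defect [eps] times the bound for the outer derivatives. The
    second estimate is the first one evaluated at the connecting vertices. *)
Lemma expansion_phi : exists2 c, 0 <= c & forall eps f psi psi1, 0 < eps -> eps < 1 ->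
  full_solution z eps f psi psi1 -> exists b : 'cV[C]_m,
  (forall e y, edge (iedges G e) y ->
    n1 (pull eps (finner psi) e y - \sum_k b k 0 * phi k e y) <= c * (eps * nrm eps f)) /\
  (forall j, n1 (psi (inl j) 0 - (L *m b) j 0) <= c * (eps * nrm eps f)).
Proof.
have [c c0 Hc] := inner_decomp phi_basis; have [T T0 HT] := trace_bounds G z_nonreal.
have [p p0 Hp] := pull_small G z_nonreal.
exists (c * (T + p)); first by rewrite mulr_ge0 // addr_ge0.
move=> eps f psi psi1 eps0 eps1 sol; have g0 := gnorm_ge0 (fedges eps) f.
have [|j|j|b Hb] := Hc _ _ _ (eps * (T * nrm eps f)) (pull_rhs_gL2 eps0 sol)
  (pull_solves eps0 sol) (pull_bc_vert eps0 sol).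
- by rewrite !mulr_ge0 // ltW.
- apply: const_kirchhoff => [|i i']; first exact: conn_degree.
  by have [u0 _] := pull_conn sol j; rewrite !u0.
- have [_ ->] := pull_conn sol j; rewrite n1N; apply: (le_trans (n1M _ _)).
  rewrite n1_real (ger0_norm (ltW eps0)); apply: ler_wpM2l; first exact: ltW.
  by have [] := HT _ _ _ _ j eps0 sol.
have B e y : edge (iedges G e) y ->
    n1 (pull eps (finner psi) e y - \sum_k b k * phi k e y) <= c * (T + p) * (eps * nrm eps f).
  move=> /Hb /le_trans; apply; rewrite -mulrA ler_wpM2l //.
  rewrite mulrDl mulrCA lerD2l; exact: Hp sol.
exists (\col_k b k); split=> [e y ey|j].
  rewrite (eq_bigr (fun k => b k * phi k e y)); last by move=> k _; rewrite mxE.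
  exact: B.
have [|i vi] := @vertex_value_end _ _ G (conn G j); first exact: conn_degree.
have [u0 _] := pull_conn sol j.
have -> : (L *m \col_k b k) j 0 = \sum_k b k * bv (phi k) (conn G j) i 0.
  rewrite mxE; apply: eq_bigr => k _; have -> : L j k = bv (phi k) (conn G j) i 0.
    by rewrite -vi mxE mxE.
  by rewrite [X in _ * X]mxE mulrC.
(* The vertex value is read off at one end of an edge, a point where the uniform estimate holds. *)
rewrite -(u0 i); set h := enum_val i.
have hE (v : gfun R (iedge G)) : bv v (conn G j) i 0 = v h.1 (if h.2 then ilen G h.1 else 0).
  by rewrite mxE.
rewrite hE (eq_bigr (fun k => b k * phi k h.1 (if h.2 then ilen G h.1 else 0))); last first.
  by move=> k _; rewrite hE.
by apply: B; case: h.2; rewrite /edge /= ?lexx ltW ?ilen_gt0.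
Qed.

Definition moments (H : gfun R (iedge G)) : 'cV[C]_m := \col_k gdot (iedges G) (phi k) H.

Lemma mx_opp_linE (a b : C) (A B : 'cV[C]_m) k :
  (- (a *: (b *: A + B))) k 0 = - (a * (b * A k 0 + B k 0)).
Proof. by rewrite !mxE. Qed.

(** Green's identity divided by [eps]. It is exact and is used twice: its size controls the flux,
    and its image under the defect determines the inner coefficients. *)
Lemma flux_identity eps f psi psi1 : 0 < eps -> full_solution z eps f psi psi1 ->
  madj L *m (\col_j psi1 (inl j) 0) =
  - (eps%:C *: (z *: moments (pull eps (finner psi)) + moments (pull eps (finner f)))).
Proof.
move=> eps0 sol; have [f2 _ _] := sol.
have [phi1 H] := eigen_solves phi_basis.
have fi2 : gL2 (iedges G) (pull eps (finner f)).
  by apply: gL2_pull => //; have [] := (gL2_split eps f).1 f2.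
have pi2 : gL2 (iedges G) (pull eps (finner psi)).
  by apply: gL2_pull => //; have [] := (gL2_split eps psi).1 (full_gL2 sol).
apply/colP => k.
have := solution_green eps0 sol (H k).1 (H k).2.
have -> : pull_rhs z eps (finner psi) (finner f) =
    gaxpy (eps ^+ 2)%:C (gaxpy z (pull eps (finner psi)) (pull eps (finner f))) (@gzero R _).
  by apply/funext => e; apply/funext => y; rewrite /pull_rhs /gaxpy /gzero addr0.
have pk := phi_gL2 k.
rewrite gdot_lin ?gdot_lin //; [|exact: gL2_lin|exact: gL2_0].
have -> : gdot (iedges G) (phi k) (@gzero R _) = 0.
  by apply: big1 => e _; rewrite -[RHS](cintegral0 (edge (iedges G e))); apply: cintegral_ext => x _; rewrite /gzero mulr0.
have e0 : eps%:C != 0 :> C by rewrite fmorph_eq0 gt_eqF.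
rewrite addr0 rmorphXn /= expr2 -mulrA -mulrN => /(mulfI e0) E.
have -> : (- (eps%:C *: (z *: moments (pull eps (finner psi)) + moments (pull eps (finner f))))) k 0 =
    - (eps%:C * (z * gdot (iedges G) (phi k) (pull eps (finner psi)) +
     gdot (iedges G) (phi k) (pull eps (finner f)))).
  by rewrite mx_opp_linE !mxE.
rewrite E opprK mxE; apply: eq_bigr => j _.
by rewrite !mxE.
Qed.

Lemma moments_bound : exists2 c, 0 <= c & forall eps H k, 0 < eps -> gL2 (ell eps) H ->
  n1 (moments (pull eps H) k 0) <= c * ((Num.sqrt eps)^-1 * Defs.gnorm (ell eps) H).
Proof.
have [M M0 HM] := phi_bound; have [c c0 Hc] := pull_L1 G.
exists (M * c); first exact: mulr_ge0.
move=> eps H k eps0 H2; rewrite mxE -mulrA.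
apply: le_trans (ler_wpM2l M0 (Hc _ _ eps0 H2)).
by apply: n1_gdot => //; [exact: phi_gL2|exact: gL2_pull|exact: HM].
Qed.

(** The prefactor [eps] meets moments of order [eps^(-1/2)]. *)
Lemma flux_bound : exists2 c, 0 <= c & forall eps (f psi psi1 : gfun R IE) k, 0 < eps ->
  full_solution z eps f psi psi1 ->
  n1 ((madj L *m (\col_j psi1 (inl j) 0)) k 0) <= c * (Num.sqrt eps * nrm eps f).
Proof.
have [c c0 Hc] := moments_bound.
exists (c * (n1 z * `|complex.Im z|^-1 + 1)).
  by rewrite mulr_ge0 // addr_ge0 // mulr_ge0 ?n1_ge0 ?invr_ge0.
move=> eps f psi psi1 k eps0 sol; have [f2 _ _] := sol.
have g0 := gnorm_ge0 (fedges eps) f; have s0 := sqrt_pos eps0.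
have fi2 : gL2 (ell eps) (finner f) by have [] := (gL2_split eps f).1 f2.
have pi2 : gL2 (ell eps) (finner psi) by have [] := (gL2_split eps psi).1 (full_gL2 sol).
rewrite (flux_identity eps0 sol).
set a := moments (pull eps (finner psi)); set g := moments (pull eps (finner f)).
have -> : (- (eps%:C *: (z *: a + g))) k 0 = - (eps%:C * (z * a k 0 + g k 0)).
  exact: mx_opp_linE.
rewrite n1N; apply: (le_trans (n1M _ _)); rewrite n1_real (ger0_norm (ltW eps0)).
pose sI := (Num.sqrt eps)^-1; have sI0 : 0 <= sI by rewrite invr_ge0 ltW.
have A : n1 (a k 0) <= c * (sI * (`|complex.Im z|^-1 * nrm eps f)).
  apply: (le_trans (Hc _ _ k eps0 pi2)); rewrite ler_wpM2l // ler_wpM2l //.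
  apply: le_trans (full_bound z_nonreal eps0 sol); exact: gnorm_finner.
have B : n1 (g k 0) <= c * (sI * nrm eps f).
  apply: (le_trans (Hc _ _ k eps0 fi2)); rewrite ler_wpM2l // ler_wpM2l //.
  exact: gnorm_finner.
have S : n1 (z * a k 0 + g k 0) <=
    n1 z * (c * (sI * (`|complex.Im z|^-1 * nrm eps f))) + c * (sI * nrm eps f).
  apply: (le_trans (n1D _ _)); apply: lerD => //.
  by apply: (le_trans (n1M _ _)); rewrite ler_wpM2l ?n1_ge0.
apply: (le_trans (ler_wpM2l (ltW eps0) S)).
have E : eps * sI = Num.sqrt eps by rewrite -{1}(sqrt_sqr eps0) -mulrA mulfV ?mulr1 // gt_eqF.
rewrite -E le_eqVlt; apply/orP; left; apply/eqP.
by move: (nrm eps f) (`|complex.Im z|^-1) (n1 z) => x y w; ring.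
Qed.

End Estimates.

(** * Comparison with the limit operator, inside and outside *)

Section Comparison.
Variables (R : realType) (N : nat) (G : qgraph R N) (z : R[i]).
Local Notation leb := (@lebesgue_measure R).
Local Notation C := R[i].
Local Notation IE := ('I_N + iedge G)%type.
Local Notation ell eps := (iedges_eps (G := G) eps).
Local Notation nrm eps f := (Defs.gnorm (fedges eps) f).
Hypothesis z_nonreal : complex.Im z != 0.
Variables (m : nat) (phi : 'I_m -> gfun R (iedge G)).
Hypothesis phi_basis : zero_eigenbasis (iedges G) (Hin_ring G) phi.
Local Notation L := (cmat phi).

Lemma phi_eps_gL2 eps k : 0 < eps -> gL2 (ell eps) (phi_eps phi eps k).
Proof.
move=> eps0; have /gL2E p2 := phi_gL2 phi_basis k; apply/gL2E => e.
apply: csqZ; first exact: measurable_edge.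
have e0 : 0 < eps^-1 by rewrite invr_gt0.
have -> : (fun x => phi k e (x / eps)) = (fun x => phi k e (eps^-1 * x)).
  by apply/funext => x; rewrite mulrC.
apply: (csq_dil e0); rewrite /ilens mulrA mulVf ?mul1r ?gt_eqF //; exact: p2 e.
Qed.

Lemma gdot_phi_eps eps k H : 0 < eps -> gL2 (ell eps) H ->
  gdot (ell eps) (phi_eps phi eps k) H =
  (Num.sqrt eps)%:C * moments phi (pull eps H) k 0.
Proof.
move=> eps0 H2; rewrite mxE mulr_sumr; apply: eq_bigr => e _.
have me := measurable_edge (ell eps e); have me' := measurable_edge (iedges G e).
have /gL2E /(_ e) p2 := phi_eps_gL2 k eps0; have /gL2E /(_ e) h2 := H2.
have /gL2E /(_ e) q2 := phi_gL2 phi_basis k; have /gL2E /(_ e) g2 := gL2_pull eps0 H2.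
rewrite (cintegral_dil eps0 (csq_mul me (csqJ me p2) h2)).
have E y : conjc (phi_eps phi eps k e (eps * y)) * H e (eps * y) =
    (Num.sqrt eps)^-1%:C * (conjc (phi k e y) * pull eps H e y).
  rewrite /phi_eps mulrAC mulfV ?gt_eqF // mul1r rmorphM /= mulrA.
  by congr (_ * _ * _); apply: cext; rewrite //= oppr0.
rewrite (cintegral_ext (g := fun y => (Num.sqrt eps)^-1%:C * (conjc (phi k e y) * pull eps H e y))); last first.
  by move=> y _; exact: E.
rewrite (cintegralZ _ me' (csq_mul me' (csqJ me' q2) g2)) mulrA -rmorphM /=.
by rewrite -{1}(sqrt_sqr eps0) mulfK ?gt_eqF ?sqrtr_gt0.
Qed.

(** The normalization [eps^(-1/2)] of the rescaled eigenfunctions cancels the factor [eps^(1/2)] of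
    the scalar product, so the block has a pointwise form free of powers of [eps]. *)
Lemma inner_blockE (A : 'M[C]_m) eps H e x : 0 < eps -> gL2 (ell eps) H ->
  inner_block phi z (fun k k' => A k k') eps H e x =
  - z^-1 * \sum_k (A *m moments phi (pull eps H)) k 0 * phi k e (x / eps).
Proof.
move=> eps0 H2; rewrite /inner_block; congr (_ * _); apply: eq_bigr => k _.
rewrite mxE mulr_suml; apply: eq_bigr => k' _.
rewrite gdot_phi_eps // /phi_eps.
move: (A k k') (moments _ _ _ _) (phi k e _) => a b c.
have E : (Num.sqrt eps)^-1%:C * (Num.sqrt eps)%:C = 1 :> C.
  by rewrite -rmorphM /= mulVf ?gt_eqF ?sqrtr_gt0.
transitivity (a * b * c * ((Num.sqrt eps)^-1%:C * (Num.sqrt eps)%:C)); last first.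
  by rewrite E mulr1.
by move: ((Num.sqrt eps)^-1)%:C ((Num.sqrt eps)%:C) => t t'; ring.
Qed.

Variables (Phat Q : 'M[C]_N).
Hypotheses (oP : orth_projection Phat) (QK : Q *m (L *m madj L) = Phat)
  (PL : Phat *m L = L).
Local Notation Pi := (defect L Q).
Local Notation delta := ((L != 0)%:R : R).

(* [delta = 0] in the uncoupled case [L = 0]. *)
Lemma coupled_bound : exists2 c, 0 <= c & forall eps (f psi psi1 : gfun R IE) (b : 'cV[C]_m) c1,
  0 < eps -> eps < 1 -> 0 <= c1 -> full_solution z eps f psi psi1 ->
  (forall j, n1 (psi (inl j) 0 - (L *m b) j 0) <= c1 * (eps * nrm eps f)) ->
  forall j, n1 ((L *m b) j 0) <= (c + c1) * (delta * nrm eps f).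
Proof.
have [T T0 HT] := trace_bounds G z_nonreal; exists T => // eps f psi psi1 b c1 eps0 eps1 c10 sol H j.
have g0 := gnorm_ge0 (fedges eps) f.
have [->|_] := eqVneq L 0; first by rewrite mul0mx mxE n1_0 mul0r mulr0.
rewrite mul1r.
have -> : (L *m b) j 0 = psi (inl j) 0 - (psi (inl j) 0 - (L *m b) j 0) by rewrite subKr.
apply: (le_trans (n1B _ _)); rewrite mulrDl; apply: lerD.
  by have [] := HT _ _ _ _ j eps0 sol.
apply: (le_trans (H j)); rewrite ler_wpM2l // ler_piMl // ltW //.
Qed.

(** The difference splits into the error of the eigenfunction expansion and a combination of
    eigenfunctions with coefficient vector [v]; all of it is estimated pointwise, the gain from the
    short edges being added later. *)
Lemma inner_estimate : exists2 c, 0 <= c & forall eps (f psi psi1 : gfun R IE) e x,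
  0 < eps -> eps < 1 -> full_solution z eps f psi psi1 -> edge (ell eps e) x ->
  n1 (psi (inr e) x - inner_block phi z (fun k k' => Pi k k') eps (finner f) e x) <=
  c * ((eps + delta) * nrm eps f).
Proof.
have [c c0 Hc] := expansion_phi z_nonreal phi_basis.
have [M M0 HM] := phi_bound phi_basis; have [t t0 Ht] := coupled_bound.
have [a a0 Ha] := mulmx_n1 (madj L *m Q); have [d d0 Hd] := mulmx_n1 Pi.
pose len := \sum_e ilen G e.
have len0 : 0 <= len by rewrite sumr_ge0 // => e _; rewrite ltW ?ilen_gt0.
pose D := a * (t + c) + d * (M * (len * c)).
have D0 : 0 <= D by rewrite addr_ge0 // !mulr_ge0 // addr_ge0.
exists (c + m%:R * (D * M)); first by rewrite addr_ge0 // !mulr_ge0.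
move=> eps f psi psi1 e x eps0 eps1 sol ex.
have g0 := gnorm_ge0 (fedges eps) f.
have [b [Hu Hb]] := Hc _ _ _ _ eps0 eps1 sol.
have [f2 _ _] := sol.
have fi2 : gL2 (ell eps) (finner f) by have [] := (gL2_split eps f).1 f2.
have pi2 : gL2 (ell eps) (finner psi) by have [] := (gL2_split eps psi).1 (full_gL2 sol).
rewrite inner_blockE //; set y := x / eps.
have ey : edge (iedges G e) y by exact: inner_scale.
have xy : eps * y = x by rewrite mulrC divfK ?gt_eqF.
set u := pull eps (finner psi); set g := moments phi (pull eps (finner f)).
have -> : psi (inr e) x = u e y by rewrite /u /pull /finner xy.
have z0 : z != 0 by apply: contraNneq z_nonreal => ->.
pose v := b + z^-1 *: (Pi *m g).
(* Applying the defect to the flux identity gives [z^-1 Pi g = - Pi a], where [a] are the moments of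
   [u]. Hence [v] is [(1 - Pi) b], controlled by [L b], minus [Pi (a - b)], which is of order
   [eps]. *)
have vE : v = madj L *m Q *m (L *m b) - Pi *m (moments phi u - b).
  have := congr1 (mulmx Pi) (flux_identity phi_basis eps0 sol).
  rewrite mulmxA (defect_madj oP QK PL) mul0mx mulmxN -scalemxAr => /esym/eqP.
  rewrite oppr_eq0 scaler_eq0 fmorph_eq0 gt_eqF //= mulmxDr -scalemxAr addrC addr_eq0 => /eqP Eg.
  rewrite /v Eg scalerN scalerA mulVf // scale1r mulmxBr opprB addrA.
  congr (_ - _); rewrite /defect mulmxBl mul1mx -!mulmxA.
  by rewrite addrC subrK.
have -> : u e y - - z^-1 * \sum_k (Pi *m g) k 0 * phi k e y =
    (u e y - \sum_k b k 0 * phi k e y) + \sum_k v k 0 * phi k e y.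
  rewrite mulNr opprK -addrA; congr (_ + _); rewrite mulr_sumr -sumrN -big_split /=.
  apply: eq_bigr => k _; have -> : v k 0 = b k 0 + z^-1 * (Pi *m g) k 0.
    by rewrite /v mxE; congr (_ + _); rewrite mxE.
  move: (b k 0) (z^-1) ((Pi *m g) k 0) (phi k e y) => p q r s; ring.
have w2 : gL2 (iedges G) (gsub u (fun e y => \sum_k b k 0 * phi k e y)).
  apply: gL2_sub; first exact: gL2_pull.
  apply/gL2E => e'; have me := measurable_edge (iedges G e').
  apply: csq_sum => // k; apply: csqZ => //.
  by have /gL2E := phi_gL2 phi_basis k; apply.
(* By orthonormality [b] is the vector of moments of the expansion, so [a - b] are the moments of
   the expansion error. *)
have ab k : n1 ((moments phi u - b) k 0) <= M * (len * (c * (eps * nrm eps f))).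
  have -> : (moments phi u - b) k 0 =
      gdot (iedges G) (phi k) (gsub u (fun e y => \sum_k b k 0 * phi k e y)).
    have -> : gsub u (fun e y => \sum_k b k 0 * phi k e y) =
        gaxpy (-1) (fun e y => \sum_k b k 0 * phi k e y) u.
      by apply/funext => i; apply/funext => s; rewrite /gsub /gaxpy mulN1r addrC.
    rewrite gdot_lin; [|exact: phi_gL2| |exact: gL2_pull]; last first.
      apply/gL2E => e'; have me := measurable_edge (iedges G e').
      apply: csq_sum => // k'; apply: csqZ => //.
      by have /gL2E := phi_gL2 phi_basis k'; apply.
    rewrite (gdot_sum (fun k => b k 0)) => [|//|k']; [|exact: phi_gL2|exact: phi_gL2].
    have [_ on _] := phi_basis.
    rewrite (bigD1 k) //= on eqxx mulr1 big1 => [|k' kk']; last first.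
      by rewrite on eq_sym (negbTE kk') mulr0.
    by rewrite addr0 mulN1r addrC [LHS]mxE [X in X + _]mxE [X in _ + X]mxE.
  apply: (le_trans (n1_gdot (phi_gL2 phi_basis k) w2 _ (HM k))) => //.
  rewrite ler_wpM2l // mulr_suml; apply: ler_sum => e' _.
  have l0 : 0 <= ilen G e' by rewrite ltW ?ilen_gt0.
  rewrite mulrC -[X in _ * X]subr0 -(Rint_cst _ l0) [edge _]edge_Some.
  apply: Rint_le => //.
  - apply: cint_n1 => //; apply: csq_cint; rewrite -edge_Some.
    by have /gL2E := w2; apply.
  - by apply: (integ_bounded (C := `|c * (eps * nrm eps f)|)) => //; exact: measurable_cst.
  by move=> s /itv0_edge es; exact: Hu.
have vM k : n1 (v k 0) <= D * ((eps + delta) * nrm eps f).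
  rewrite vE.
  have -> : (madj L *m Q *m (L *m b) - Pi *m (moments phi u - b)) k 0 =
    (madj L *m Q *m (L *m b)) k 0 - (Pi *m (moments phi u - b)) k 0.
    by rewrite mxE; congr (_ + _); rewrite mxE.
  apply: (le_trans (n1B _ _)); rewrite /D mulrDl; apply: lerD.
    have := Ha (L *m b) ((t + c) * (delta * nrm eps f)) _ _ k.
    move=> /(_ _ _)/le_trans; apply.
    - by rewrite !mulr_ge0 // addr_ge0.
    - by move=> j; exact: (Ht _ _ _ _ b c eps0 eps1 c0 sol Hb j).
    rewrite -!mulrA ler_wpM2l // ler_wpM2l ?addr_ge0 // mulrDl lerDr mulr_ge0 // ltW //.
  have := Hd (moments phi u - b) (M * (len * (c * (eps * nrm eps f)))) _ ab k.
  move=> /(_ _)/le_trans; apply; first by rewrite !mulr_ge0 // ltW.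
  rewrite -!mulrA; do 4 (apply: ler_wpM2l => //).
  by rewrite mulrDl lerDl mulr_ge0.
apply: (le_trans (n1D _ _)); rewrite [leRHS]mulrDl; apply: lerD.
  apply: (le_trans (Hu _ _ ey)); rewrite ler_wpM2l // mulrDl lerDl mulr_ge0 //.
apply: (le_trans (n1_sum _ _ _)).
apply: (@le_trans _ _ (\sum_(k < m) D * ((eps + delta) * nrm eps f) * M)).
  apply: ler_sum => k _; apply: (le_trans (n1M _ _)).
  by apply: ler_pM; rewrite ?n1_ge0 // HM.
rewrite sumr_const card_ord -[leLHS]mulr_natl le_eqVlt; apply/orP; left; apply/eqP.
by move: (nrm eps f) (delta) (m%:R : R) => p q r; ring.
Qed.

Lemma cdotDr n (a b c : 'cV[C]_n) : cdot a (b + c) = cdot a b + cdot a c.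
Proof.
rewrite !cdotE -big_split; apply: eq_bigr => i _ /=.
by rewrite mxE mulrDr.
Qed.

Lemma n1_cdot n (a b : 'cV[C]_n) A B : 0 <= A -> (forall i, n1 (a i 0) <= A) ->
  (forall i, n1 (b i 0) <= B) -> n1 (cdot a b) <= n%:R * (A * B).
Proof.
move=> A0 aA bB; rewrite cdotE; apply: (le_trans (n1_sum _ _ _)).
apply: (@le_trans _ _ (\sum_(i < n) A * B)); last first.
  by rewrite sumr_const card_ord mulr_natl.
apply: ler_sum => i _; apply: (le_trans (n1M _ _)).
by apply: ler_pM; rewrite ?n1_ge0 ?n1J // aA.
Qed.

(** The difference [w] solves the equation with zero source and the same conditions at the far ends,
    so its norm is controlled by the boundary form at the origin. Splitting by [Phat] puts a small
    factor in each term; the other factor is a trace of [w], bounded by the norm of [w], and one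
    power of that norm cancels. *)
Lemma outer_estimate : exists2 c, 0 <= c & forall eps (f psi psi1 : gfun R IE) chi chi1,
  0 < eps -> eps < 1 -> full_solution z eps f psi psi1 ->
  solves (olen G) (Bout G) z (fouter f) chi chi1 -> bc_hat G Phat chi chi1 ->
  Defs.gnorm (olen G) (gsub (fouter psi) chi) <=
  c * ((eps + delta * Num.sqrt eps) * nrm eps f).
Proof.
have [PP adP] := oP.
have [c c0 Hc] := expansion_phi z_nonreal phi_basis.
have [h h0 Hh] := flux_bound z_nonreal phi_basis.
have [a a0 Ha] := mulmx_n1 (1%:M - Phat); have [d d0 Hd] := mulmx_n1 (Q *m L).
have [K [BK _]] := potential_bounds G.
have [T T0 HT] := trace_solves (@olen_gt0 _ _ G) (@Bout_meas _ _ G) BK z.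
pose t := Num.sqrt (2 * T); have t0 : 0 <= t := sqrtr_ge0 _.
pose I := `|complex.Im z|; have I0 : 0 < I by rewrite normr_gt0.
pose D := N%:R * (t * (d * h)) + N%:R * (t * (a * c)).
have D0 : 0 <= D by rewrite addr_ge0 // !mulr_ge0.
exists (I^-1 * (2 * D)); first by rewrite !mulr_ge0 // invr_ge0 ltW.
move=> eps f psi psi1 chi chi1 eps0 eps1 sol sc [bo bz].
have g0 := gnorm_ge0 (fedges eps) f; have [f2 s [_ bs _]] := sol.
have fo2 : gL2 (olen G) (fouter f) by have [] := (gL2_split eps f).1 f2.
have [b [_ Hb]] := Hc _ _ _ _ eps0 eps1 sol.
have s0 := sqrt_pos eps0.
set w := gsub (fouter psi) chi; pose w1 := gsub (fouter psi1) chi1.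
have sw : solves (olen G) (Bout G) z (@gzero R _) w w1.
  have so : solves (olen G) (Bout G) z (fouter f) (fouter psi) (fouter psi1).
    by move=> i; exact: s (inl i).
  have := solves_sub so sc.
  have -> : gsub (fouter f) (fouter f) = @gzero R _; last by [].
  by apply/funext => i; apply/funext => x; rewrite /gsub /gzero subrr.
have gs (A B : gfun R 'I_N) : gsub A B = gaxpy (-1) B A.
  by apply/funext => i; apply/funext => x; rewrite /gsub /gaxpy mulN1r addrC.
have bw : bc_Vout G w w1.
  apply/vres_outP => j oj; rewrite /w /w1 !gs vres_out_lin.
  by move/vres_outP: bo => /(_ j oj) ->; move/vres_outP: bs => /(_ j oj) ->; rewrite scaler0 addr0.
set X := Defs.gnorm (olen G) w; have X0 : 0 <= X := gnorm_ge0 _ _.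
have tr j : n1 (w j 0) <= t * X /\ n1 (w1 j 0) <= t * X.
  have H := HT _ _ _ j (gL2_0 _) sw; rewrite N2Z0 addr0 -gnorm_sqr -/X in H.
  have fin q : sqmod q <= T * X ^+ 2 -> n1 q <= t * X.
    move=> Hq; apply: sqrt_le_sqr; first exact: mulr_ge0.
    rewrite exprMn sqr_sqrtr ?mulr_ge0 //; apply: (le_trans (n1_le_sqmod _)).
    by rewrite -mulrA ler_wpM2l.
  by split; apply: fin; apply: le_trans H; rewrite ?lerDl ?lerDr sqmod_ge0.
have [z1 z2] := bz; rewrite mul0mx subr0 in z2.
have vsub (A B : gfun R 'I_N) : values0 (gsub A B) = values0 A - values0 B.
  by apply/colP => j; rewrite !mxE.
pose r := eps * nrm eps f; have r0 : 0 <= r by rewrite mulr_ge0 // ltW.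
(* [1 - Phat] annihilates the trace of [chi] and the range of [L], so only the error of
   [psi(0) = L b] survives. *)
have B1 i : n1 (((1%:M - Phat) *m values0 w) i 0) <= a * (c * r).
  have -> : (1%:M - Phat) *m values0 w = (1%:M - Phat) *m (values0 (fouter psi) - L *m b).
    have PL0 : (1%:M - Phat) *m (L *m b) = 0.
      by rewrite mulmxA mulmxBl mul1mx PL subrr mul0mx.
    by rewrite vsub !mulmxBr z1 PL0.
  apply: Ha; first exact: mulr_ge0.
  move=> j; have -> : (values0 (fouter psi) - L *m b) j 0 = psi (inl j) 0 - (L *m b) j 0.
    by rewrite mxE; congr (_ + _); rewrite mxE.
  exact: Hb.
(* [Phat] annihilates the derivative of [chi], and [Phat = Q L L^*] brings in the flux
   [L^* psi'(0)]; the term is absent when [L = 0]. *)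
have B2 i : n1 ((Phat *m values0 w1) i 0) <= d * (h * (delta * (Num.sqrt eps * nrm eps f))).
  have -> : Phat *m values0 w1 = Q *m L *m (madj L *m (\col_j psi1 (inl j) 0)).
    rewrite vsub mulmxBr z2 subr0 -QK -!mulmxA; congr (_ *m (_ *m (_ *m _))).
  have [L0|_] := eqVneq L 0.
    by rewrite L0 mulmx0 !mul0mx mxE n1_0 !mul0r !mulr0.
  rewrite mul1r; apply: Hd; first by rewrite !mulr_ge0 // ltW.
  by move=> j; exact: (Hh eps f psi psi1 j eps0 sol).
have bf : `|bform (olen G) w w1| <= X * (D * ((eps + delta * Num.sqrt eps) * nrm eps f)).
  rewrite bform_out //; set v := values0 w; set v1 := values0 w1.
  have -> : cdot v v1 = cdot v (Phat *m v1) + cdot ((1%:M - Phat) *m v) v1.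
    have ad1 : adjmx (1%:M - Phat) = 1%:M - Phat.
      by rewrite -[adjmx _]/(madj _) madjB madj1 -[madj Phat]/(adjmx _) adP.
    rewrite -ad1 -cdot_adj -cdotDr mulmxBl mul1mx addrC subrK //.
  set q := _ + _; apply: (@le_trans _ _ (n1 q)); first by rewrite /n1 lerDr.
  rewrite /q; apply: (le_trans (n1D _ _)).
  have E1 : n1 (cdot v (Phat *m v1)) <=
      N%:R * (t * X * (d * (h * (delta * (Num.sqrt eps * nrm eps f))))).
    apply: n1_cdot => // [|i]; first exact: mulr_ge0.
    by rewrite mxE; have [] := tr i.
  have E2 : n1 (cdot ((1%:M - Phat) *m v) v1) <= N%:R * (a * (c * r) * (t * X)).
    apply: n1_cdot => // [|i]; first by do 2 (apply: mulr_ge0 => //).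
    by rewrite mxE; have [] := tr i.
  apply: (le_trans (lerD E1 E2)); rewrite /D /r.
  have dl0 : 0 <= delta by [].
  have F1 : 0 <= N%:R * (t * X * (d * h)) * (eps * nrm eps f).
    by rewrite !mulr_ge0 // ltW.
  have F2 : 0 <= N%:R * (t * X * (a * c)) * (delta * Num.sqrt eps * nrm eps f).
    by rewrite !mulr_ge0 // ltW.
  move: F1 F2; move: (nrm eps f) (delta) (Num.sqrt eps) (N%:R : R) => p q' l n'.
  move=> F1 F2; rewrite -subr_ge0; apply: (le_trans (addr_ge0 F1 F2)).
  rewrite le_eqVlt; apply/orP; left; apply/eqP; ring.
have := apriori (@olen_gt0 _ _ G) (@Bout_meas _ _ G) BK (gL2_0 _) sw.
rewrite N2Z0 add0r -gnorm_sqr -/X -/I => H.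
set Y := D * _ in bf *; have Y0 : 0 <= Y.
  by rewrite mulr_ge0 // mulr_ge0 // addr_ge0 ?mulr_ge0 // ltW.
have {}H : I ^+ 2 * X ^+ 2 <= 2 * (I * (X * Y)).
  by rewrite -normrX ger0_norm ?sqr_ge0 //; apply: (le_trans H); rewrite ler_wpM2l // ler_wpM2l // ltW.
have -> : I^-1 * (2 * D) * ((eps + delta * Num.sqrt eps) * nrm eps f) = I^-1 * (2 * Y).
  by rewrite /Y; move: (_ * nrm eps f) => q; ring.
(* The inequality is quadratic in [X] on the left and linear on the right; dividing by [X] requires
   it to be nonzero. *)
have [->|Xn] := eqVneq X 0.
  by apply: mulr_ge0; [rewrite invr_ge0 ltW|apply: mulr_ge0].
have Xp : 0 < X by rewrite lt_def Xn.
rewrite mulrC ler_pdivlMr // -(ler_pM2l Xp) -(ler_pM2l I0).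
apply: le_trans (le_trans H _); rewrite le_eqVlt; apply/orP; left; apply/eqP; ring.
Qed.

End Comparison.

Lemma ae_imp2 (R : realType) (P Q S : R -> Prop) : (forall x, P x -> Q x -> S x) ->
  {ae @lebesgue_measure R, forall x, P x} -> {ae @lebesgue_measure R, forall x, Q x} ->
  {ae @lebesgue_measure R, forall x, S x}.
Proof.
move=> H aP aQ.
apply: (negligibleS _ (negligibleU aP aQ)) => x nS; apply: contrapT => /not_orP[nP nQ].
by apply: nS; apply: H; exact: contrapT.
Qed.

(** [resolvent] is a choice among representatives, so linearity follows from uniqueness and holds
    almost everywhere only. *)
Lemma schr_resolvent_lin (R : realType) (I : finType) (l : I -> option R) (B : I -> R -> R)
  (K : R) (bc : gfun R I -> gfun R I -> Prop) (z c : R[i]) (f g : gfun R I) :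
  (forall i, measurable_fun (edge (l i)) (B i)) ->
  (forall i x, edge (l i) x -> `|B i x| <= K) ->
  (forall psi psi1 chi chi1, bc psi psi1 -> bc chi chi1 ->
    bc (gaxpy c psi chi) (gaxpy c psi1 chi1)) ->
  resolvent_set l (schrodinger l B bc) z -> gL2 l f -> gL2 l g ->
  geq_ae l (resolvent (schrodinger l B bc) z (gaxpy c f g))
    (gaxpy c (resolvent (schrodinger l B bc) z f) (resolvent (schrodinger l B bc) z g)).
Proof.
move=> mB BK lin rs f2 g2; have fg2 := gL2_lin c f2 g2.
have [_ uniq _] := rs; apply: (uniq _ _ _ fg2); first exact: (resolventP rs fg2).
have /(schrE mB BK bc z _ f2)[p1 s1 b1] := resolventP rs f2.
have /(schrE mB BK bc z _ g2)[p2 s2 b2] := resolventP rs g2.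
apply/(schrE mB BK bc z _ fg2); exists (gaxpy c p1 p2); first exact: solves_lin.
exact: lin.
Qed.

(** * Assembly of the resolvent expansion *)

Section Expansion.
Variables (R : realType) (N : nat) (G : qgraph R N) (z : R[i]).
Local Notation C := R[i].
Local Notation IE := ('I_N + iedge G)%type.
Local Notation ell eps := (iedges_eps (G := G) eps).
Local Notation nrm eps f := (Defs.gnorm (fedges eps) f).
Hypothesis z_nonreal : complex.Im z != 0.

Lemma full_resolvent eps (f : gfun R IE) : 0 < eps -> gL2 (fedges eps) f ->
  exists psi1, full_solution z eps f (resolvent (@Hfull R N G eps) z f) psi1.
Proof.
move=> eps0 f2; have [M BM] := Bfull_le G eps0.
have rs := Hfull_resolvent_set G eps0 z_nonreal.
have /(schrE (@Bfull_meas _ _ G eps eps0) BM (@bc_full _ _ G eps) z _ f2)[p s b] := resolventP rs f2.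
by exists p.
Qed.

Lemma full_resolvent_lin eps c (f g : gfun R IE) : 0 < eps ->
  gL2 (fedges eps) f -> gL2 (fedges eps) g ->
  geq_ae (fedges eps) (resolvent (@Hfull R N G eps) z (gaxpy c f g))
    (gaxpy c (resolvent (@Hfull R N G eps) z f) (resolvent (@Hfull R N G eps) z g)).
Proof.
move=> eps0; have [M BM] := Bfull_le G eps0.
apply: (schr_resolvent_lin (@Bfull_meas _ _ G eps eps0) BM) => [psi psi1 chi chi1|].
  move=> /bc_fullE b1 /bc_fullE b2; apply/bc_fullE => h ah.
  by rewrite res_full_lin b1 // b2 // mulr0 addr0.
exact: (Hfull_resolvent_set G eps0 z_nonreal).
Qed.

Variable Phat : 'M[C]_N.
Hypothesis oP : orth_projection Phat.

Lemma hat_resolvent (f : gfun R 'I_N) : gL2 (olen G) f ->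
  exists2 chi1, solves (olen G) (Bout G) z f (resolvent (Hout_hat G Phat) z f) chi1
    & bc_hat G Phat (resolvent (Hout_hat G Phat) z f) chi1.
Proof.
move=> f2; have [K [BK _]] := potential_bounds G.
have rs := Hout_hat_resolvent_set G oP z_nonreal.
by have /(schrE (@Bout_meas _ _ G) BK (bc_hat G Phat) z _ f2) := resolventP rs f2.
Qed.

Lemma hat_resolvent_lin c (f g : gfun R 'I_N) : gL2 (olen G) f -> gL2 (olen G) g ->
  geq_ae (olen G) (resolvent (Hout_hat G Phat) z (gaxpy c f g))
    (gaxpy c (resolvent (Hout_hat G Phat) z f) (resolvent (Hout_hat G Phat) z g)).
Proof.
have [K [BK _]] := potential_bounds G.
apply: (schr_resolvent_lin (@Bout_meas _ _ G) BK) => [psi psi1 chi chi1|].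
  move=> /(bc_hatE G oP) b1 /(bc_hatE G oP) b2; apply/(bc_hatE G oP) => h ah.
  by rewrite res_hat_lin b1 // b2 // mulr0 addr0.
exact: (Hout_hat_resolvent_set G oP z_nonreal).
Qed.

Variables (m : nat) (phi : 'I_m -> gfun R (iedge G)).
Hypothesis phi_basis : zero_eigenbasis (iedges G) (Hin_ring G) phi.
Local Notation L := (cmat phi).

Lemma inner_block_lin q eps c (f g : gfun R (iedge G)) e x : 0 < eps ->
  gL2 (ell eps) f -> gL2 (ell eps) g ->
  inner_block phi z q eps (gaxpy c f g) e x =
  c * inner_block phi z q eps f e x + inner_block phi z q eps g e x.
Proof.
move=> eps0 f2 g2; rewrite /inner_block mulrCA -mulrDr; congr (_ * _).
rewrite mulr_sumr -big_split; apply: eq_bigr => k _ /=.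
rewrite mulr_sumr -big_split; apply: eq_bigr => k' _ /=.
rewrite gdot_lin //; last exact: phi_eps_gL2.
by rewrite mulrDr mulrCA.
Qed.

Lemma inner_block_gL2 q eps (f : gfun R (iedge G)) : 0 < eps ->
  gL2 (ell eps) (inner_block phi z q eps f).
Proof.
move=> eps0; apply/gL2E => e; have me := measurable_edge (ell eps e).
apply: csqZ => //; apply: csq_sum => // k; apply: csq_sum => // k'.
apply: (csq_ext (f := fun x => (q k k' * gdot (ell eps) (phi_eps phi eps k') f) * phi_eps phi eps k e x)) => //.
  by move=> x _; rewrite mulrAC.
by apply: csqZ => //; have /gL2E := phi_eps_gL2 phi_basis k eps0; apply.
Qed.

Variable Q : 'M[C]_N.
Hypotheses (QK : Q *m (L *m madj L) = Phat) (PL : Phat *m L = L).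

Definition remainder (q : 'I_m -> 'I_m -> C) eps (f : gfun R IE) : gfun R IE :=
  gsub (resolvent (@Hfull R N G eps) z f)
    (blockdiag (resolvent (Hout_hat G Phat) z) (inner_block phi z q eps) f).

Lemma remainder_lin q eps c f g : 0 < eps -> gL2 (fedges eps) f -> gL2 (fedges eps) g ->
  geq_ae (fedges eps) (remainder q eps (gaxpy c f g))
    (gaxpy c (remainder q eps f) (remainder q eps g)).
Proof.
move=> eps0 f2 g2; have H := full_resolvent_lin c eps0 f2 g2.
have [fo fi] := (gL2_split eps f).1 f2; have [go gi] := (gL2_split eps g).1 g2.
have split_sub (a b p p' r r' : C) : a = c * p + r -> b = c * p' + r' ->
    a - b = c * (p - p') + (r - r').
  by move=> -> ->; ring.
case=> [j|e].
  have H' := hat_resolvent_lin c fo go j.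
  apply: (ae_imp2 _ (H (inl j)) H') => x h h' xj.
  by apply: split_sub; [exact: h|exact: h'].
apply: ae_imp (H (inr e)) => x h xe.
apply: split_sub; first exact: h.
exact: inner_block_lin.
Qed.

Lemma remainder_gL2 q eps f : 0 < eps -> gL2 (fedges eps) f ->
  gL2 (fedges eps) (remainder q eps f).
Proof.
move=> eps0 f2; have [psi1 sol] := full_resolvent eps0 f2.
have [fo fi] := (gL2_split eps f).1 f2; have [chi1 sc _] := hat_resolvent fo.
apply: gL2_sub; first exact: full_gL2 sol.
by apply/gL2_split; split; [exact: solves_gL2 sc|exact: inner_block_gL2].
Qed.

(** The short edges multiply the inner pointwise error [eps + delta] by [eps^(1/2)], where [delta]
    is [1] if [L != 0] and [0] otherwise; the product is at most the outer error
    [eps + delta eps^(1/2)]. *)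
Lemma remainder_bound q : (forall k k', q k k' = defect L Q k k') ->
  exists2 c, 0 <= c & forall eps f, 0 < eps -> eps < 1 -> gL2 (fedges eps) f ->
  nrm eps (remainder q eps f) <= c * ((eps + (L != 0)%:R * Num.sqrt eps) * nrm eps f).
Proof.
move=> qE; have {qE}-> : q = fun k k' => defect L Q k k'.
  by apply/funext => k; apply/funext => k'.
have [a a0 Ha] := outer_estimate z_nonreal phi_basis oP QK PL.
have [b b0 Hb] := inner_estimate z_nonreal phi_basis oP QK PL.
have [d d0 Hd] := gnorm_sup G.
exists (a + d * b); first by rewrite addr_ge0 // mulr_ge0.
move=> eps f eps0 eps1 f2; have [psi1 sol] := full_resolvent eps0 f2.
have g0 := gnorm_ge0 (fedges eps) f.
have [fo fi] := (gL2_split eps f).1 f2; have [chi1 sc bc] := hat_resolvent fo.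
apply: (le_trans (gnorm_split _ _)); rewrite [leRHS]mulrDl; apply: lerD.
  exact: Ha _ _ _ _ _ _ eps0 eps1 sol sc bc.
set q' := fun k k' => _.
have rL := (gL2_split eps _).1 (remainder_gL2 q' eps0 f2).
set M := b * ((eps + (L != 0)%:R) * nrm eps f).
have M0 : 0 <= M by rewrite mulr_ge0 // mulr_ge0 // addr_ge0 // ltW.
have := Hd eps _ M eps0 M0 rL.2 (fun e x xe => Hb _ _ _ _ _ _ eps0 eps1 sol xe).
move=> /le_trans; apply; rewrite -mulrA ler_wpM2l // /M mulrCA ler_wpM2l // mulrA.
rewrite ler_wpM2r // mulrDr (mulrC _ (_%:R)) lerD2r; apply: ler_piMl; first exact: ltW.
by rewrite -[leRHS]sqrtr1 ler_sqrt // ltW.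
Qed.

(** The exponent is chosen only here, by comparing the common error with [eps^a]; the estimates hold
    for all [eps < 1], whence the threshold [1]. *)
Lemma expansion_of q a : (forall k k', q k k' = defect L Q k k') ->
  (exists c, forall eps, 0 < eps -> eps < 1 ->
    eps + (L != 0)%:R * Num.sqrt eps <= c * eps `^ a) ->
  resolvent_expansion z (Hout_hat G Phat) (inner_block phi z q) a.
Proof.
move=> qE [c Hc]; split; first exact: (Hout_hat_resolvent_set G oP z_nonreal).
  by move=> eps eps0 _; exact: (Hfull_resolvent_set G eps0 z_nonreal).
have [d d0 Hd] := remainder_bound qE.
exists (d * c), 1; split=> // eps eps0 eps1 _; split=> [w f g f2 g2|f f2|f f2].
- exact: remainder_lin.
- exact: remainder_gL2.
apply: (le_trans (Hd _ _ eps0 eps1 f2)).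
rewrite -!mulrA ler_wpM2l // mulrA ler_wpM2r ?gnorm_ge0 //; exact: Hc.
Qed.

End Expansion.

Theorem theorem2p13 (R : realType) (N : nat) (G : qgraph R N) (z : R[i])
    (m : nat) (phi : 'I_m -> gfun R (iedge G)) (Phat : 'M[R[i]]_N)
    (z_nonreal : complex.Im z != 0)
    (non_generic : has_eigenvalue (iedges G) (Hin_ring G) 0)
    (phi_basis : zero_eigenbasis (iedges G) (Hin_ring G) phi)
    (Phat_proj : orth_projection Phat)
    (Phat_ran : mxran Phat = mxran (Chat phi)) :
  [/\ mxker (Chat phi) `<` [set: 'cV[R[i]]_N] ->
        set_bij (mxran Phat) (mxran Phat) (mulmx (Chat phi)) /\
        resolvent_expansion z (Hout_hat G Phat)
          (inner_block phi z (coef phi Phat)) 2^-1,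
      mxker (Chat phi) = [set: 'cV[R[i]]_N] ->
        [/\ Phat = 0, Hout_hat G Phat = Hout_ring G
          & resolvent_expansion z (Hout_ring G)
              (inner_block phi z (fun k k' => (k == k')%:R)) 1]
    & free [seq cvec phi k | k <- enum 'I_m] ->
        (forall k k', coef phi Phat k k' = 0) /\
        resolvent_expansion z (Hout_hat G Phat)
          (fun _ _ => gzero (I := iedge G)) 2^-1].
Proof.
have ranK : mxran Phat = mxran (cmat phi *m madj (cmat phi)) by rewrite -ChatE.
have [Q [QK KQ PL]] := low_rank_factor Phat_proj ranK.
have QK' : Q *m Chat phi = Phat by rewrite ChatE.
have KQ' : Chat phi *m madj Q = Phat by rewrite ChatE.
have cE := coef_defect Phat_proj QK' KQ' PL.
(* For [eps < 1] both summands are at most [eps^(1/2)], which gives the constant [2]. *)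
have half : exists c, forall eps : R, 0 < eps -> eps < 1 ->
    eps + (cmat phi != 0)%:R * Num.sqrt eps <= c * eps `^ 2^-1.
  exists 2 => eps eps0 eps1; rewrite (powR12_sqrt (ltW eps0)) mulr2n mulrDl !mul1r.
  have s1 : Num.sqrt eps <= 1 by rewrite -[leRHS]sqrtr1 ler_sqrt // ltW.
  apply: lerD; last by case: (_ != 0); rewrite ?mul1r ?mul0r ?sqrtr_ge0.
  by rewrite -{1}(sqrt_sqr eps0) ler_piMl ?sqrtr_ge0.
have main := expansion_of z_nonreal Phat_proj phi_basis QK PL cE half.
split=> [_|kK|fr].
- split; last exact: main.
  exact: (Chat_bij Phat_proj Phat_ran QK' KQ' PL).
- have [L0 P0] := Chat_ker_full Phat_ran kK.
  have E : Hout_hat G Phat = Hout_ring G by rewrite P0 Hout_hat0.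
  (* With [L = 0] the defect is the identity matrix and the term of order [eps^(1/2)] disappears. *)
  split=> //; rewrite -E; apply: (expansion_of z_nonreal Phat_proj phi_basis QK PL).
    by move=> k k'; rewrite /defect L0 !mulmx0 subr0 mxE.
  by exists 1 => eps eps0 _; rewrite L0 eqxx mul0r addr0 powRr1 ?mul1r // ltW.
have D0 := defect_eq0 Phat_proj QK' KQ' PL fr.
have c0 k k' : coef phi Phat k k' = 0 by rewrite cE D0 mxE.
split; first exact: c0.
(* All coefficients vanish, so the zero block is the inner block of the expansion already
   obtained. *)
suff -> : (fun _ _ => gzero (I := iedge G)) = inner_block phi z (coef phi Phat) by [].
apply/funext => eps; apply/funext => f; apply/funext => e; apply/funext => x.
rewrite /inner_block /gzero big1 ?mulr0 // => k _.
by rewrite big1 // => k' _; rewrite c0 !mul0r.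
Qed.
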